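(* Let $\nu > 1/2$ be real and let $m \geq 0$ be an integer with $m \in \{0,1,\dots,[\nu-1/2]\}$ and $2(\nu-m)-1 \neq 0$. Let $\mathbb{P}^{\nu}_m$ be the hyperbolic-type point process on the unit disc $\mathbb{D}$, let $N_r$ be the number of its particles in the disc $D_r = \{z \in \mathbb{C} : |z|<r\}$, $0<r<1$, and let $\mathrm{V}_m^\nu(N_r)$ be the variance of $N_r$ under $\mathbb{P}^{\nu}_m$. Then $$\mathrm{V}_m^\nu(N_r) \sim \frac{C^{\nu}_m}{1-r^2}, \qquad r \to 1^-,$$ where $$C^{\nu}_m = \int_{\mathbb{D}} f_{\nu,m}(d(z,0))\, \arccos(1-2|z|^2)\,\lambda_0(dz).$$ Here $\sim$ means that the ratio of the two sides tends to $1$.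
   Context: Notation: $\mathbb{D}=\{z\in\mathbb{C}:|z|<1\}$; $dz$ is Lebesgue measure on $\mathbb{C}\cong\mathbb{R}^2$; $[x]$ is the largest integer $\le x$; for real $\nu\ge 0$, $\lambda_\nu(dz) := (1-|z|^2)^{2\nu-2}\,dz$ on $\mathbb{D}$, so $\lambda_0(dz) = (1-|z|^2)^{-2}dz$; $P_m^{(\alpha,\beta)}$ is the $m$-th Jacobi polynomial (standard normalization $P_m^{(\alpha,\beta)}(1)=\binom{m+\alpha}{m}$). Determinantal point process: a point process $\mathbb{P}$ on a locally compact Polish space $E$ (a probability measure on locally finite configurations $X\subset E$) is determinantal with correlation kernel $K$ and reference measure $\mu$ if for every $n\ge 1$ and every bounded compactly supported measurable $f:E^n\to\mathbb{C}$, $$\mathbb{E}_{\mathbb{P}}\Big[\sum_{x_1,\dots,x_n\in X} f(x_1,\dots,x_n)\Big]=\int_{E^n} f(x_1,\dots,x_n)\det(K(x_i,x_j))_{1\le i,j\le n}\,d\mu(x_1)\cdots d\mu(x_n),$$ where the sum is over $n$-tuples of pairwise distinct points of $X$. Hyperbolic-type point process: $\mathbb{P}^\nu_m$ is the determinantal point process on $\mathbb{D}$ with reference measure $\lambda_\nu$ and correlation kernel $$G_m^{\nu}(z,w) = \frac{2(\nu-m)-1}{\pi}(1-z\bar{w})^{-2\nu}\left( \frac{|1-z\bar{w}|^2}{(1-|z|^2)(1-|w|^2)}\right)^m P_m^{(0,2(\nu-m)-1)}\left(2\frac{(1-|z|^2)(1-|w|^2)}{|1-z\bar{w}|^2}-1\right).$$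 This is the reproducing kernel of the eigenspace, for the eigenvalue $4m(2\nu-m-1)$, of the self-adjoint operator on $L^2(\mathbb{D},\lambda_\nu)$ extending $H_\nu=-4(1-z\bar z)\big((1-z\bar z)\partial_z\partial_{\bar z}-2\nu\bar z\,\partial_{\bar z}\big)$. Hyperbolic distance: $d(z,w)\ge 0$ is defined for $z,w\in\mathbb{D}$ by $\cosh^2(d(z,w)) = \dfrac{|1-z\overline{w}|^2}{(1-|z|^2)(1-|w|^2)}$ (so $\tanh d(z,0)=|z|$). The function $f_{\nu,m}$ is, for $x\ge 0$, $$f_{\nu,m}(x) := \left[\frac{2(\nu-m)-1}{\pi}(1-\tanh^2(x))^{\nu-m}P_m^{(0,2(\nu-m)-1)}\left(1-2\tanh^2(x)\right)\right]^2.$$ *)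

(* Defs.v *)
(* Points of the complex plane are pairs of reals, which carry the product
   topology, the Borel sigma-algebra and two-dimensional Lebesgue measure;
   [toC] sends a point to the complex number it represents. *)
From HB Require Import structures.
From mathcomp Require Import all_boot all_order all_algebra.
From mathcomp Require Import finmap.
From mathcomp Require Import all_classical all_reals all_analysis.
From mathcomp Require Import measurable_realfun.
From mathcomp Require Import complex.
Set Implicit Arguments.
Unset Strict Implicit.
Unset Printing Implicit Defensive.
Import Order.TTheory GRing.Theory Num.Theory.
Import numFieldNormedType.Exports.
Import ComplexField.Normc.

Local Open Scope classical_set_scope.
Local Open Scope ring_scope.
Local Open Scope complex_scope.

Notation plane R := (measurableTypeR R * measurableTypeR R)%type.

Definition toC (R : realType) (z : plane R) : R[i] := z.1 +i* z.2.

Definition cdisk (R : realType) (r : R) : set (plane R) :=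
  [set z | normc (toC z) < r].

Section lebesgue_plane.
Context (R : realType).

Definition leb2 : set (plane R) -> \bar R :=
  (@lebesgue_measure R \x @lebesgue_measure R)%E.

HB.instance Definition _ := Measure.on leb2.

(* The library's sigma-finiteness instance for products is shadowed by its
   instance for products of probabilities. *)
Let leb2_sigma_finite : sigma_finite setT leb2.
Proof.
have /sigma_finiteP[F [TF ndF Foo]] := sigma_finiteT (@lebesgue_measure R).
exists (fun n => F n `*` F n).
  apply/esym; rewrite -subTset => -[x y] _.
  have [n _ Fx] : (\bigcup_i F i) x by rewrite -TF.
  have [k _ Fy] : (\bigcup_i F i) y by rewrite -TF.
  exists (maxn n k) => //; split => /=.
    by move: x Fx; exact/subsetPset/ndF/leq_maxl.
  by move: y Fy; exact/subsetPset/ndF/leq_maxr.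
move=> k; have [mFk Fkoo] := Foo k; split; first exact: measurableX.
by rewrite /leb2 product_measure1E// lte_mul_pinfty// ge0_fin_numE.
Qed.

HB.instance Definition _ := @Measure_isSigmaFinite.Build _ _ _
  leb2 leb2_sigma_finite.

End lebesgue_plane.
Arguments leb2 {R}.

Section hyperbolic_measure.
Context (R : realType) (nu : R).

Definition hyp_density (z : plane R) : R :=
  (1 - normc (toC z) ^+ 2) `^ (2 * nu - 2).

Definition hyp_measure (A : set (plane R)) : \bar R :=
  (\int[leb2]_(z in A `&` cdisk 1) (hyp_density z)%:E)%E.

Lemma measurable_normc : measurable_fun setT (fun z : plane R => normc (toC z)).
Proof.
rewrite /normc /toC /=.
apply: (measurableT_comp (continuous_measurable_fun (@sqrt_continuous R))).
apply: measurable_funD; apply: measurable_funX.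
  exact: measurable_fst.
exact: measurable_snd.
Qed.

Lemma measurable_cdisk (r : R) : measurable (cdisk r).
Proof.
have := @measurable_normc measurableT `]-oo, r[%classic (measurable_itv _).
rewrite setTI; congr (measurable _).
Qed.

Lemma measurable_hyp_density : measurable_fun setT hyp_density.
Proof.
apply: (measurableT_comp (measurable_powR _)).
by apply: measurable_funB => //; apply: measurable_funX; exact: measurable_normc.
Qed.

Let meas_dens (A : set (plane R)) :
  measurable_fun A (fun z => (hyp_density z)%:E).
Proof.
apply: (@measurable_funS _ _ _ _ setT) => //.
by apply/measurable_EFinP; exact: measurable_hyp_density.
Qed.

Let dens_ge0 z : (0 <= (hyp_density z)%:E)%E.
Proof. by rewrite lee_fin powR_ge0. Qed.

Let hyp_measure0 : hyp_measure set0 = 0%E.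
Proof. by rewrite /hyp_measure set0I integral_set0. Qed.

Let hyp_measure_ge0 A : (0 <= hyp_measure A)%E.
Proof. by apply: integral_ge0 => z _; exact: dens_ge0. Qed.

Let hyp_measure_sigma_additive : semi_sigma_additive hyp_measure.
Proof.
move=> F mF tF mUF; rewrite /hyp_measure setI_bigcupl ge0_integral_bigcup//.
- by apply: is_cvg_nneseries => k _ _; exact: hyp_measure_ge0.
- by move=> k; apply: measurableI => //; exact: measurable_cdisk.
- exact: trivIset_setIr.
Qed.

HB.instance Definition _ := isMeasure.Build _ _ _ hyp_measure
  hyp_measure0 hyp_measure_ge0 hyp_measure_sigma_additive.

Let hyp_measure_sigma_finite : sigma_finite setT hyp_measure.
Proof.
have /sigma_finiteP[F [TF ndF Foo]] := sigma_finiteT (@leb2 R).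
exists (fun n => F n `&` [set z | hyp_density z <= n%:R]).
  apply/esym; rewrite -subTset => z _.
  have [n _ Fnz] : (\bigcup_i F i) z by rewrite -TF.
  pose k := Num.truncn (hyp_density z).
  exists (maxn n k.+1) => //; split.
    by have /subsetPset := ndF _ _ (leq_maxl n k.+1); exact.
  rewrite /=; apply: (@le_trans _ _ k.+1%:R).
    by rewrite ltW// truncnS_gt.
  by rewrite ler_nat leq_maxr.
move=> n; have [mFn Fnoo] := Foo n.
pose D := [set z : plane R | hyp_density z <= n%:R].
have mD : measurable D.
  have := @measurable_hyp_density measurableT `]-oo, n%:R]%classic (measurable_itv _).
  rewrite setTI; congr (measurable _).
have mD1 := measurable_cdisk 1.
split; first exact: measurableI.
rewrite /hyp_measure -/D.
apply: (@le_lt_trans _ _ (\int[leb2]_(z in F n) n%:R%:E)%E).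
  apply: (@le_trans _ _ (\int[leb2]_(z in F n `&` D `&` cdisk 1) n%:R%:E)%E).
    apply: ge0_le_integral => //.
    - by apply: measurableI => //; exact: measurableI.
    - by move=> z [[_ /= ?] _]; rewrite lee_fin.
  apply: ge0_subset_integral => //.
  - by apply: measurableI => //; exact: measurableI.
  - by move=> z [[]].
by rewrite integral_cst// lte_mul_pinfty.
Qed.

HB.instance Definition _ := @Measure_isSigmaFinite.Build _ _ _
  hyp_measure hyp_measure_sigma_finite.

End hyperbolic_measure.

Section power_measure.
Context d (T : measurableType d) (R : realType).

Definition tcons n (p : n.-tuple T * T) : n.+1.-tuple T :=
  [the n.+1.-tuple T of p.2 :: p.1].

Lemma measurable_tcons n : measurable_fun setT (@tcons n).
Proof. exact: measurable_cons. Qed.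

Variable mu : {sigma_finite_measure set T -> \bar R}.

Section cons_measure.
Context n (m : {measure set (n.-tuple T) -> \bar R}).

Definition cons_measure : set (n.+1.-tuple T) -> \bar R :=
  pushforward (m \x mu)%E (@tcons n).

Let cons_measure0 : cons_measure set0 = 0%E.
Proof. by rewrite /cons_measure /pushforward preimage_set0 measure0. Qed.

Let mpre A : measurable A -> measurable (@tcons n @^-1` A).
Proof. by move=> mA; rewrite -[X in measurable X]setTI; exact: measurable_tcons. Qed.

Let cons_measure_ge0 A : (0 <= cons_measure A)%E.
Proof. by rewrite /cons_measure /pushforward. Qed.

Let cons_measure_sigma_additive : semi_sigma_additive cons_measure.
Proof.
move=> F mF tF mUF; rewrite /cons_measure /pushforward preimage_bigcup.
apply: measure_semi_sigma_additive.
- by move=> k; exact: mpre.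
- apply/trivIsetP => /= i j _ _ ij; rewrite -preimage_setI.
  by move/trivIsetP : tF => /(_ _ _ _ _ ij) ->//; rewrite preimage_set0.
- by rewrite -preimage_bigcup; exact: mpre.
Qed.

HB.instance Definition _ := isMeasure.Build _ _ _ cons_measure
  cons_measure0 cons_measure_ge0 cons_measure_sigma_additive.

End cons_measure.

Fixpoint power_measure n : {measure set (n.-tuple T) -> \bar R} :=
  match n return {measure set (n.-tuple T) -> \bar R} with
  | 0 => \d_([tuple] : 0.-tuple T)
  | k.+1 => cons_measure (power_measure k)
  end.

End power_measure.

Section complex_integral.
Context d (T : measurableType d) (R : realType).
Variable mu : {measure set T -> \bar R}.
Implicit Types f : T -> R[i].

Definition cmeasurable f : Prop :=
  measurable_fun setT (fun x => complex.Re (f x)) /\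
  measurable_fun setT (fun x => complex.Im (f x)).

Definition cintegrable f : Prop :=
  mu.-integrable setT (fun x => (complex.Re (f x))%:E) /\
  mu.-integrable setT (fun x => (complex.Im (f x))%:E).

Definition cintegral f : R[i] :=
  (\int[mu]_x complex.Re (f x)) +i* (\int[mu]_x complex.Im (f x)).

End complex_integral.

Section point_process.
Context (R : realType).
Implicit Types (E B : set (plane R)).

(* Locally finite subsets of E; E stands for the whole state space, so that
   only compact sets contained in E are relevant. *)
Definition locally_finite E (X : set (plane R)) : Prop :=
  X `<=` E /\ forall K, compact K -> K `<=` E -> finite_set (X `&` K).

Record configuration E :=
  Configuration { points : set (plane R); pointsP : locally_finite E points }.

Lemma locally_finite0 E : locally_finite E set0.
Proof. by split => // K _ _; rewrite set0I. Qed.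

HB.instance Definition _ E := gen_eqMixin (configuration E).
HB.instance Definition _ E := gen_choiceMixin (configuration E).
HB.instance Definition _ E :=
  isPointed.Build (configuration E) (Configuration (@locally_finite0 E)).

(* Meaningful when X has finitely many points in B (it is 0 otherwise). *)
Definition count_points E B (X : configuration E) : nat :=
  #|` fset_set (points X `&` B)|.

Definition counting_events E : set (set (configuration E)) :=
  [set A | exists B n, [/\ measurable B,
     (exists2 K, compact K & B `<=` K /\ K `<=` E)
     & A = [set X | count_points B X = n]]].

Definition configuration_space E := g_sigma_algebraType (@counting_events E).

Definition distinct_tuples n (X : set (plane R)) : set (n.-tuple (plane R)) :=
  [set t | uniq t /\ [set` t] `<=` X].

(* Every compact subset of E^n is contained in K^n for some compact K in E. *)
Definition test_function E n (f : n.-tuple (plane R) -> R[i]) : Prop :=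
  [/\ cmeasurable f,
      exists M : R, forall t, normc (f t) <= M
    & exists K, [/\ compact K, K `<=` E
        & forall t, f t != 0 -> [set` t] `<=` K]].

(* The reference measure mu lives on the whole plane; since test functions
   vanish outside E^n, only its restriction to E matters.  The existence of
   both sides is part of the defining identity. *)
Definition determinantal E (mu : {sigma_finite_measure set (plane R) -> \bar R})
    (K : plane R -> plane R -> R[i])
    (P : probability (configuration_space E) R) : Prop :=
  forall n (f : n.-tuple (plane R) -> R[i]), (0 < n)%N -> test_function E f ->
  let S (X : configuration_space E) :=
    \sum_(t \in distinct_tuples (points X)) f t in
  let F t := f t * \det (\matrix_(i < n, j < n) K (tnth t i) (tnth t j)) in
  [/\ cintegrable P S, cintegrable (power_measure mu n) F
    & cintegral P S = cintegral (power_measure mu n) F].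

End point_process.

Section special_functions.
Context (R : realType).
Implicit Types (a b x : R) (w : R[i]).

Definition gbinomial a k : R := (\prod_(i < k) (a - i%:R)) / k`!%:R.

(* P_m^(a,b)(x)
   = sum_s C(m+a, m-s) C(m+b, s) ((x-1)/2)^s ((x+1)/2)^(m-s),
   so that P_m^(a,b)(1) = C(m+a, m). *)
Definition jacobi m a b x : R :=
  \sum_(s < m.+1) gbinomial (m%:R + a) (m - s) * gbinomial (m%:R + b) s
    * ((x - 1) / 2) ^+ s * ((x + 1) / 2) ^+ (m - s).

(* Principal argument, with values in ]-pi, pi] (for w != 0). *)
Definition carg w : R :=
  if 0 <= complex.Im w then acos (complex.Re w / normc w)
  else - acos (complex.Re w / normc w).

(* Principal branch of w^a. *)
Definition cpow w a : R[i] :=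
  (normc w `^ a)%:C * (cos (a * carg w) +i* sin (a * carg w)).

Definition cosh x : R := (expR x + expR (- x)) / 2.
Definition sinh x : R := (expR x - expR (- x)) / 2.
Definition tanh x : R := sinh x / cosh x.

End special_functions.

Section hyperbolic_process.
Context (R : realType).
Implicit Types (nu : R) (m : nat) (z w : plane R).

Definition cosh2_dist z w : R :=
  normc (1 - toC z * (toC w)^*) ^+ 2
  / ((1 - normc (toC z) ^+ 2) * (1 - normc (toC w) ^+ 2)).

(* On the open disk cosh2_dist is at least 1, so exactly one d qualifies. *)
Definition hyp_dist z w : R :=
  get [set d : R | 0 <= d /\ cosh d ^+ 2 = cosh2_dist z w].

(* The principal branch is unambiguous here: 1 - z w^* has positive real part
   when z and w are in the open disk. *)
Definition hyp_kernel nu m z w : R[i] :=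
  ((2 * (nu - m%:R) - 1) / pi)%:C
  * cpow (1 - toC z * (toC w)^*) (- (2 * nu))
  * (cosh2_dist z w ^+ m
     * jacobi m 0 (2 * (nu - m%:R) - 1)
         (2 * ((1 - normc (toC z) ^+ 2) * (1 - normc (toC w) ^+ 2)
               / normc (1 - toC z * (toC w)^*) ^+ 2) - 1))%:C.

Definition hyperbolic_type_process nu m
    (P : probability (configuration_space (@cdisk R 1)) R) : Prop :=
  determinantal (hyp_measure nu) (hyp_kernel nu m) P.

Definition number_in_disk (r : R)
    (X : configuration_space (@cdisk R 1)) : R :=
  (count_points (cdisk r) X)%:R.

Definition f_ nu m (x : R) : R :=
  ((2 * (nu - m%:R) - 1) / pi * (1 - tanh x ^+ 2) `^ (nu - m%:R)
   * jacobi m 0 (2 * (nu - m%:R) - 1) (1 - 2 * tanh x ^+ 2)) ^+ 2.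

Definition variance_constant nu m : R :=
  \int[hyp_measure 0]_(z in cdisk 1)
    (f_ nu m (hyp_dist z (0, 0)) * acos (1 - 2 * normc (toC z) ^+ 2)).

End hyperbolic_process.

(* Main.v *)
(* For a determinantal process with kernel K the number of points in D_r has
   variance int_{D_r} K(z,z) - int int_{D_r x D_r} |K(z,w)|^2.  The kernel
   reproduces: int_D |K(z,w)|^2 dw = K(z,z).  Hence the variance is the integral
   of |K(z,w)|^2 over z in D_r and w in D \ D_r.  In terms of lambda_0 the
   integrand is H(v) with v = cosh^-2 d(z,w) and H(cosh^-2 d) = f_{nu,m}(d).

   Reproducing property: by invariance, int_D H(cosh^-2 d(z,w)) lambda_0(dw)
   does not depend on z and equals pi int_0^1 H(v) v^-2 dv, and this is computed
   from int_0^1 v^(b-1) P_m^(0,b)(2v-1)^2 dv = 1/b.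

   Asymptotics: with e = 1 - r^2, put 1 - |z|^2 = c, 1 - |w|^2 = c s and
   tan(theta/2) = c l, where c = e/a and theta is the angle between z and w.
   Multiplied by e, the integrand has a limit as e -> 0 and is dominated by a
   constant times s^(2(nu-m)-2) / (1 + l^2).  Integrating the limit gives
   2 pi int_0^1 H(v) v^-2 arctan(sqrt(1/v - 1)) dv, which is C because
   arccos(2v - 1) = 2 arctan(sqrt(1/v - 1)). *)
Require Import Defs.
From HB Require Import structures.
From mathcomp Require Import all_boot all_order all_algebra.
From mathcomp Require Import finmap.
From mathcomp Require Import all_classical all_reals all_analysis.
From mathcomp Require Import measurable_realfun.
From mathcomp Require Import complex ring lra.
Set Implicit Arguments.
Unset Strict Implicit.
Unset Printing Implicit Defensive.
Import Order.TTheory GRing.Theory Num.Theory.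
Import numFieldNormedType.Exports.
Import ComplexField.Normc.
Local Open Scope classical_set_scope.
Local Open Scope ring_scope.

(** * Integration with a density and substitutions on the line *)

(** The geometric integrals have nonnegative integrands and values in the extended reals, so
    substitutions and exchanges of order need only measurability. Finiteness matters at two points:
    the double integral over [D_r x D_r] must be finite to be cancelled, which the determinantal
    identity itself supplies, and the limit needs an integrable bound. Substitutions in the plane
    are composed of substitutions on the line. The coordinates [|z|^2] and [tan(theta/2)] keep them
    rational up to a square root. Disk automorphisms are avoided in the same spirit: a rotation
    moves the centre to a point [p] of the real axis, and an inversion followed by a scaling removes
    [p] from the integral. Everything rests on the strict inequality [nu - m > 1/2], that is
    [b = 2 (nu - m) - 1 > 0]. It makes [v^(b-1)] integrable at 0, which is needed both for the norm
    of the Jacobi polynomial and for the dominating function. It also makes the integral [b / pi^2]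
    of [H(v) v^-2] positive, hence [C > 0], so that dividing by [C] is legitimate. *)

Section density.
Context d (T : measurableType d) (R : realType).
Variables (mu nu : {measure set T -> \bar R}) (w : T -> \bar R).
Hypotheses (mw : measurable_fun setT w) (w0 : forall x, (0 <= w x)%E).
Hypothesis wfin : forall x, w x \is a fin_num.
Hypothesis nuE : forall A, measurable A -> nu A = (\int[mu]_(x in A) w x)%E.
Import HBNNSimple.
Local Open Scope ereal_scope.

(** The identity holds for indicators by [nuE], for simple functions by linearity, and in general by
    monotone convergence. Finiteness of [w] lets the increasing limit pass through the product with
    [w x]. No sigma-finiteness is assumed of either measure. *)
Lemma ge0_integral_density (f : T -> \bar R) :
  measurable_fun setT f -> (forall x, 0 <= f x) ->
  \int[nu]_x f x = \int[mu]_x (f x * w x).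
Proof.
move=> mf f0.
pose h := nnsfun_approx measurableT mf.
have -> : \int[nu]_x f x = limn (fun n => \int[nu]_x (EFin \o h n) x).
  have fE x : f x = limn (fun n => (EFin \o h n) x).
    by apply/esym/cvg_lim => //; exact: cvg_nnsfun_approx.
  under eq_integral => x _ do rewrite fE.
  apply: monotone_convergence => //.
  - by move=> n; apply/measurable_EFinP.
  - by move=> n x _ /=; rewrite lee_fin.
  - by move=> x _ a b ab; rewrite lee_fin; exact/lefP/nd_nnsfun_approx.
have -> : \int[mu]_x (f x * w x) = limn (fun n => \int[mu]_x ((h n x)%:E * w x)).
  have fE x : f x * w x = limn (fun n => (h n x)%:E * w x).
    by apply/esym/cvg_lim => //; apply: cvgeZr => //; exact: cvg_nnsfun_approx.
  under eq_integral => x _ do rewrite fE.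
  apply: monotone_convergence => //.
  - by move=> n; apply: emeasurable_funM => //; apply/measurable_EFinP.
  - by move=> n x _ /=; rewrite mule_ge0 ?lee_fin.
  - move=> x _ a b ab; rewrite lee_wpmul2r// lee_fin.
    exact/lefP/nd_nnsfun_approx.
suff suf n : \int[nu]_x (EFin \o h n) x = \int[mu]_x ((h n x)%:E * w x).
  by congr (limn _); apply/funext => n; exact: suf.
rewrite [LHS](_ : _ = \int[nu]_x
   (\sum_(y \in range (h n)) (y * \1_(h n @^-1` [set y]) x)%:E)); last first.
  by apply: eq_integral => t tE; rewrite /= fimfunE -fsumEFin.
rewrite [RHS](_ : _ = \int[mu]_x
   (\sum_(y \in range (h n)) ((y * \1_(h n @^-1` [set y]) x)%:E * w x))); last first.
  apply: eq_integral => t tE.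
  rewrite -ge0_mule_fsuml => [|y]; last exact: nnfun_muleindic_ge0.
  by rewrite fsumEFin// fimfunE.
have mi r : measurable_fun setT (fun x => (r * \1_(h n @^-1` [set r]) x)%:E).
  by apply/measurable_EFinP; apply: measurable_funM.
rewrite ge0_integral_fsum//; last by move=> y x _; exact: nnfun_muleindic_ge0.
rewrite ge0_integral_fsum//; last 2 first.
  - by move=> y; apply: emeasurable_funM.
  - by move=> y x _; rewrite mule_ge0// nnfun_muleindic_ge0.
apply: eq_fsbigr => r /[!inE] -[z _ <-].
have hz0 : (0 <= h n z)%R by [].
rewrite integralZl_indic_nnsfun//= integral_indic//= setIT nuE//.
rewrite integral_mkcond -ge0_integralZl//; last 2 first.
- apply/(measurable_restrictT _ _).1 => //. exact: measurable_funTS.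
- by move=> x _; apply: erestrict_ge0.
apply: eq_integral => x _; rewrite EFinM -muleA; congr (_ * _).
by rewrite epatch_indic muleC.
Qed.
End density.

Section density_measure.
Context d (T : measurableType d) (R : realType).
Variables (mu : {measure set T -> \bar R}) (w : T -> \bar R).
Hypotheses (mw : measurable_fun setT w) (w0 : forall x, (0 <= w x)%E).

(** The two proofs are arguments so that the measure structure can be inferred from the term
    itself. *)
Definition density_measure (_ : measurable_fun setT w)
  (_ : forall x, (0 <= w x)%E) (A : set T) : \bar R :=
  (\int[mu]_(x in A) w x)%E.

Local Notation nu := (density_measure mw w0).

Let nu0 : nu set0 = 0%E. Proof. exact: integral_set0. Qed.

Let nu_ge0 A : (0 <= nu A)%E. Proof. exact: integral_ge0. Qed.

Let nu_sigma : semi_sigma_additive nu.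
Proof. exact: semi_sigma_additive_nng_induced. Qed.

HB.instance Definition _ := isMeasure.Build _ _ _ nu nu0 nu_ge0 nu_sigma.
End density_measure.

(** The set [J] is null for the measure restricted to its complement, and off [J] the integrand
    vanishes. *)
Lemma integral_mrestrC d (T : measurableType d) (R : realType)
    (m : {measure set T -> \bar R}) (J : set T) (mJ : measurable J)
    (g : T -> \bar R) :
  measurable_fun setT (g \_ J) -> (forall x, 0 <= (g \_ J) x)%E ->
  (\int[mrestr m (measurableC mJ)]_x (g \_ J) x = 0)%E.
Proof.
move=> mg g0; rewrite (ge0_negligible_integral mJ)//.
  apply: integral0_eq => x [_ nJx]; rewrite patchE.
  by case: ifPn => // /set_mem.
by rewrite /= /mrestr setICr measure0.
Qed.

(** * Change of variables along an increasing map of an open interval *)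

Section change_of_variables.
Context (R : realType).
Local Notation mu := (@lebesgue_measure R).
Variables (I : set R) (phi dphi : R -> R) (a b : R^nat).
Hypotheses (oI : open I) (ab : forall n, a n < b n).
Hypothesis ndI : nondecreasing_seq (fun n => `[a n, b n]%classic).
Hypothesis IE : I = \bigcup_n `[a n, b n]%classic.
Hypothesis mono : forall x y, I x -> I y -> x < y -> phi x < phi y.
Hypothesis dphiP : forall x, I x -> is_derive x 1 phi (dphi x).
Hypothesis cdphi : forall x, I x -> {for x, continuous dphi}.
Hypothesis dphi0 : forall x, I x -> 0 <= dphi x.

Let I_itv x y z : I x -> I y -> x <= z <= y -> I z.
Proof.
rewrite IE => -[n _ /= nx] [k _ /= ky] /andP[xz zy].
exists (maxn n k) => //.
have h1 := ndI (leq_maxl n k); rewrite subsetEset in h1.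
have h2 := ndI (leq_maxr n k); rewrite subsetEset in h2.
move: (h1 _ nx) (h2 _ ky); rewrite /= !in_itv/= => /andP[ax _] /andP[_ yb].
by rewrite (le_trans ax)//= (le_trans zy).
Qed.

Let mono_le x y : I x -> I y -> x <= y -> phi x <= phi y.
Proof.
move=> Ix Iy; rewrite le_eqVlt => /predU1P[->//|xy].
by rewrite ltW// mono.
Qed.

Let cphi x : I x -> {for x, continuous phi}.
Proof.
by move=> Ix; apply: differentiable_continuous; apply/derivable1_diffP; case: (dphiP Ix).
Qed.

Let mphi : measurable_fun I phi.
Proof. by apply: open_continuous_measurable_fun => // x /set_mem; exact: cphi. Qed.

Let mdphi : measurable_fun I dphi.
Proof. by apply: open_continuous_measurable_fun => // x /set_mem; exact: cdphi. Qed.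

Let mI : measurable I. Proof. exact: open_measurable. Qed.

Let ftc x y : I x -> I y -> x <= y ->
  (\int[mu]_(z in `[x, y]) (dphi z)%:E = (phi y - phi x)%:E)%E.
Proof.
move=> Ix Iy; rewrite le_eqVlt => /predU1P[->|xy].
  by rewrite set_itv1 integral_set1 subrr.
have Ixy z : x <= z <= y -> I z by exact: I_itv.
rewrite (@continuous_FTC2 _ _ phi)//.
- apply: continuous_in_subspaceT => z /set_mem/=; rewrite in_itv/= => /Ixy.
  exact: cdphi.
- split.
  + move=> z; rewrite in_itv/= => /andP[xz zy].
    by have /dphiP[] : I z by apply: Ixy; rewrite !ltW.
  + by apply: cvg_at_right_filter; exact: cphi.
  + by apply: cvg_at_left_filter; exact: cphi.
- move=> z; rewrite in_itv/= => /andP[xz zy].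
  rewrite derive1E; have /dphiP[_ ->//] : I z by apply: Ixy; rewrite !ltW.
Qed.

Let Iab n x : a n <= x <= b n -> I x.
Proof. by move=> axb; rewrite IE; exists n => //=; rewrite in_itv/=. Qed.

Let ivt n c : phi (a n) <= c <= phi (b n) -> exists2 x, a n <= x <= b n & phi x = c.
Proof.
move=> cab.
have abn := ltW (ab n).
have phiab : phi (a n) <= phi (b n).
  by have /andP[] := cab; exact: le_trans.
have [||x] := @IVT R phi (a n) (b n) c abn.
- by apply: continuous_in_subspaceT => z /set_mem/=; rewrite in_itv/= => /Iab/cphi.
- by rewrite (min_idPl phiab) (max_idPr phiab).
- by rewrite in_itv/= => axb <-; exists x.
Qed.

(** On a compact piece the fundamental theorem of calculus computes the left side, once the preimage
    of []s, t]] is known to be an interval up to its end points. *)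
Let piece n (s t : R) :
  (\int[mu]_(x in `[a n, b n] `&` phi @^-1` `]s, t]) (dphi x)%:E =
  mu (`[phi (a n), phi (b n)] `&` `]s, t]))%E.
Proof.
have abn := ltW (ab n).
have Ia : I (a n) by apply: (@Iab n); rewrite lexx.
have Ib : I (b n) by apply: (@Iab n); rewrite lexx andbT.
have sub : `[a n, b n] `&` phi @^-1` `]s, t] `<=`
    phi @^-1` (`[phi (a n), phi (b n)] `&` `]s, t]).
  move=> x /= [/[!in_itv]/= /andP[ax xb]] /andP[sx xt].
  have Ix : I x by apply: (@Iab n); rewrite ax.
  by rewrite !mono_le// sx.
have mF : measurable (`[a n, b n] `&` phi @^-1` `]s, t]).
  have := @measurable_funS _ _ _ _ I `[a n, b n]%classic phi mI.
  apply => //; first by move=> x /=; rewrite in_itv/=; exact: Iab.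
(* These are the end points of the intersection. With preimages [x0] and [x1] from the intermediate
   value theorem, the domain of integration lies between []x0, x1[] and [[x0, x1]], which carry the
   same mass [e - c]. *)
set c := Num.max s (phi (a n)); set e := Num.min t (phi (b n)).
have [ce|ec] := leP c e; last first.
  have G0 : `[phi (a n), phi (b n)] `&` `]s, t] = set0.
    rewrite -subset0 => y /= [/[!in_itv]/= /andP[ay yb]] /andP[sy yt].
    have : c <= e.
      rewrite /c /e ge_max !le_min.
      by rewrite (le_trans (ltW sy) yt) (le_trans (ltW sy) yb) (le_trans ay yt) (le_trans ay yb).
    by rewrite leNgt ec.
  have -> : `[a n, b n] `&` phi @^-1` `]s, t] = set0.
    by rewrite -subset0 => x /sub; rewrite G0.
  by rewrite G0 integral_set0 measure0.
have /ivt[x0 x0ab px0] : phi (a n) <= c <= phi (b n).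
  by rewrite le_max lexx orbT/= (le_trans ce)// ge_min lexx orbT.
have /ivt[x1 x1ab px1] : phi (a n) <= e <= phi (b n).
  by rewrite ge_min lexx orbT andbT (le_trans _ ce)// le_max lexx orbT.
have I0 := Iab x0ab; have I1 := Iab x1ab.
have x01 : x0 <= x1.
  rewrite leNgt; apply/negP => /(mono I1 I0); rewrite px0 px1.
  by rewrite ltNge ce.
have Gle : `]c, e[ `<=` `[phi (a n), phi (b n)] `&` `]s, t].
  move=> y/=; rewrite !in_itv/= gt_max lt_min => /andP[/andP[sy ay] /andP[yt yb]].
  by rewrite sy !ltW.
have Gge : `[phi (a n), phi (b n)] `&` `]s, t] `<=` `[c, e].
  move=> y/= [/[!in_itv]/= /andP[ay yb] /andP[sy yt]].
  by rewrite ge_max le_min ay yb yt (ltW sy).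
have Fle : `]x0, x1[ `<=` `[a n, b n] `&` phi @^-1` `]s, t].
  move=> x /=; rewrite in_itv/= => /andP[xx0 xx1].
  have axb : a n <= x <= b n.
    have /andP[? _] := x0ab; have /andP[_ ?] := x1ab.
    by rewrite (le_trans _ (ltW xx0))//= (le_trans (ltW xx1)).
  split; first by rewrite in_itv.
  have [] // : (`[phi (a n), phi (b n)] `&` `]s, t]) (phi x).
  by apply: Gle; rewrite /= in_itv/= -px0 -px1 !mono//; exact: Iab axb.
have Fge : `[a n, b n] `&` phi @^-1` `]s, t] `<=` `[x0, x1].
  move=> x Fx; have /Gge := sub _ Fx; rewrite /= !in_itv/= -px0 -px1 => /andP[h1 h2].
  have [+ _] := Fx; rewrite /= in_itv/= => /Iab Ix.
  by apply/andP; split; rewrite leNgt; apply/negP => /mono; [move=> /(_ Ix I0)|move=> /(_ I1 Ix)];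
    rewrite ltNge ?h1 ?h2.
have x01I : `[x0, x1] `<=` I.
  by move=> x /=; rewrite in_itv/=; exact: I_itv.
have mfI D : measurable D -> D `<=` I -> measurable_fun D (fun x => (dphi x)%:E).
  move=> mD DI; apply: (measurable_funS mI) => //.
  exact/measurable_EFinP.
transitivity ((e - c)%:E).
  apply/eqP; rewrite eq_le; apply/andP; split.
    apply: (@le_trans _ _ (\int[mu]_(x in `[x0, x1]) (dphi x)%:E)%E).
      apply: ge0_subset_integral => //; first exact: mfI.
      by move=> x /x01I/dphi0; rewrite lee_fin.
    by rewrite ftc// px0 px1.
  apply: (@le_trans _ _ (\int[mu]_(x in `]x0, x1[) (dphi x)%:E)%E).
    rewrite -px0 -px1 -ftc// (@integral_itv_bndoo _ _ _ _ true false)//.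
    by apply: mfI => // x /=; rewrite in_itv/= => /andP[? ?]; apply: x01I; rewrite /= in_itv/= !ltW.
  apply: ge0_subset_integral => //.
    by apply: mfI => //; apply: subset_trans Fge _.
  by move=> x /Fge/x01I/dphi0; rewrite lee_fin.
apply/esym/eqP; rewrite eq_le; apply/andP; split.
  apply: (@le_trans _ _ (mu `[c, e]%classic)).
    by apply: le_measure => //; rewrite inE//; exact: measurableI.
  rewrite lebesgue_measure_itv/= lte_fin; case: ltP => [_|_].
    by rewrite -EFinB.
  by rewrite lee_fin subr_ge0.
apply: (@le_trans _ _ (mu `]c, e[%classic)).
  rewrite lebesgue_measure_itv/= lte_fin; case: ltP => [_|ec].
    by rewrite -EFinB.
  by rewrite lee_fin subr_le0.
by apply: le_measure => //; rewrite inE//; exact: measurableI.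
Qed.

Let J : set R := phi @` I.

Let JE : J = \bigcup_n `[phi (a n), phi (b n)]%classic.
Proof.
apply/seteqP; split => [_ [x + <-]|y [n _ /=]].
  rewrite {1}IE => -[n _ /=]; rewrite in_itv/= => axb; exists n => //=.
  have Ix := Iab axb; have abn := ltW (ab n).
  have Ia : I (a n) by apply: (@Iab n); rewrite lexx.
  have Ib : I (b n) by apply: (@Iab n); rewrite lexx andbT.
  by have /andP[? ?] := axb; rewrite in_itv/= !mono_le.
by rewrite in_itv/= => /ivt[x /Iab Ix <-]; exists x.
Qed.

Let mJ : measurable J.
Proof. by rewrite JE; exact: bigcup_measurable. Qed.

(** Both sides are increasing limits of the two sides of [piece] along the exhaustion of [I]. *)
Let ocitv_mass (s t : R) :
  (\int[mu]_(x in I `&` phi @^-1` `]s, t]) (dphi x)%:E =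
  mu (J `&` `]s, t]))%E.
Proof.
pose F n := `[a n, b n]%classic `&` phi @^-1` `]s, t]%classic.
pose G n := `[phi (a n), phi (b n)]%classic `&` `]s, t]%classic.
have FE : I `&` phi @^-1` `]s, t] = \bigcup_n F n by rewrite IE setI_bigcupl.
have GE : J `&` `]s, t] = \bigcup_n G n by rewrite JE setI_bigcupl.
have mF n : measurable (F n).
  have := @measurable_funS _ _ _ _ I `[a n, b n]%classic phi mI.
  apply => //; by move=> x /=; rewrite in_itv/=; exact: Iab.
have FI n : F n `<=` I by move=> x [+ _]; rewrite /= in_itv/=; exact: Iab.
have c1 : (\int[mu]_(x in F n) (dphi x)%:E @[n --> \oo] -->
    \int[mu]_(x in \bigcup_n F n) (dphi x)%:E)%E.
  apply: ge0_nondecreasing_set_cvg_integral => //.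
  - move=> n k nk; rewrite subsetEset; apply: setSI.
    by rewrite -subsetEset; exact: ndI.
  - by move=> n; apply: (measurable_funS mI) => //; exact/measurable_EFinP.
  - by move=> n x /FI/dphi0; rewrite lee_fin.
have c2 : (mu (G n) @[n --> \oo] --> mu (\bigcup_n G n))%E.
  apply: nondecreasing_cvg_mu => //.
  - by move=> n; exact: measurableI.
  - by rewrite -GE; exact: measurableI.
  - move=> n k nk; rewrite subsetEset; apply: setSI => x /=.
    have Ia i : I (a i) by apply: (@Iab i); rewrite lexx (ltW (ab i)).
    have Ib i : I (b i) by apply: (@Iab i); rewrite lexx (ltW (ab i)).
    have h := ndI nk; rewrite subsetEset in h.
    have := h (a n); have := h (b n); rewrite /= !in_itv/= !lexx (ltW (ab n))/=.
    move=> /(_ isT)/andP[_ bk] /(_ isT)/andP[ak _] /andP[ax xb].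
    by rewrite (le_trans _ ax) ?(le_trans xb)// mono_le.
rewrite FE GE; apply: cvg_unique c2 => //.
suff -> : (fun n => mu (G n)) = (fun n => \int[mu]_(x in F n) (dphi x)%:E)%E by [].
by apply/funext => n; rewrite /F piece.
Qed.

Let w : R -> \bar R := (EFin \o dphi) \_ I.

Let mw : measurable_fun setT w.
Proof.
apply: (measurable_restrictT _ mI).1.
by apply/measurable_EFinP; exact: mdphi.
Qed.

Let w0 x : (0 <= w x)%E.
Proof. by apply: erestrict_ge0 => {}x Ix; rewrite lee_fin dphi0. Qed.

(** A push-forward needs a map defined everywhere. The value 0 outside [I] is harmless because the
    density [w] vanishes there. *)
Let phiI : measurableTypeR R -> measurableTypeR R := phi \_ I.

Let mphiI : measurable_fun setT phiI.
Proof. by apply: (measurable_restrictT _ mI).1; exact: mphi. Qed.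

Let nu := density_measure mu mw w0.
Let nu1 := measure_function_pushforward__canonical__measure_function_Measure nu mphiI.
(** The push-forward lives on [J] only. Lebesgue measure off [J] is added to obtain a measure on the
    whole line that can be compared with [mu]. *)
Let nu' := measure_add nu1 (mrestr mu (measurableC mJ)).

(** By [ocitv_mass] the measure [nu'] gives every half-open interval its length, so it is Lebesgue
    measure by uniqueness. Integrating [g] cut off to [J] against it gives the formula. *)
Lemma ge0_integral_change_of_variables (g : R -> \bar R) :
  measurable_fun setT g -> (forall y, 0 <= g y)%E ->
  (\int[mu]_(y in phi @` I) g y = \int[mu]_(x in I) (g (phi x) * (dphi x)%:E))%E.
Proof.
move=> mg g0; rewrite -/J.
have mugE A : measurable A -> mu A = nu' A.
  apply: lebesgue_measure_unique => _ [[s t] _ <-].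
  rewrite [RHS]measure_addE /=.
  have -> : pushforward nu phiI `]s, t] =
      (\int[mu]_(x in I `&` phi @^-1` `]s, t]) (dphi x)%:E)%E.
    rewrite /pushforward /nu /density_measure /w.
    rewrite -integral_mkcondr [in RHS]setIC.
    congr (integral _ _ _); apply/seteqP; split => x [px Ix];
      by split=> //; move: px; rewrite /= /phiI patchE mem_set.
  rewrite ocitv_mass /mrestr -measureU//.
  - by rewrite [J `&` _]setIC -setIUr setUv setIT.
  - exact: measurableI.
  - by apply: measurableI => //; exact: measurableC.
  - by rewrite [J `&` _]setIC setIACA setICr setI0.
pose mJC := measurableC mJ.
have mgJ : measurable_fun setT (g \_ J).
  by apply: (measurable_restrictT _ mJ).1; exact: measurable_funTS.
have gJ0 x : (0 <= (g \_ J) x)%E by apply: erestrict_ge0.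
rewrite integral_mkcond (eq_measure_integral nu'); last by move=> A mA _; exact: mugE.
rewrite ge0_integral_measure_add//.
rewrite [X in (_ + X)%E](_ : _ = 0%E) ?adde0; last first.
  exact: integral_mrestrC.
rewrite (ge0_integral_pushforward mphiI)//.
rewrite preimage_setT (@ge0_integral_density _ _ _ mu nu w)//; last first.
- by move=> x /=; exact: gJ0.
- exact: measurableT_comp mgJ mphiI.
- by move=> x; rewrite /w patchE; case: ifPn.
rewrite [RHS]integral_mkcond; apply: eq_integral => x _.
rewrite /w /phiI /= !patchE; have [xI|xI] := boolP (x \in I); last by rewrite mule0.
have Jx : J (phi x) by exists x => //; exact: set_mem.
by rewrite (mem_set Jx).
Qed.

End change_of_variables.

Section substitutions.
Context (R : realType).
Local Notation mu := (@lebesgue_measure R).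
Implicit Types g : R -> \bar R.

Lemma ge0_integral_oppr g (A : set R) : measurable A ->
  measurable_fun setT g -> (forall y, 0 <= g y)%E ->
  (\int[mu]_(y in A) g y = \int[mu]_(x in -%R @^-1` A) g (- x)%R)%E.
Proof.
move=> mA mg g0.
have mN : measurable_fun setT (-%R : measurableTypeR R -> measurableTypeR R).
  exact: measurable_funN.
have -> : (\int[mu]_(y in A) g y =
    \int[pushforward mu (-%R : measurableTypeR R -> measurableTypeR R)]_(y in A) g y)%E.
  by apply: eq_measure_integral => B mB _; exact/esym/lebesgue_measureN.
rewrite (ge0_integral_pushforward mN)//.
exact: measurable_funTS.
Qed.

Let nd_itv (a b : R^nat) : {homo a : n m / (n <= m)%N >-> m <= n} ->
  {homo b : n m / (n <= m)%N >-> n <= m} ->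
  nondecreasing_seq (fun n => `[a n, b n]%classic).
Proof.
move=> da ib n m nm; rewrite subsetEset => x /=; rewrite !in_itv/= => /andP[ax xb].
by rewrite (le_trans (da _ _ nm))//= (le_trans xb)// ib.
Qed.

(** The offset 3 makes [1/(n+3) < 1/2], so that [[1/(n+3), 1 - 1/(n+3)]] is nondegenerate already
    for [n = 0]. *)
Let inv2_gt0 (n : nat) : 0 < n.+3%:R^-1 :> R. Proof. by rewrite invr_gt0. Qed.

Let inv2_lt (n : nat) : n.+3%:R^-1 < 2^-1 :> R.
Proof. by rewrite ltf_pV2 ?posrE// ltr_nat. Qed.

Let inv2_nd : {homo (fun n => n.+3%:R^-1 : R) : n m / (n <= m)%N >-> m <= n}.
Proof. by move=> n m nm; rewrite lef_pV2 ?posrE// ler_nat !ltnS. Qed.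

Let arch (x : R) : 0 < x -> exists n, n.+3%:R^-1 <= x.
Proof.
move=> x0; exists (Num.truncn x^-1); rewrite -[leRHS]invrK lef_pV2 ?posrE ?invr_gt0//.
by rewrite (le_trans (ltW (truncnS_gt _)))// ler_nat ltnS leqW.
Qed.

Inductive cov_domain : set R -> Prop :=
| CovDomain0y : cov_domain `]0, +oo[
| CovDomain01 : cov_domain `]0, 1[
| CovDomainT : cov_domain setT.

Lemma cov_domainP (I : set R) : cov_domain I -> open I /\ exists a b : R^nat,
  [/\ forall n, a n < b n, nondecreasing_seq (fun n => `[a n, b n]%classic)
    & I = \bigcup_n `[a n, b n]%classic].
Proof.
case.
- split; first exact: interval_open.
  exists (fun n => n.+3%:R^-1), (fun n => n.+3%:R); split.
  + by move=> n; rewrite (lt_trans (inv2_lt n))// (@lt_trans _ _ 1)// ?invf_lt1// ltr1n.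
  + by apply: nd_itv => // n m nm; rewrite ler_nat !ltnS.
  + apply/seteqP; split => [x/=|x [n _ /=]]; rewrite !in_itv/= ?andbT; last first.
      by move=> /andP[+ _]; exact: lt_le_trans.
    move=> x0; have [n nx] := arch x0.
    have [k xk] : exists k, x <= k.+3%:R.
      exists (Num.truncn x); rewrite (le_trans (ltW (truncnS_gt _)))// ler_nat.
      by rewrite ltnS leqW.
    exists (maxn n k) => //=; rewrite in_itv/= (le_trans _ nx)/=.
      by rewrite (le_trans xk)// ler_nat !ltnS leq_maxr.
    by apply: inv2_nd; rewrite leq_maxl.
- split; first exact: interval_open.
  exists (fun n => n.+3%:R^-1), (fun n => 1 - n.+3%:R^-1); split.
  + by move=> n /=; have := inv2_lt n; move: (n.+3%:R^-1) => u; lra.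
  + apply: nd_itv => // n m nm; rewrite lerD2l lerN2; exact: inv2_nd.
  + apply/seteqP; split => [x/=|x [n _ /=]]; rewrite !in_itv/= ; last first.
      by have := inv2_gt0 n; move: (n.+3%:R^-1) => u; lra.
    move=> /andP[x0 x1]; have [n nx] := arch x0.
    have [|k kx] := @arch (1 - x); first lra.
    exists (maxn n k) => //=; rewrite in_itv/= (le_trans _ nx)/=; last first.
      by apply: inv2_nd; rewrite leq_maxl.
    by have := inv2_nd (leq_maxr n k); move: kx => /=; move: ((maxn n k).+3%:R^-1) (k.+3%:R^-1) => u v; lra.
- split; first exact: openT.
  exists (fun n => - n.+1%:R), (fun n => n.+1%:R); split.
  + by move=> n; rewrite (@lt_trans _ _ 0)// oppr_lt0.
  + apply: nd_itv => n m nm; first by rewrite lerN2 ler_nat ltnS.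
    by rewrite ler_nat ltnS.
  + apply/seteqP; split => // x _.
    exists (Num.truncn `|x|) => //=; rewrite in_itv/= -ler_norml.
    exact/ltW/truncnS_gt.
Qed.

Section monotone.
Variables (I J : set R) (phi dphi : R -> R).
Hypothesis dI : cov_domain I.
Hypothesis IJ : forall x, I x -> J (phi x).
Hypothesis JI : forall y, J y -> exists2 x, I x & phi x = y.
Hypothesis dphiP : forall x, I x -> is_derive x 1 phi (dphi x).
Hypothesis cdphi : forall x, I x -> {for x, continuous dphi}.

Let JE : J = phi @` I.
Proof.
by apply/seteqP; split => [y /JI[x Ix <-]|_ [x /IJ ? <-]//]; exists x.
Qed.

Lemma increasing_cov g :
  (forall x y, I x -> I y -> x < y -> phi x < phi y) ->
  (forall x, I x -> 0 <= dphi x) ->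
  measurable_fun setT g -> (forall y, 0 <= g y)%E ->
  (\int[mu]_(y in J) g y = \int[mu]_(x in I) (g (phi x) * (dphi x)%:E))%E.
Proof.
move=> mono dphi0 mg g0; have [oI [a [b [ab ndI IE]]]] := cov_domainP dI.
by rewrite JE; exact: (ge0_integral_change_of_variables oI ab ndI IE).
Qed.

End monotone.

(** Reflecting the target turns [phi] into the increasing map [- phi]. Here [dphi] is minus the
    derivative, so that it is the nonnegative Jacobian. *)
Lemma decreasing_cov (I J : set R) (phi dphi : R -> R) (dI : cov_domain I)
  (mJ : measurable J)
  (IJ : forall x, I x -> J (phi x))
  (JI : forall y, J y -> exists2 x, I x & phi x = y)
  (dphiP : forall x, I x -> is_derive x 1 phi (- dphi x))
  (cdphi : forall x, I x -> {for x, continuous dphi}) g :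
  (forall x y, I x -> I y -> x < y -> phi y < phi x) ->
  (forall x, I x -> 0 <= dphi x) ->
  measurable_fun setT g -> (forall y, 0 <= g y)%E ->
  (\int[mu]_(y in J) g y = \int[mu]_(x in I) (g (phi x) * (dphi x)%:E))%E.
Proof.
move=> mono dphi0 mg g0.
have dP x : I x -> is_derive x 1 (fun x => - phi x) (dphi x).
  by move=> Ix; rewrite -[dphi x]opprK; apply: is_deriveN; exact: dphiP.
rewrite ge0_integral_oppr// (@increasing_cov I _ (fun x => - phi x) dphi dI _ _ dP)//=.
- by apply: eq_integral => x _; rewrite opprK.
- by move=> x /IJ; rewrite opprK.
- by move=> y /JI[x Ix xy]; exists x => //; rewrite [LHS]/= -[y]opprK -xy.
- by move=> x y Ix Iy xy; rewrite /= ltrN2; exact: mono.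
- by apply: measurableT_comp mg _; exact: measurable_funN.
Qed.

Lemma affine_cov (c d : R) (A : set R) g : c != 0 -> measurable A ->
  measurable_fun setT g -> (forall y, 0 <= g y)%E ->
  (\int[mu]_(y in A) g y =
   \int[mu]_(x in [set x : R | A (c * x + d)%R]) (g (c * x + d)%R * `|c|%:E))%E.
Proof.
move=> c0 mA mg g0.
have mgA : measurable_fun setT (g \_ A).
  by apply: (measurable_restrictT _ mA).1; exact: measurable_funTS.
have gA0 y : (0 <= (g \_ A) y)%E by apply: erestrict_ge0.
have dP (x : R) : is_derive x 1 (fun x => c * x + d) c.
  have h : is_derive x 1 ((c \*o id) + cst d : R -> R) (c * 1 + 0).
    by apply: is_deriveD.
  by rewrite mulr1 addr0 in h.
have ex y : exists2 x, [set: R] x & c * x + d = y.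
  by exists ((y - d) / c) => //; rewrite mulrC divfK// subrK.
rewrite integral_mkcond [RHS]integral_mkcond.
have [c_gt0|c_lt0|c00] := ltgtP 0 c; last by rewrite -c00 eqxx in c0.
- rewrite (@increasing_cov setT setT (fun x => c * x + d) (fun=> c) CovDomainT _ _ (fun x _ => dP x))//.
  + apply: eq_integral => x _; rewrite !patchE gtr0_norm//.
    have [h|h] := pselect (A (c * x + d)); first by rewrite !mem_set.
    by rewrite !memNset// mul0e.
  + by move=> x _; exact: cvg_cst.
  + by move=> x y _ _ xy; rewrite ltrD2r ltr_pM2l.
  + by move=> x _; exact: ltW.
- have dP' (x : R) (_ : setT x) : is_derive x 1 (fun x => c * x + d) (- (- c)).
    by rewrite opprK.
  rewrite (@decreasing_cov setT setT (fun x => c * x + d) (fun=> - c) CovDomainT _ _ _ dP')//.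
  + apply: eq_integral => x _; rewrite !patchE ltr0_norm//.
    have [h|h] := pselect (A (c * x + d)); first by rewrite !mem_set.
    by rewrite !memNset// mul0e.
  + by move=> x _; exact: cvg_cst.
  + by move=> x y _ _ xy; rewrite ltrD2r ltr_nM2l.
  + by move=> x _; rewrite oppr_ge0 ltW.
Qed.

End substitutions.

(** * Measurability of composite expressions *)

Lemma measurable_fun_inv d (T : measurableType d) (R : realType) (D : set T) (f : T -> R) :
  measurable_fun D f -> measurable_fun D (fun x => (f x)^-1).
Proof.
move=> mf.
(* Writing [1/f] as [f (f^2)^(-1)] reduces inversion to a measurable real power. At a zero of [f]
   both sides are 0. *)
rewrite (_ : (fun x => _) = (fun x => f x * (f x ^+ 2) `^ (-1))); last first.
  apply/funext => x; rewrite powR_inv1 ?sqr_ge0//.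
  have [->|fx0] := eqVneq (f x) 0; first by rewrite invr0 mul0r.
  by rewrite expr2 invfM mulrA mulfV// mul1r.
apply: measurable_funM => //; apply: (measurableT_comp (measurable_powR _)).
exact: measurable_funX.
Qed.

Lemma measurable_fun_sqrt d (T : measurableType d) (R : realType) (D : set T) (f : T -> R) :
  measurable_fun D f -> measurable_fun D (fun x => Num.sqrt (f x)).
Proof.
exact: (measurableT_comp (continuous_measurable_fun (@sqrt_continuous R))).
Qed.

(** Structural recursion on the expression. A function whose measurability is a hypothesis may occur
    as the head, and subgoals out of reach are left open. *)
Ltac mfun :=
  lazymatch goal with
  | |- measurable_fun _ (fun x => EFin (@?f x)) => apply/measurable_EFinP; mfun
  | |- measurable_fun _ (fun x => (@?f x * @?g x)%E) => apply: (@emeasurable_funM _ _ _ _ f g); mfun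
  | |- measurable_fun _ (fun x => @?f x + @?g x) => apply: (@measurable_funD _ _ _ _ f g); mfun
  | |- measurable_fun _ (fun x => @?f x * @?g x) => apply: (@measurable_funM _ _ _ _ f g); mfun
  | |- measurable_fun _ (fun x => - @?f x) => apply: (@measurable_funN _ _ _ _ f); mfun
  | |- measurable_fun _ (fun x => (@?f x) ^+ ?n) => apply: (@measurable_funX _ _ _ _ f n); mfun
  | |- measurable_fun _ (fun x => (@?f x)^-1) => apply: (@measurable_fun_inv _ _ _ _ f); mfun
  | |- measurable_fun _ (fun x => Num.sqrt (@?f x)) => apply: (@measurable_fun_sqrt _ _ _ _ f); mfun
  | |- measurable_fun _ (fun x => (@?f x, @?g x)) => apply: (@measurable_fun_pair _ _ _ _ _ _ f g); mfun
  | |- measurable_fun _ (fun x => (@?f x).1) => apply: (measurableT_comp measurable_fst); mfun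
  | |- measurable_fun _ (fun x => (@?f x).2) => apply: (measurableT_comp measurable_snd); mfun
  | |- measurable_fun _ (fun x => `|@?f x|) => apply: (measurableT_comp (@normr_measurable _ setT)); mfun
  | |- measurable_fun _ (fun x => Num.max (@?f x) (@?g x)) => apply: (@measurable_maxr _ _ _ _ f g); mfun
  | |- measurable_fun _ (fun x => x) => exact: measurable_id
  | |- measurable_fun _ GRing.inv => apply: (@measurable_fun_inv _ _ _ _ id); exact: measurable_id
  | |- measurable_fun _ Num.sqrt => apply: (@measurable_fun_sqrt _ _ _ _ id); exact: measurable_id
  | |- measurable_fun _ fst => exact: measurable_fst
  | |- measurable_fun _ snd => exact: measurable_snd
  | |- measurable_fun _ ?F =>
    first [ exact: measurable_cst
          | match goal with
            | mh : measurable_fun [set: _] ?h |- measurable_fun _ (fun x => ?h _) =>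
              apply: (measurableT_comp mh); mfun
            end
          | idtac ]
  | |- _ => idtac
  end.

(** * Tonelli's theorem on products of sets *)

Section tonelli_on.
Context d1 d2 (T1 : measurableType d1) (T2 : measurableType d2) (R : realType).
Variables (m1 : {sigma_finite_measure set T1 -> \bar R}).
Variables (m2 : {sigma_finite_measure set T2 -> \bar R}).
Variables (A : set T1) (B : set T2) (f : T1 * T2 -> \bar R).
Hypotheses (mA : measurable A) (mB : measurable B).
Hypotheses (mf : measurable_fun setT f) (f0 : forall p, (0 <= f p)%E).
Local Open Scope ereal_scope.

Lemma measurable_integral_snd :
  measurable_fun setT (fun x => \int[m2]_(y in B) f (x, y)).
Proof.
under eq_fun do rewrite integral_mkcond.
pose g := f \_ (setT `*` B).
have mg : measurable_fun setT g.
  apply: (measurable_restrictT _ _).1; last exact: measurable_funTS.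
  exact: measurableX.
have g0 p : 0 <= g p by apply: erestrict_ge0.
have := measurable_fun_fubini_tonelli_F (m2 := m2) g mg g0.
congr measurable_fun; apply/funext => x; apply: eq_integral => y _.
by rewrite /g !patchE in_setX in_setT.
Qed.

Lemma tonelli_on :
  \int[m1]_(x in A) \int[m2]_(y in B) f (x, y) =
  \int[m2]_(y in B) \int[m1]_(x in A) f (x, y).
Proof.
pose g := f \_ (A `*` B).
have mg : measurable_fun setT g.
  apply: (measurable_restrictT _ _).1; last exact: measurable_funTS.
  exact: measurableX.
have g0 p : 0 <= g p by apply: erestrict_ge0.
have := fubini_tonelli (m1 := m1) (m2 := m2) g mg g0.
congr (_ = _).
- rewrite [RHS]integral_mkcond; apply: eq_integral => x _.
  rewrite patchE; case: ifPn => xA.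
    rewrite [RHS]integral_mkcond; apply: eq_integral => y _.
    by rewrite /g !patchE in_setX xA.
  by apply: integral0_eq => y _; rewrite /g patchE in_setX (negbTE xA).
- rewrite [RHS]integral_mkcond; apply: eq_integral => y _.
  rewrite patchE; case: ifPn => yB.
    rewrite [RHS]integral_mkcond; apply: eq_integral => x _.
    by rewrite /g !patchE in_setX yB andbT.
  by apply: integral0_eq => x _; rewrite /g patchE in_setX (negbTE yB) andbF.
Qed.

End tonelli_on.

Section leb2_tonelli.
Context (R : realType).
Local Notation mu := (@lebesgue_measure R).
Local Open Scope ereal_scope.
Variable f : plane R -> \bar R.
Hypotheses (mf : measurable_fun setT f) (f0 : forall p, (0 <= f p)%E).

Lemma measurable_integral_leb (B : set R) : measurable B ->
  measurable_fun [set: R] (fun x : R => \int[mu]_(y in B) f (x, y)).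
Proof. by move=> mB; exact: (measurable_integral_snd mu mB mf f0). Qed.

Lemma tonelli_leb (A B : set R) : measurable A -> measurable B ->
  \int[mu]_(x in A) \int[mu]_(y in B) f (x, y) =
  \int[mu]_(y in B) \int[mu]_(x in A) f (x, y).
Proof. by move=> mA mB; exact: (tonelli_on mu mu mA mB mf f0). Qed.

Lemma integral_leb2_xy : \int[leb2]_z f z = \int[mu]_x \int[mu]_y f (x, y).
Proof. exact: fubini_tonelli1. Qed.

Lemma integral_leb2_yx : \int[leb2]_z f z = \int[mu]_y \int[mu]_x f (x, y).
Proof. exact: fubini_tonelli2. Qed.
End leb2_tonelli.

(** * Four explicit substitutions on the line *)

Section explicit_substitutions.
Context (R : realType).
Local Notation mu := (@lebesgue_measure R).
Implicit Types g : R -> \bar R.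

Lemma integral_invr g : measurable_fun setT g -> (forall y, 0 <= g y)%E ->
  (\int[mu]_(y in `]0%R, +oo[) g y =
   \int[mu]_(x in `]0%R, +oo[) (g (x^-1)%R * (x ^- 2)%:E))%E.
Proof.
move=> mg g0.
have dP (x : R) : `]0, +oo[%classic x -> is_derive x 1 (fun x : R => x^-1) (- x ^- 2).
  rewrite /= in_itv/= andbT => x0.
  have h := is_deriveV (lt0r_neq0 x0) (is_derive_id x 1).
  by apply: (is_derive_eq h); rewrite scaler1.
apply: (decreasing_cov (CovDomain0y R) _ _ _ dP) => //.
- by move=> x /=; rewrite !in_itv/= !andbT invr_gt0.
- move=> y /=; rewrite !in_itv/= !andbT => y0; exists y^-1; last by rewrite invrK.
  by rewrite /= in_itv/= andbT invr_gt0.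
- move=> x /=; rewrite in_itv/= andbT => x0.
  by apply: cvgV; [rewrite expf_neq0// gt_eqF|exact: exprn_continuous].
- by move=> x y /=; rewrite !in_itv/= !andbT => x0 y0 xy; rewrite ltf_pV2.
- by move=> x _; rewrite invr_ge0 sqr_ge0.
Qed.

Lemma integral_sqrr g : measurable_fun setT g -> (forall y, 0 <= g y)%E ->
  (\int[mu]_(y in `]0%R, +oo[) g y =
   \int[mu]_(x in `]0%R, +oo[) (g (x ^+ 2)%R * (2 * x)%:E))%E.
Proof.
move=> mg g0.
have dP (x : R) : `]0, +oo[%classic x -> is_derive x 1 (fun x : R => x ^+ 2) (2 * x).
  move=> _; have h := is_deriveX 2 (is_derive_id x 1).
  by apply: (is_derive_eq h); rewrite scaler1.
apply: (increasing_cov (CovDomain0y R) _ _ dP) => //.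
- by move=> x /=; rewrite !in_itv/= !andbT => x0; rewrite exprn_gt0.
- move=> y /=; rewrite !in_itv/= !andbT => y0; exists (Num.sqrt y).
    by rewrite /= in_itv/= andbT sqrtr_gt0.
  by rewrite sqr_sqrtr// ltW.
- by move=> x _; apply: cvgMr; exact: cvg_id.
- move=> x y /=; rewrite !in_itv/= !andbT => x0 y0 xy.
  by rewrite ltr_pXn2r// ?nnegrE ltW.
- by move=> x /=; rewrite in_itv/= andbT => x0; rewrite mulr_ge0// ltW.
Qed.

(* The substitution is y = cot t in terms of k = tan (t/2). *)
Lemma integral_half_cot g : measurable_fun setT g -> (forall y, 0 <= g y)%E ->
  (\int[mu]_y g y = \int[mu]_(k in `]0%R, +oo[)
     (g ((1 - k ^+ 2) / (2 * k))%R * ((1 + k ^+ 2) / (2 * k ^+ 2))%:E))%E.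
Proof.
move=> mg g0.
have E (k : R) : k != 0 -> (1 - k ^+ 2) / (2 * k) = 2^-1 * (k^-1 - k).
  by move=> k0; field; rewrite k0.
have dP (k : R) : `]0, +oo[%classic k ->
    is_derive k 1 (fun k : R => (1 - k ^+ 2) / (2 * k)) (- ((1 + k ^+ 2) / (2 * k ^+ 2))).
  rewrite /= in_itv/= andbT => k0.
  have kn0 := lt0r_neq0 k0.
  have hN : is_derive k 1 (fun x : R => 1 - x ^+ 2) (- (2 * k)).
    have h : is_derive k 1 (cst 1 - (id : R -> R) ^+ 2 : R -> R) (0 - (2%:R * k ^+ 1) *: 1).
      by apply: is_deriveB.
    by apply: (is_derive_eq h); rewrite sub0r scaler1.
  have hD : is_derive k 1 (fun x : R => 2 * x) 2.
    have h : is_derive k 1 (2 \*: (id : R -> R) : R -> R) (2 *: 1) by apply: is_deriveZ.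
    by apply: (is_derive_eq h); rewrite scaler1.
  have k20 : 2 * k != 0 by rewrite mulf_neq0// pnatr_eq0.
  have hV := is_deriveV k20 hD.
  have h := is_deriveM hN hV.
  apply: (is_derive_eq h).
  by rewrite /GRing.scale/=; field.
apply: (decreasing_cov (CovDomain0y R) measurableT _ _ dP) => //.
- move=> y _; have y2 : 0 <= y ^+ 2 + 1 by rewrite addr_ge0// sqr_ge0.
  have sy : `|y| < Num.sqrt (y ^+ 2 + 1).
    by rewrite -sqrtr_sqr ltr_sqrt ?ltrDl// ltr_wpDl// sqr_ge0.
  have k0 : 0 < Num.sqrt (y ^+ 2 + 1) - y by rewrite subr_gt0 (le_lt_trans (ler_norm _)).
  (* This is the positive root of [k^2 + 2 y k - 1 = 0], which is the equation
     [(1 - k^2) / (2 k) = y]. *)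
  exists (Num.sqrt (y ^+ 2 + 1) - y); first by rewrite /= in_itv/= andbT.
  have := sqr_sqrtr y2; move: k0; set s := Num.sqrt _ => k0 s2.
  have sy0 : s - y != 0 by rewrite gt_eqF.
  have -> : 1 - (s - y) ^+ 2 = y * (2 * (s - y)) by lra.
  by rewrite mulfK// mulf_neq0// pnatr_eq0.
- move=> k /=; rewrite in_itv/= andbT => k0.
  apply: cvgM; first by apply: cvgD; [exact: cvg_cst|exact: exprn_continuous].
  apply: cvgV; first by rewrite mulf_neq0 ?pnatr_eq0// expf_neq0// gt_eqF.
  by apply: cvgMr; exact: exprn_continuous.
- move=> x y /=; rewrite !in_itv/= !andbT => x0 y0 xy.
  rewrite !E ?gt_eqF// ltr_pM2l ?invr_gt0//.
  by apply: ltrD; rewrite ?ltrN2// ltf_pV2.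
- move=> k /=; rewrite in_itv/= andbT => k0.
  have := sqr_ge0 k => k2.
  by apply: divr_ge0; [exact: addr_ge0|exact: mulr_ge0].
Qed.

(** The map is four times a rotated Koebe function. It is needed because [4 s/(1 + s)^2] is the
    value of [cosh^-2 d] for two points at angle 0 in the boundary limit. *)
Lemma integral_koebe g : measurable_fun setT g -> (forall y, 0 <= g y)%E ->
  (\int[mu]_(y in `]0%R, 1%R[) g y = \int[mu]_(x in `]0%R, 1%R[)
     (g (4 * x / (1 + x) ^+ 2)%R * (4 * (1 - x) / (1 + x) ^+ 3)%:E))%E.
Proof.
move=> mg g0.
have dP (k : R) : `]0, 1[%classic k ->
    is_derive k 1 (fun k : R => 4 * k / (1 + k) ^+ 2) (4 * (1 - k) / (1 + k) ^+ 3).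
  rewrite /= in_itv/= => /andP[k0 k1].
  have k10 : 1 + k != 0 by rewrite gt_eqF// addr_gt0.
  have hN : is_derive k 1 (fun x : R => 4 * x) 4.
    have h : is_derive k 1 (4 \*: (id : R -> R) : R -> R) (4 *: 1) by apply: is_deriveZ.
    by apply: (is_derive_eq h); rewrite scaler1.
  have hD : is_derive k 1 (fun x : R => (1 + x) ^+ 2) (2 * (1 + k)).
    have h : is_derive k 1 ((cst 1 + (id : R -> R)) ^+ 2 : R -> R) ((2%:R * (1 + k) ^+ 1) *: (0 + 1)).
      by apply: is_deriveX; apply: is_deriveD.
    by apply: (is_derive_eq h); rewrite add0r scaler1.
  have k20 : (1 + k) ^+ 2 != 0 by rewrite expf_neq0.
  have hV := is_deriveV (f := fun x : R => (1 + x) ^+ 2) k20 hD.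
  have h := is_deriveM hN hV.
  apply: (is_derive_eq h).
  by rewrite /GRing.scale/=; field.
apply: (increasing_cov (CovDomain01 R) _ _ dP) => //.
- move=> x /=; rewrite !in_itv/= => /andP[x0 x1].
  have p : 0 < (1 + x) ^+ 2 by rewrite exprn_gt0// addr_gt0.
  apply/andP; split; first by apply: divr_gt0 => //; exact: mulr_gt0.
  rewrite ltr_pdivrMr// mul1r.
  by rewrite -subr_gt0 (_ : _ - _ = (1 - x) ^+ 2) ?exprn_gt0 ?subr_gt0//; ring.
- move=> y /=; rewrite !in_itv/= => /andP[y0 y1].
  have y10 : 0 <= 1 - y by lra.
  have s2 := sqr_sqrtr y10.
  have s0 : 0 < Num.sqrt (1 - y) by rewrite sqrtr_gt0; lra.
  have s1 : Num.sqrt (1 - y) < 1 by rewrite -[ltRHS]sqrtr1 ltr_sqrt//; lra.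
  move: s0 s1 s2; set s := Num.sqrt _ => s0 s1 s2.
  have s1n0 : 1 + s != 0 by rewrite gt_eqF// addr_gt0.
  (* With [s = sqrt(1 - y)] this point [x] satisfies [1 + x = 2/(1 + s)], whence
     [4 x/(1 + x)^2 = 1 - s^2 = y]. *)
  exists ((1 - s) / (1 + s)).
    rewrite /= in_itv/=; apply/andP; split.
      by apply: divr_gt0; [rewrite subr_gt0|exact: addr_gt0].
    by rewrite ltr_pdivrMr ?addr_gt0// mul1r; lra.
  have -> : y = 1 - s ^+ 2 by rewrite s2; ring.
  field; apply/andP; split => //.
  by rewrite (_ : _ + _ = 2) ?pnatr_eq0//; ring.
- move=> k /=; rewrite in_itv/= => /andP[k0 k1].
  apply: cvgM.
    by apply: cvgMr; apply: cvgB; [exact: cvg_cst|exact: cvg_id].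
  apply: cvgV; first by rewrite expf_neq0// gt_eqF// addr_gt0.
  apply: (@continuous_comp _ _ _ (fun x : R => 1 + x) (fun x => x ^+ 3)).
    by apply: cvgD; [exact: cvg_cst|exact: cvg_id].
  exact: exprn_continuous.
- move=> x y /=; rewrite !in_itv/= => /andP[x0 x1] /andP[y0 y1] xy.
  rewrite ltr_pdivrMr ?exprn_gt0 ?addr_gt0// mulrAC ltr_pdivlMr ?exprn_gt0 ?addr_gt0//.
  rewrite -subr_gt0 (_ : _ - _ = 4 * ((y - x) * (1 - x * y))); last by ring.
  rewrite mulr_gt0// mulr_gt0 ?subr_gt0//.
  by rewrite mulr_ilt1// ltW.
- move=> k /=; rewrite in_itv/= => /andP[k0 k1].
  by rewrite divr_ge0 ?mulr_ge0 ?subr_ge0 ?exprn_ge0 ?addr_ge0// ltW.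
Qed.

End explicit_substitutions.

(** * Lebesgue measure of the plane in polar coordinates *)

Section plane.
Context (R : realType).
Local Notation mu := (@lebesgue_measure R).
Implicit Types h : plane R -> \bar R.

Definition sqnorm (z : plane R) : R := z.1 ^+ 2 + z.2 ^+ 2.

Lemma measurable_sqnorm : measurable_fun setT sqnorm.
Proof. by rewrite /sqnorm; mfun. Qed.

Lemma integral_even (g : R -> \bar R) : measurable_fun setT g ->
  (forall y, 0 <= g y)%E -> (forall y, g (- y)%R = g y) ->
  (\int[mu]_y g y = 2%:E * \int[mu]_(y in `]0%R, +oo[) g y)%E.
Proof.
move=> mg g0 gN.
have mgS D : measurable_fun D g by exact: measurable_funTS.
have E : (\int[mu]_(y in `]-oo, 0%R]) g y = \int[mu]_(y in `]0%R, +oo[) g y)%E.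
  rewrite ge0_integral_oppr//.
  rewrite [in LHS](_ : -%R @^-1` `]-oo, 0%R] = `[0%R, +oo[%classic); last first.
    by apply/seteqP; split => x /=; rewrite !in_itv/= ?andbT oppr_le0.
  under eq_integral do rewrite gN.
  by rewrite -integral_itv_obnd_cbnd.
transitivity (\int[mu]_(y in `]-oo, 0%R]) g y + \int[mu]_(y in `]0%R, +oo[) g y)%E.
  rewrite -ge0_integral_setU//.
    congr (integral _ _ _); apply/seteqP; split => // x _ /=; rewrite !in_itv/= andbT.
    by case: (leP x 0) => ?; [left|right].
  exact: mgS.
  by apply/disj_setPS => x [/=]; rewrite !in_itv/= andbT ltNge => ->.
rewrite E.
by rewrite mule_natl mule2n.
Qed.

(** Here [r] is the radius and [k] the tangent of half the polar angle. For fixed [y] one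
    substitutes [x = y (1 - k^2)/(2 k)]. After an exchange of order one substitutes
    [y = r 2 k/(1 + k^2)] for fixed [k]. *)
Lemma integral_half_plane_polar h : measurable_fun setT h ->
  (forall p, 0 <= h p)%E ->
  (\int[mu]_(y in `]0%R, +oo[) \int[mu]_x h (x, y) =
   \int[mu]_(r in `]0%R, +oo[) \int[mu]_(k in `]0%R, +oo[)
     (h (r * ((1 - k ^+ 2) / (1 + k ^+ 2)), r * (2 * k / (1 + k ^+ 2)))%R
      * (2 * r / (1 + k ^+ 2))%:E))%E.
Proof.
move=> mh h0.
transitivity (\int[mu]_(y in `]0%R, +oo[) \int[mu]_(k in `]0%R, +oo[)
   (h (y * ((1 - k ^+ 2) / (2 * k)), y)%R * (`|y| * ((1 + k ^+ 2) / (2 * k ^+ 2)))%:E))%E.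
  apply: eq_integral => y /set_mem/=; rewrite in_itv/= andbT => y0.
  have mhy : measurable_fun setT (fun x => h (x, y)) by mfun.
  rewrite (@affine_cov _ y 0 setT)//; last by rewrite gt_eqF.
  under eq_integral do rewrite addr0.
  rewrite (_ : [set _ | _] = setT)// (@integral_half_cot _ (fun x => h (y * x, y)%R * `|y|%:E)%E)//.
  - apply: eq_integral => k _; rewrite -muleA -EFinM.
    by [].
  - by mfun.
  - by move=> x; rewrite mule_ge0// lee_fin.
(* [Num.max p.1 0] agrees with [y] on the half-line and keeps [f] nonnegative on the whole plane, as
   the exchange of order demands. *)
pose f (p : plane R) := (h (p.1 * ((1 - p.2 ^+ 2) / (2 * p.2)), p.1)%R *
   (Num.max p.1 0 * ((1 + p.2 ^+ 2) / (2 * p.2 ^+ 2)))%:E)%E.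
have k0 (k : R) : 0 <= (1 + k ^+ 2) / (2 * k ^+ 2).
  by apply: divr_ge0; [exact/addr_ge0/sqr_ge0|exact/mulr_ge0/sqr_ge0].
have f0 p : (0 <= f p)%E.
  by rewrite mule_ge0// lee_fin mulr_ge0// le_max lexx orbT.
have mf : measurable_fun setT f.
  rewrite /f; mfun.
transitivity (\int[mu]_(y in `]0%R, +oo[) \int[mu]_(k in `]0%R, +oo[) f (y, k))%E.
  apply: eq_integral => y /set_mem/=; rewrite in_itv/= andbT => y0.
  by apply: eq_integral => k _; rewrite /f/= gtr0_norm// max_l// ltW.
apply: (etrans (tonelli_leb mf f0 (measurable_itv _) (measurable_itv _))).
pose f' (p : plane R) := (h (p.2 * ((1 - p.1 ^+ 2) / (1 + p.1 ^+ 2)),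
    p.2 * (2 * p.1 / (1 + p.1 ^+ 2)))%R *
   (2 * Num.max p.2 0 / (1 + p.1 ^+ 2))%:E)%E.
have k1 (k : R) : 0 < 1 + k ^+ 2 by rewrite ltr_pwDl ?sqr_ge0.
have f'0 p : (0 <= f' p)%E.
  apply: mule_ge0 => //; rewrite lee_fin; apply: mulr_ge0.
    by rewrite mulr_ge0// le_max lexx orbT.
  by rewrite invr_ge0 ltW.
have mf' : measurable_fun setT f'.
  rewrite /f'; mfun.
transitivity (\int[mu]_(k in `]0%R, +oo[) \int[mu]_(r in `]0%R, +oo[) f' (k, r))%E.
  apply: eq_integral => k /set_mem/=; rewrite in_itv/= andbT => kp.
  have c0 : 0 < 2 * k / (1 + k ^+ 2) by rewrite divr_gt0 ?mulr_gt0.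
  rewrite (@affine_cov _ (2 * k / (1 + k ^+ 2)) 0 `]0, +oo[)//; last 2 first.
    by rewrite gt_eqF.
    by move: mf; rewrite /f => mf; mfun.
  under eq_integral do rewrite addr0.
  rewrite (_ : [set _ | _] = `]0, +oo[%classic); last first.
    by apply/seteqP; split => x /=; rewrite !in_itv/= !andbT addr0 pmulr_rgt0.
  apply: eq_integral => r /set_mem/=; rewrite in_itv/= andbT => r0.
  rewrite /f /f' /= !max_l ?(ltW r0)//; last by rewrite mulr_ge0// ltW.
  rewrite -muleA -EFinM (gtr0_norm c0).
  have := k1 k; have kn0 : k != 0 by rewrite gt_eqF.
  move=> /lt0r_neq0 kk.
  by congr (h (_, _) * _%:E)%E; field; rewrite ?kk ?kn0.
apply: (etrans (tonelli_leb mf' f'0 (measurable_itv _) (measurable_itv _))).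
apply: eq_integral => r /set_mem/=; rewrite in_itv/= andbT => r0.
apply: eq_integral => k _.
by rewrite /f' /= max_l// ltW.
Qed.

(** The integrand is even in [z.2], so the upper half-plane counts twice. The variable [t = r^2]
    absorbs the factor [2 r] of the polar Jacobian. *)
Lemma integral_polar h : measurable_fun setT h -> (forall p, 0 <= h p)%E ->
  (\int[leb2]_z h (sqnorm z, z.1) =
   2%:E * \int[mu]_(t in `]0%R, +oo[) \int[mu]_(k in `]0%R, +oo[)
     (h (t, Num.sqrt t * ((1 - k ^+ 2) / (1 + k ^+ 2)))%R * ((1 + k ^+ 2)^-1)%:E))%E.
Proof.
move=> mh h0.
have k1 (k : R) : 0 < 1 + k ^+ 2 by rewrite ltr_pwDl ?sqr_ge0.
pose h1 (z : plane R) := h (sqnorm z, z.1).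
have mh1 : measurable_fun setT h1 by rewrite /h1 /sqnorm; mfun.
have mh1' : measurable_fun setT (fun p : plane R => h1 (p.2, p.1)) by mfun.
pose G (y : R) := (\int[mu]_x h1 (x, y))%E.
have mG : measurable_fun setT G.
  exact: (measurable_integral_leb mh1' (fun p => h0 _)).
have G0 y : (0 <= G y)%E by apply: integral_ge0 => x _; exact: h0.
have GN y : G (- y) = G y.
  by apply: eq_integral => x _; rewrite /h1 /sqnorm/= sqrrN.
apply: (etrans (@integral_leb2_yx _ h1 mh1 (fun p => h0 _))).
apply: (etrans (integral_even mG G0 GN)); rewrite /G.
congr (_ * _)%E; apply: (etrans (integral_half_plane_polar mh1 (fun p => h0 _))).
pose f (p : plane R) := (h (p.1, Num.sqrt p.1 * ((1 - p.2 ^+ 2) / (1 + p.2 ^+ 2)))%R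
  * ((1 + p.2 ^+ 2)^-1)%:E)%E.
have mf : measurable_fun setT f by rewrite /f; mfun.
have f0 p : (0 <= f p)%E by rewrite mule_ge0// lee_fin invr_ge0 ltW.
rewrite [RHS](@integral_sqrr _ (fun t => \int[mu]_(k in `]0%R, +oo[) f (t, k))%E); last 2 first.
- exact: (measurable_integral_leb mf f0).
- by move=> y; apply: integral_ge0.
apply: eq_integral => r /set_mem/=; rewrite in_itv/= andbT => r0.
rewrite -ge0_integralZr//; last 2 first.
- by move: mf; rewrite /f => mf; mfun; apply: measurable_funTS; mfun.
- by rewrite lee_fin mulr_ge0// ltW.
apply: eq_integral => k _.
rewrite /f/= -muleA -EFinM sqrtr_sqr gtr0_norm//.
have /lt0r_neq0 kk := k1 k.
by congr (h (_, _) * _%:E)%E; rewrite /sqnorm/=; field.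
Qed.

Lemma integral_radial (g : R -> \bar R) : measurable_fun setT g ->
  (forall y, 0 <= g y)%E ->
  (\int[leb2]_z g (sqnorm z) = pi%:E * \int[mu]_(t in `]0%R, +oo[) g t)%E.
Proof.
move=> mg g0.
rewrite (@integral_polar (fun p => g p.1))//; last by mfun.
have atanE : (\int[mu]_(k in `]0%R, +oo[) ((1 + k ^+ 2)^-1)%:E = (pi / 2)%:E)%E.
  rewrite integral_itv_obnd_cbnd; last by apply: measurable_funTS; mfun.
  exact: integral0y_oneDsqr.
have -> : (\int[mu]_(t in `]0%R, +oo[) \int[mu]_(k in `]0%R, +oo[)
    (g t * ((1 + k ^+ 2)^-1)%:E) = \int[mu]_(t in `]0%R, +oo[) (g t * (pi / 2)%:E))%E.
  apply: eq_integral => t _; rewrite ge0_integralZl ?atanE//.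
  - by apply: measurable_funTS; mfun.
  - by move=> k _; rewrite lee_fin invr_ge0 addr_ge0// sqr_ge0.
rewrite ge0_integralZr//; last 2 first.
- exact: measurable_funTS.
- by rewrite lee_fin divr_ge0// pi_ge0.
by rewrite muleCA muleC -EFinM mulrC divfK.
Qed.

(** Two affine substitutions: [v = (s u + y)/c] for fixed [u], then [u = c x - s y] for fixed [y].
    Their Jacobians [1/|c|] and [|c|] cancel. A quarter turn, [c = 0], is an exchange of the
    coordinates up to signs and is treated apart. *)
Lemma integral_rotation h (c s : R) : c ^+ 2 + s ^+ 2 = 1 ->
  measurable_fun setT h -> (forall p, 0 <= h p)%E ->
  (\int[leb2]_z h z = \int[leb2]_z h (c * z.1 - s * z.2, s * z.1 + c * z.2)%R)%E.
Proof.
move=> cs mh h0.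
pose h' (z : plane R) := h (c * z.1 - s * z.2, s * z.1 + c * z.2)%R.
have mh' : measurable_fun setT h' by rewrite /h'; mfun.
apply: (etrans _ (esym (integral_leb2_yx mh' (fun p => h0 _)))).
have [c0|c0] := eqVneq c 0.
  have s1 : `|s| = 1.
    by apply/eqP; rewrite -sqrp_eq1// -normrX -cs c0 expr0n add0r ger0_norm// sqr_ge0.
  have sn0 : s != 0 by rewrite -normr_eq0 s1 oner_eq0.
  apply: (etrans (integral_leb2_xy mh h0)).
  have mG : measurable_fun setT (fun x => \int[mu]_y h (x, y))%E.
    exact: measurable_integral_leb.
  rewrite (@affine_cov _ (- s) 0 setT)//; last 2 first.
    by rewrite oppr_eq0.
    by move=> x; exact: integral_ge0.
  rewrite (_ : [set _ | _] = setT)//; apply: eq_integral => y _.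
  rewrite normrN s1 mule1 (@affine_cov _ s 0 setT)//; last by mfun.
  rewrite (_ : [set _ | _] = setT)//; apply: eq_integral => x _.
  by rewrite s1 mule1 /h' /= c0 !mul0r !addr0 sub0r mulNr.
transitivity (\int[mu]_y \int[mu]_u (h (u, (s * u + y) / c)%R * (`|c|^-1)%:E))%E.
  pose f (p : plane R) := (h (p.2, (s * p.2 + p.1) / c)%R * (`|c|^-1)%:E)%E.
  have mf : measurable_fun setT f by rewrite /f; mfun.
  have f0 p : (0 <= f p)%E by rewrite mule_ge0// lee_fin invr_ge0.
  apply: (etrans (integral_leb2_xy mh h0)).
  apply: (etrans _ (esym (tonelli_leb mf f0 measurableT measurableT))).
  apply: eq_integral => u _.
  rewrite (@affine_cov _ c^-1 (s * u / c) setT)//; last 2 first.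
    by rewrite invr_eq0.
    by mfun.
  rewrite (_ : [set _ | _] = setT)//; apply: eq_integral => y _.
  by rewrite /f /= normfV; congr (h (_, _) * _)%E; field.
apply: eq_integral => y _.
rewrite (@affine_cov _ c (- (s * y)) setT)//; last 2 first.
  by mfun.
  by move=> u; rewrite mule_ge0// lee_fin invr_ge0.
rewrite (_ : [set _ | _] = setT)//; apply: eq_integral => x _.
rewrite -muleA -EFinM mulVf ?normr_eq0// mule1 /h' /=.
congr (h (_, _)); apply: (canLR (mulfK c0)).
by rewrite -[X in _ + X = _](mul1r y) -cs; ring.
Qed.

(** Inversion preserves each ray [x = k y], on which it is [y -> 1/((k^2 + 1) y)]. Slicing both
    sides by the slope [k] therefore leaves a one-dimensional substitution. *)
Lemma integral_half_plane_inversion h : measurable_fun setT h ->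
  (forall p, 0 <= h p)%E ->
  (\int[mu]_(y in `]0%R, +oo[) \int[mu]_x h (x, y) =
   \int[mu]_(y in `]0%R, +oo[) \int[mu]_x
     (h (x / (x ^+ 2 + y ^+ 2), y / (x ^+ 2 + y ^+ 2))%R
      * ((x ^+ 2 + y ^+ 2) ^- 2)%:E))%E.
Proof.
have slope f : measurable_fun setT f -> (forall p, 0 <= f p)%E ->
    (\int[mu]_(y in `]0%R, +oo[) \int[mu]_x f (x, y) =
     \int[mu]_k \int[mu]_(y in `]0%R, +oo[) (f (k * y, y)%R * `|y|%:E))%E.
  move=> mf f0.
  pose f' (p : plane R) := (f (p.1 * p.2, p.2)%R * `|p.2|%:E)%E.
  have mf' : measurable_fun setT f'.
    by rewrite /f'; mfun.
  have f'0 p : (0 <= f' p)%E by rewrite mule_ge0// lee_fin.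
  apply: (etrans _ (esym (tonelli_leb mf' f'0 measurableT (measurable_itv _)))).
  apply: eq_integral => y /set_mem/=; rewrite in_itv/= andbT => y0.
  rewrite (@affine_cov _ y 0 setT)//; last 2 first.
  - by rewrite gt_eqF.
  - by mfun.
  rewrite (_ : [set _ | _] = setT)//; apply: eq_integral => x _.
  by rewrite addr0 /f'/= mulrC.
move=> mh h0.
pose h' (p : plane R) := (h (p.1 / (p.1 ^+ 2 + p.2 ^+ 2), p.2 / (p.1 ^+ 2 + p.2 ^+ 2))%R
      * ((p.1 ^+ 2 + p.2 ^+ 2) ^- 2)%:E)%E.
have mh' : measurable_fun setT h' by rewrite /h'; mfun.
have h'0 p : (0 <= h' p)%E by rewrite mule_ge0// lee_fin invr_ge0 sqr_ge0.
rewrite [RHS](slope _ mh' h'0) (slope _ mh h0).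
apply: eq_integral => k _.
have k1 : 0 < k ^+ 2 + 1 by rewrite ltr_wpDl ?sqr_ge0.
have mg : measurable_fun setT (fun y : R => h (k * y, y)%R * `|y|%:E)%E.
  by mfun.
rewrite integral_invr//; last by move=> y; rewrite mule_ge0// lee_fin.
rewrite (@affine_cov _ (k ^+ 2 + 1) 0 `]0, +oo[)//; last 3 first.
- by rewrite gt_eqF.
- by mfun.
- by move=> y; rewrite !mule_ge0// lee_fin ?normr_ge0 ?invr_ge0 ?sqr_ge0.
rewrite (_ : [set _ | _] = `]0, +oo[%classic); last first.
  by apply/seteqP; split => x /=; rewrite !in_itv/= !andbT addr0 pmulr_rgt0.
apply: eq_integral => y /set_mem/=; rewrite in_itv/= andbT => y0.
have := lt0r_neq0 k1; have := lt0r_neq0 y0 => yn kn.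
rewrite addr0 /h'/= -!muleA -!EFinM (gtr0_norm k1) (gtr0_norm y0) gtr0_norm ?invr_gt0 ?mulr_gt0//.
have -> : (k * y) ^+ 2 + y ^+ 2 = (k ^+ 2 + 1) * y ^+ 2 by ring.
by congr (h (_, _) * _%:E)%E; field; rewrite ?kn ?yn.
Qed.

End plane.

(** * Invariance of the hyperbolic area *)

Section hyperbolic_plane.
Context (R : realType).
Local Notation mu := (@lebesgue_measure R).
Local Notation D := [set z : plane R | sqnorm z < 1].

(* The inverse of cosh2_dist, with |1 - z w^*|^2 in real coordinates. *)
Definition sech2_dist (z w : plane R) : R :=
  (1 - sqnorm z) * (1 - sqnorm w)
  / (1 - 2 * (z.1 * w.1 + z.2 * w.2) + sqnorm z * sqnorm w).

(* The density of lambda_0. *)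
Definition hyp_area (w : plane R) : R := (1 - sqnorm w) ^- 2.

Lemma measurable_sqnorm_lt (A : set R) : measurable A ->
  measurable [set z : plane R | A (sqnorm z)].
Proof.
move=> mA; rewrite -[X in measurable X]setTI.
by apply: (@measurable_sqnorm R).
Qed.

(** The rotation taking [|z|] to [z] preserves both [|w|] and the distance. At [z = 0] the direction
    [z/|z|] is undefined, but there is nothing to rotate. *)
Lemma integral_recenter (z : plane R) (A : set R) (f : plane R -> \bar R) :
  measurable A -> measurable_fun setT f -> (forall u, 0 <= f u)%E ->
  (\int[leb2]_(w in [set w | A (sqnorm w)]) f (sech2_dist z w, sqnorm w) =
   \int[leb2]_(w in [set w | A (sqnorm w)])
     f (sech2_dist (Num.sqrt (sqnorm z), 0%R) w, sqnorm w))%E.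
Proof.
move=> mA mf f0.
have q0 : 0 <= sqnorm z by rewrite addr_ge0 ?sqr_ge0.
pose p := Num.sqrt (sqnorm z).
have p2 : p ^+ 2 = sqnorm z by rewrite sqr_sqrtr.
rewrite -/p.
have [p0|pn0] := eqVneq p 0.
  have /eqP : sqnorm z = 0 by rewrite -p2 p0 expr0n.
  rewrite paddr_eq0 ?sqr_ge0// !sqrf_eq0 => /andP[/eqP z10 /eqP z20].
  by rewrite p0 (surjective_pairing z) z10 z20.
have cs : (z.1 / p) ^+ 2 + (z.2 / p) ^+ 2 = 1.
  by rewrite !expr_div_n -mulrDl p2 -/(sqnorm z) divff// -p2 expf_neq0.
pose g (w : plane R) := f (sech2_dist z w, sqnorm w).
have mg : measurable_fun setT g.
  by rewrite /g /sech2_dist /sqnorm; mfun.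
have mAs := measurable_sqnorm_lt mA.
pose F := g \_ [set w | A (sqnorm w)].
have mF : measurable_fun setT F.
  by apply: (measurable_restrictT _ _).1 => //; exact: measurable_funTS.
have F0 w : (0 <= F w)%E by apply: erestrict_ge0 => {}w _; exact: f0.
rewrite [LHS]integral_mkcond [RHS]integral_mkcond.
apply: (etrans (integral_rotation cs mF F0)).
apply: eq_integral => w _.
rewrite /F !patchE.
set w' := (_, _).
have sw : sqnorm w' = sqnorm w.
  transitivity (((z.1 / p) ^+ 2 + (z.2 / p) ^+ 2) * sqnorm w); last by rewrite cs mul1r.
  by rewrite /sqnorm/=; ring.
have -> : (w' \in [set w | A (sqnorm w)]) = (w \in [set w | A (sqnorm w)]).
  by apply/idP/idP; rewrite !inE/= sw.
case: ifPn => // _; rewrite /g sw; congr (f (_, _)).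
rewrite /sech2_dist sw; congr (_ / (_ - 2 * _ + _)).
- by rewrite -p2 /sqnorm/= expr0n addr0.
- transitivity (((z.1 / p) ^+ 2 + (z.2 / p) ^+ 2) * (p * w.1)); last by rewrite cs /=; ring.
  by rewrite /w'/=; field.
- by rewrite -p2 /sqnorm/= expr0n addr0.
Qed.

Variable H : R -> R.
Hypotheses (mH : measurable_fun setT H) (H0 : forall v, 0 <= H v).

(* The inversion w = 1 - 1/u maps the disk to the half-plane Re u > 1/2;
   writing u = 1/2 + l (x + i y) with l = (1 + p)/(1 - p) eliminates p. *)
Let integral_real_center (p : R) : 0 <= p < 1 ->
  (\int[leb2]_(w in D) (H (sech2_dist (p, 0) w) * hyp_area w)%:E =
   2%:E * \int[mu]_(y in `]0%R, +oo[) \int[mu]_(x in `]0%R, +oo[)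
     (H (2 * x / ((2^-1 + x) ^+ 2 + y ^+ 2)) / (4 * x ^+ 2))%:E)%E.
Proof.
move=> /andP[p0 p1].
have mD : measurable D by exact: (measurable_sqnorm_lt (measurable_itv `]-oo, 1[)).
pose f (w : plane R) := (H (sech2_dist (p, 0) w) * hyp_area w)%:E.
have mf : measurable_fun setT f.
  by rewrite /f /sech2_dist /hyp_area /sqnorm /=; mfun.
have f0 w : (0 <= f w)%E by rewrite lee_fin mulr_ge0// invr_ge0 sqr_ge0.
pose F := f \_ D.
have mF : measurable_fun setT F.
  by apply: (measurable_restrictT _ _).1 => //; exact: measurable_funTS.
have F0 w : (0 <= F w)%E by apply: erestrict_ge0 => {}w _; exact: f0.
have mF' : measurable_fun setT (fun p : plane R => F (p.2, p.1)) by mfun.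
pose G (y : R) := (\int[mu]_x F (x, y))%E.
have mG : measurable_fun setT G by exact: (measurable_integral_leb mF').
have G0 y : (0 <= G y)%E by apply: integral_ge0.
have GN y : G (- y) = G y.
  apply: eq_integral => x _; rewrite /F !patchE.
  rewrite (_ : ((x, - y) \in D) = ((x, y) \in D)); last first.
    by apply/idP/idP; rewrite !inE /sqnorm/= sqrrN.
  by rewrite /f /sech2_dist /hyp_area /sqnorm/= sqrrN !mul0r.
rewrite [LHS]integral_mkcond.
apply: (etrans (integral_leb2_yx mF F0)).
apply: (etrans (integral_even mG G0 GN)); congr (_ * _)%E.
pose F1 (w : plane R) := F (1 - w.1, w.2)%R.
have mF1 : measurable_fun setT F1 by rewrite /F1; mfun.
have F10 w : (0 <= F1 w)%E by exact: F0.
transitivity (\int[mu]_(y in `]0%R, +oo[) \int[mu]_x F1 (x, y)%R)%E.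
  apply: eq_integral => y _.
  have mFy : measurable_fun setT (fun x => F (x, y)) by mfun.
  apply: (etrans (@affine_cov _ (-1) 1 setT _ _ measurableT mFy (fun x => F0 _))).
    by rewrite oppr_eq0 oner_eq0.
  rewrite (_ : [set _ | _] = setT)//; apply: eq_integral => x _.
  by rewrite normrN1 mule1 mulN1r addrC.
apply: (etrans (integral_half_plane_inversion mF1 F10)).
pose l := (1 + p) / (1 - p).
have l0 : 0 < l by apply: divr_gt0; lra.
pose F2 (q : plane R) := (F1 (q.2 / (q.2 ^+ 2 + q.1 ^+ 2), q.1 / (q.2 ^+ 2 + q.1 ^+ 2))%R *
  ((q.2 ^+ 2 + q.1 ^+ 2) ^- 2)%:E)%E.
have mF2 : measurable_fun setT F2 by rewrite /F2; mfun.
have F20 q : (0 <= F2 q)%E.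
  by apply: mule_ge0 => //; rewrite lee_fin invr_ge0 sqr_ge0.
have mG2 := measurable_integral_leb mF2 F20 measurableT.
have ln0 : l != 0 by rewrite gt_eqF.
apply: (etrans (@affine_cov _ l 0 `]0, +oo[ _ ln0 (measurable_itv _) mG2 _)).
  by move=> y; apply: integral_ge0.
rewrite (_ : [set _ | _] = `]0, +oo[%classic); last first.
  by apply/seteqP; split => x /=; rewrite !in_itv/= !andbT addr0 pmulr_rgt0.
apply: eq_integral => y /set_mem/=; rewrite in_itv/= andbT => y0.
have mF3 : measurable_fun setT (fun x => F2 (l * y, x)%R) by mfun.
rewrite addr0.
have <- : (\int[mu]_x (F2 (l * y, x)%R * `|l|%:E) = (\int[mu]_x F2 (l * y, x)%R) * `|l|%:E)%E.
  by apply: ge0_integralZr => //; rewrite lee_fin.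
have mF4 : measurable_fun setT (fun x => F2 (l * y, x)%R * `|l|%:E)%E by mfun.
apply: (etrans (@affine_cov _ l 2^-1 setT _ ln0 measurableT mF4 _)).
  by move=> x; apply: mule_ge0.
rewrite (_ : [set _ | _] = setT)// [RHS]integral_mkcond.
apply: eq_integral => x _.
rewrite /F2 /F1 /F !patchE /=.
have n0 : 0 < (l * x + 2^-1) ^+ 2 + (l * y) ^+ 2.
  by apply: ltr_wpDl; [exact: sqr_ge0|rewrite exprn_gt0// mulr_gt0].
set n := (l * x + 2^-1) ^+ 2 + (l * y) ^+ 2 in n0 *.
have nn0 : n != 0 by rewrite gt_eqF.
set a := 1 - _; set b := l * y / _.
(* For [w = 1 - 1/u] one has [1 - |w|^2 = (2 Re u - 1)/|u|^2]. Hence the disk corresponds to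
   [x > 0]. *)
have sq : 1 - sqnorm (a, b) = 2 * l * x / n.
  transitivity ((2 * (l * x + 2^-1) * n - ((l * x + 2^-1) ^+ 2 + (l * y) ^+ 2)) / n ^+ 2).
    by rewrite /sqnorm /a /b/=; field.
  by rewrite -/n; field.
have x0E : ((a, b) \in D) = (x \in `]0, +oo[%classic).
  apply/idP/idP; rewrite !inE/= in_itv/= andbT.
    by rewrite -subr_gt0 sq pmulr_lgt0 ?invr_gt0// pmulr_rgt0// mulr_gt0.
  by move=> x0; rewrite -subr_gt0 sq; apply: divr_gt0 => //; do 2 apply: mulr_gt0 => //.
rewrite x0E; case: ifPn => [|_]; last by rewrite !mul0e.
rewrite inE/= in_itv/= andbT => x0.
rewrite /f -!EFinM (gtr0_norm l0).
set N := (2^-1 + x) ^+ 2 + y ^+ 2.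
have Nn0 : N != 0.
  by rewrite gt_eqF//; apply: ltr_wpDl; [exact: sqr_ge0|rewrite exprn_gt0].
have p1n0 : 1 + p != 0 by rewrite gt_eqF//; lra.
have p2n0 : 1 - p != 0 by rewrite gt_eqF//; lra.
(* This is where the choice of [l] matters: [(1 - p) l = 1 + p] makes [(1 + p)^2] a common factor,
   which then cancels against [1 - p^2] and [l]. *)
have den : 1 - 2 * (p * a + 0 * b) + sqnorm (p, 0) * sqnorm (a, b) =
   (1 + p) ^+ 2 * N / n.
  have -> : sqnorm (a, b) = 1 - 2 * l * x / n by rewrite -sq; ring.
  transitivity (((1 - p) ^+ 2 * n + 2 * p * (l * x + 2^-1) - 2 * p ^+ 2 * l * x) / n).
    by rewrite /sqnorm /a/=; field.
  by congr (_ / _); rewrite /n /N /l; field.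
have -> : sech2_dist (p, 0) (a, b) = 2 * x / N.
  rewrite /sech2_dist/= den sq /sqnorm/= /l; field.
  by rewrite Nn0 nn0 p1n0 p2n0.
rewrite /hyp_area sq -!mulrA; congr (_ * _)%:E.
by rewrite /l; field; rewrite nn0 p1n0 p2n0 gt_eqF.
Qed.

Let integral_center0 :
  (\int[leb2]_(w in D) (H (sech2_dist (0, 0) w) * hyp_area w)%:E =
   pi%:E * \int[mu]_(v in `]0%R, 1%R[) (H v * v ^- 2)%:E)%E.
Proof.
pose g (t : R) := (H (1 - t) * (1 - t) ^- 2)%:E.
have mg : measurable_fun setT g by rewrite /g; mfun.
have g0 t : (0 <= g t)%E by rewrite lee_fin mulr_ge0// invr_ge0 sqr_ge0.
have m1 : measurable ([set` `]-oo, 1[] : set R) by exact: measurable_itv.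
pose G := g \_ `]-oo, 1[.
have mG : measurable_fun setT G.
  by apply: (measurable_restrictT _ _).1 => //; exact: measurable_funTS.
have G0 t : (0 <= G t)%E by apply: erestrict_ge0 => {}t _; exact: g0.
transitivity (\int[leb2]_w G (sqnorm w))%E.
  rewrite integral_mkcond; apply: eq_integral => w _.
  rewrite /G !patchE (_ : (w \in D) = (sqnorm w \in `]-oo, 1[%classic)); last first.
    by apply/idP/idP; rewrite !inE.
  case: ifPn => // _; rewrite /g /sech2_dist /hyp_area.
  have -> : sqnorm ((0, 0) : plane R) = 0 by rewrite /sqnorm/= expr0n/= addr0.
  by rewrite /= !mul0r !addr0 mulr0 !subr0 divr1 mul1r.
apply: (etrans (integral_radial mG G0)); congr (_ * _)%E.
transitivity (\int[mu]_(t in `]0%R, 1%R[) g t)%E.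
  rewrite /G -integral_mkcondr; congr (integral _ _ _).
  by apply/seteqP; split => t /=; rewrite !in_itv/= andbT => /andP.
have n1 : -1 != 0 :> R by rewrite oppr_eq0 oner_eq0.
apply: (etrans (@affine_cov _ (-1) 1 `]0, 1[ _ n1 (measurable_itv _) mg g0)).
rewrite (_ : [set _ | _] = `]0, 1[%classic); last first.
  apply/seteqP; split => t /=; rewrite !in_itv/=; lra.
apply: eq_integral => t _; rewrite normrN1 mule1 /g.
by rewrite mulN1r opprD opprK addrCA subrr addr0.
Qed.

(** The half-plane formula of [integral_real_center] does not contain [p], so the centre can be
    moved to 0, where the integral is radial. It is applied twice: to the squared kernel for the
    reproducing property, and with the arccosine factor for the constant. *)
Lemma integral_sech2_dist (z : plane R) : sqnorm z < 1 ->
  (\int[leb2]_(w in D) (H (sech2_dist z w) * hyp_area w)%:E =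
   pi%:E * \int[mu]_(v in `]0%R, 1%R[) (H v * v ^- 2)%:E)%E.
Proof.
move=> z1; rewrite -integral_center0 (@integral_real_center 0) ?lexx ?ltr01//.
have q0 : 0 <= sqnorm z by rewrite addr_ge0 ?sqr_ge0.
have p01 : 0 <= Num.sqrt (sqnorm z) < 1.
  by rewrite sqrtr_ge0/= -sqrtr1 ltr_sqrt.
rewrite -(@integral_real_center (Num.sqrt (sqnorm z)))//.
pose f (u : plane R) := (H u.1 * (1 - u.2) ^- 2)%:E.
have mf : measurable_fun setT f by rewrite /f; mfun.
have f0 u : (0 <= f u)%E by rewrite lee_fin mulr_ge0// invr_ge0 sqr_ge0.
exact: (integral_recenter z (measurable_itv `]-oo, 1[) mf f0).
Qed.

End hyperbolic_plane.

(** * Pairs of points on the two sides of a circle near the boundary *)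

Section boundary_integral.
Context (R : realType).
Local Notation mu := (@lebesgue_measure R).
Local Notation mR := (measurableTypeR R).

Lemma integral_invr_on (A : set R) (g : R -> \bar R) :
  measurable A -> A `<=` `]0, +oo[ ->
  measurable_fun setT g -> (forall y, 0 <= g y)%E ->
  (\int[mu]_(y in A) g y =
   \int[mu]_(x in `]0%R, +oo[ `&` [set x : R | A (x^-1)%R]) (g (x^-1)%R * (x ^- 2)%:E))%E.
Proof.
move=> mA A0 mg g0.
pose G := g \_ A.
have mG : measurable_fun setT G.
  by apply: (measurable_restrictT _ _).1 => //; exact: measurable_funTS.
have G0 t : (0 <= G t)%E by apply: erestrict_ge0.
rewrite [LHS](_ : _ = \int[mu]_(y in `]0%R, +oo[) G y)%E; last first.
  by rewrite /G -integral_mkcondr setIidr.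
rewrite (integral_invr mG G0) [RHS]integral_mkcondr.
apply: eq_integral => x _; rewrite /G !patchE.
have [h|h] := pselect (A x^-1); first by rewrite !mem_set.
by rewrite !memNset// mul0e.
Qed.

Lemma integral_leb3 (f : plane R * mR -> \bar R) :
  measurable_fun setT f -> (forall u, 0 <= f u)%E ->
  (\int[leb2 \x mu]_u f u = \int[mu]_x \int[mu]_y \int[mu]_z f ((x, y), z))%E.
Proof.
move=> mf f0.
pose g (p : plane R) := (\int[mu]_z f (p, z))%E.
have mg : measurable_fun setT g.
  exact: (measurable_integral_snd mu measurableT mf f0).
have g0 p : (0 <= g p)%E by apply: integral_ge0.
exact: (etrans (fubini_tonelli1 f mf f0) (integral_leb2_xy mg g0)).
Qed.

Variable H : R -> R.
Hypotheses (mH : measurable_fun setT H) (H0 : forall v, 0 <= H v).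

(* sech2_dist z w for s = |z|^2, t = |w|^2 and k = tan(theta/2), with theta the
   angle between z and w. *)
Definition polar_sech2 (s t k : R) : R :=
  (1 - s) * (1 - t)
  / (1 - 2 * (Num.sqrt s * (Num.sqrt t * ((1 - k ^+ 2) / (1 + k ^+ 2)))) + s * t).

Let f3 (u : plane R * mR) : \bar R :=
  (H (polar_sech2 u.1.1 u.1.2 u.2) * (1 - u.1.1) ^- 2 * (1 - u.1.2) ^- 2
   * (1 + u.2 ^+ 2)^-1)%:E.

Let mf3 : measurable_fun setT f3.
Proof. by rewrite /f3 /polar_sech2; mfun. Qed.

Let f30 u : (0 <= f3 u)%E.
Proof.
have h : 0 <= 1 + u.2 ^+ 2 by rewrite addr_ge0// sqr_ge0.
by rewrite lee_fin !mulr_ge0// ?invr_ge0 ?sqr_ge0.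
Qed.

Let K2 (p : plane R) := (\int[mu]_(k in `]0%R, +oo[) f3 (p, k))%E.

Let mK2 : measurable_fun setT K2.
Proof. exact: (measurable_integral_snd mu (measurable_itv _) mf3 f30). Qed.

Let K20 p : (0 <= K2 p)%E. Proof. by apply: integral_ge0. Qed.

Let J (r s : R) := (2%:E * \int[mu]_(t in `[r, 1%R[) K2 (s, t))%E.

Let mJ r : measurable_fun setT (J r).
Proof.
apply: emeasurable_funM => //.
exact: (measurable_integral_leb mK2 K20 (measurable_itv _)).
Qed.

Let J0 r s : (0 <= J r s)%E.
Proof. by apply: mule_ge0; [rewrite lee_fin|apply: integral_ge0]. Qed.

(** Once [z] is rotated onto the positive axis, the integrand depends on [w] through [|w|^2] and
    [w.1] only, which is the situation of [integral_polar]. Hence the result depends on [|z|^2]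
    alone. *)
Let inner (r : R) (z : plane R) : 0 < r -> 
  (\int[leb2]_(w in [set w | `[r, 1%R[%classic (sqnorm w)])
    (H (sech2_dist z w) * hyp_area z * hyp_area w)%:E = J r (sqnorm z))%E.
Proof.
move=> r0; set s := sqnorm z.
have s0 : 0 <= s by rewrite addr_ge0 ?sqr_ge0.
pose f (u : plane R) := (H u.1 * (1 - s) ^- 2 * (1 - u.2) ^- 2)%:E.
have mf : measurable_fun setT f by rewrite /f; mfun.
have f0 u : (0 <= f u)%E by rewrite lee_fin !mulr_ge0// invr_ge0 sqr_ge0.
rewrite /hyp_area -/s.
apply: (etrans (integral_recenter z (measurable_itv `[r, 1[) mf f0)); rewrite -/s.
pose h (p : plane R) :=
  f ((1 - s) * (1 - p.1) / (1 - 2 * (Num.sqrt s * p.2) + s * p.1), p.1).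
have mh : measurable_fun setT h by rewrite /h; mfun.
have h0 p : (0 <= h p)%E by exact: f0.
pose A := [set p : plane R | `[r, 1[%classic p.1].
have mA : measurable A.
  rewrite /A -[X in measurable X]setTI.
  exact: (@measurable_fst _ _ mR mR measurableT `[r, 1[%classic (measurable_itv _)).
pose h' := h \_ A.
have mh' : measurable_fun setT h'.
  by apply: (measurable_restrictT _ _).1 => //; exact: measurable_funTS.
have h'0 p : (0 <= h' p)%E by apply: erestrict_ge0 => {}p _; exact: h0.
have sc : sqnorm ((Num.sqrt s, 0) : plane R) = s.
  by rewrite /sqnorm/= expr0n addr0 sqr_sqrtr.
transitivity (\int[leb2]_w h' (sqnorm w, w.1))%E.
  rewrite [LHS]integral_mkcond; apply: eq_integral => w _.
  rewrite /h' !patchE (_ : (w \in [set w | _]) = ((sqnorm w, w.1) \in A)); last first.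
    by apply/idP/idP; rewrite !inE.
  case: ifPn => // _; rewrite /h /=; congr (f (_, _)).
  by rewrite /sech2_dist sc/= mul0r addr0.
apply: (etrans (integral_polar mh' h'0)).
rewrite /J; congr (_ * _)%E.
transitivity (\int[mu]_(t in `]0%R, +oo[) ((fun t => K2 (s, t)) \_ `[r, 1%R[%classic) t)%E.
  have AE t x : ((t, x) \in A) = (t \in `[r, 1[%classic).
    by apply/idP/idP => /set_mem ?; apply/mem_set.
  apply: eq_integral => t _; rewrite patchE; case: ifPn => tr; last first.
    by apply: integral0_eq => k _; rewrite /h' patchE AE (negbTE tr) mul0e.
  apply: eq_integral => k _; rewrite /h' patchE AE tr.
  by rewrite /h /f /f3 /polar_sech2 -EFinM.
rewrite -integral_mkcondr setIidr// => t /=.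
by rewrite !in_itv/= andbT => /andP[+ _]; exact: lt_le_trans.
Qed.

(* polar_sech2 at s = 1 - c, t = 1 - c s, k = c l.  The first square is that of
   (1 - p)/c, in a form that makes sense at c = 0. *)
Definition scaled_sech2 (c s l : R) : R :=
  let p := Num.sqrt (1 - c) * Num.sqrt (1 - c * s) in
  s * (1 + c ^+ 2 * l ^+ 2)
  / (((1 + s - c * s) / (1 + p)) ^+ 2 + l ^+ 2 * (1 + p) ^+ 2).

Lemma polar_scaled_sech2 (c s l : R) : 0 < c < 1 -> 0 < s -> c * s < 1 ->
  polar_sech2 (1 - c) (1 - c * s) (c * l) = scaled_sech2 c s l.
Proof.
move=> /andP[c0 c1] s0 cs1; rewrite /polar_sech2 /scaled_sech2 /=.
set a := Num.sqrt (1 - c); set b := Num.sqrt (1 - c * s).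
have a2 : a ^+ 2 = 1 - c by rewrite sqr_sqrtr// subr_ge0 ltW.
have b2 : b ^+ 2 = 1 - c * s by rewrite sqr_sqrtr// subr_ge0 ltW.
have p0 : 0 <= a * b by rewrite mulr_ge0// sqrtr_ge0.
rewrite [a * (b * _)]mulrA.
have p2 : (a * b) ^+ 2 = (1 - c) * (1 - c * s) by rewrite exprMn a2 b2.
set p := a * b in p0 p2 *.
have p1 : 1 + p != 0 by rewrite gt_eqF// ltr_pwDl.
have cn0 : c != 0 by rewrite gt_eqF.
(* Rationalisation: [1 - p^2 = c (1 + s - c s)]. *)
have q : (1 + s - c * s) / (1 + p) = (1 - p) / c.
  apply/eqP; rewrite eqr_div//; apply/eqP.
  transitivity (1 - p ^+ 2); last by ring.
  by rewrite p2; ring.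
rewrite q -p2.
have k0 : 0 < 1 + (c * l) ^+ 2 by rewrite ltr_pwDl ?sqr_ge0.
have d0 : 0 < (1 - p) ^+ 2 + (c * l) ^+ 2 * (1 + p) ^+ 2.
  apply: ltr_pwDl; last by apply: mulr_ge0; exact: sqr_ge0.
  rewrite exprn_even_gt0//= subr_eq0.
  apply/eqP => p1'; move: p2; rewrite -p1' expr1n => p2.
  have h1 : 0 <= (1 - c) * (c * s) by rewrite !mulr_ge0 ?ltW// subr_gt0.
  by move: p2; lra.
have -> : 1 - 2 * (p * ((1 - (c * l) ^+ 2) / (1 + (c * l) ^+ 2))) + p ^+ 2 =
   ((1 - p) ^+ 2 + (c * l) ^+ 2 * (1 + p) ^+ 2) / (1 + (c * l) ^+ 2).
  by field; rewrite gt_eqF.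
have -> : ((1 - p) / c) ^+ 2 + l ^+ 2 * (1 + p) ^+ 2 =
   ((1 - p) ^+ 2 + (c * l) ^+ 2 * (1 + p) ^+ 2) / c ^+ 2.
  by field.
have -> : 1 + c ^+ 2 * l ^+ 2 = 1 + (c * l) ^+ 2 by rewrite exprMn.
set N := 1 + _ in k0 *; set M := _ ^+ 2 + _ in d0 *.
by field; rewrite !gt_eqF.
Qed.

(* A triple u = ((a, s), l) encodes 1 - |z|^2 = e/a, 1 - |w|^2 = (e/a) s and
   tan(theta/2) = (e/a) l. *)
Definition boundary_region (e : R) : set (plane R * mR) :=
  [set u | [/\ e < u.1.1 < 1, 0 < u.1.2 <= u.1.1 & 0 < u.2]].

(** With [c = e/a] the Jacobians are [e a^-2] for [z] and [c] each for [s] and [l], and the two area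
    densities are [c^-2] and [(c s)^-2]. Their product is [s^-2 / e]. The factor [pi] is the angular
    integral of [z], and 2 counts both signs of the angle. *)
Definition boundary_integrand (e : R) (u : plane R * mR) : R :=
  2 * pi / e * (u.1.2 ^- 2 * (H (scaled_sech2 (e / u.1.1) u.1.2 u.2)
    / (1 + (e / u.1.1) ^+ 2 * u.2 ^+ 2))).

Lemma measurable_boundary_region (e : R) : measurable (boundary_region e).
Proof.
rewrite (_ : boundary_region e =
   ([set u | `]e, 1[%classic u.1.1] `&` [set u | `]0, +oo[%classic u.1.2])
   `&` ([set u | `[0, +oo[%classic (u.1.1 - u.1.2)] `&` [set u | `]0, +oo[%classic u.2])).
  have mpre (f : plane R * mR -> R) (A : set R) : measurable_fun setT f -> measurable A ->
      measurable [set u | A (f u)].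
    by move=> mf mA; rewrite -[X in measurable X]setTI; exact: mf.
  by apply: measurableI; apply: measurableI; apply: mpre => //; mfun.
apply/seteqP; split => u /=; rewrite !in_itv/= !andbT subr_ge0.
  by move=> [? /andP[? ?] ?].
by move=> [[? ?] [? ?]]; split => //; apply/andP.
Qed.

Lemma measurable_boundary_integrand (e : R) : measurable_fun setT (boundary_integrand e).
Proof. by rewrite /boundary_integrand /scaled_sech2/=; mfun. Qed.

Lemma boundary_integrand_ge0 (e : R) u : 0 < e -> 0 <= boundary_integrand e u.
Proof.
move=> e0; apply: mulr_ge0.
  by apply: divr_ge0; [apply: mulr_ge0 => //; exact: pi_ge0|exact: ltW].
apply: mulr_ge0; first by rewrite invr_ge0 sqr_ge0.
apply: divr_ge0 => //; apply: addr_ge0 => //.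
by apply: mulr_ge0; exact: sqr_ge0.
Qed.

Lemma boundary_integral (e : R) : 0 < e < 1 ->
  (\int[leb2]_(z in [set z | `]-oo, (1 - e)%R[%classic (sqnorm z)])
     \int[leb2]_(w in [set w | `[(1 - e)%R, 1%R[%classic (sqnorm w)])
       (H (sech2_dist z w) * hyp_area z * hyp_area w)%:E =
   \int[leb2 \x mu]_(u in boundary_region e) (boundary_integrand e u)%:E)%E.
Proof.
move=> /andP[e0 e1]; set r := 1 - e.
have r0 : 0 < r by rewrite subr_gt0.
have en0 : e != 0 by rewrite gt_eqF.
transitivity (\int[leb2]_(z in [set z | `]-oo, r[%classic (sqnorm z)]) J r (sqnorm z))%E.
  by apply: eq_integral => z _; exact: inner.
pose G := J r \_ `]-oo, r[.
have mG : measurable_fun setT G.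
  by apply: (measurable_restrictT _ _).1 => //; exact: measurable_funTS.
have G0 t : (0 <= G t)%E by apply: erestrict_ge0 => {}t _; exact: J0.
transitivity (\int[leb2]_z G (sqnorm z))%E.
  rewrite integral_mkcond; apply: eq_integral => w _.
  rewrite /G !patchE.
  by [].
apply: (etrans (integral_radial mG G0)).
have -> : (\int[mu]_(t in `]0%R, +oo[) G t = \int[mu]_(s in `]0%R, r[) J r s)%E.
  rewrite /G -integral_mkcondr; congr (integral _ _ _).
  by apply/seteqP; split => t /=; rewrite !in_itv/= andbT => /andP.
(* First [|z|^2 = 1 - e x], then [x = 1/a]. In terms of [a] the range stays inside []0, 1[] for
   every [e], which the later domination requires. *)
have -> : (\int[mu]_(s in `]0%R, r[) J r s =
    \int[mu]_(x in `]1%R, e^-1%R[) (J r (1 - e * x)%R * e%:E))%E.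
  have ne0 : - e != 0 by rewrite oppr_eq0.
  apply: (etrans (@affine_cov _ (- e) 1 `]0, r[ _ ne0 (measurable_itv _) (mJ r) (J0 r))).
  rewrite (_ : [set _ | _] = `]1, e^-1[%classic); last first.
    apply/seteqP; split => t /=; rewrite !in_itv/= /r -[t < e^-1](ltr_pM2l e0) divff//.
      by move=> /andP[? ?]; apply/andP; split; [rewrite -(ltr_pM2l e0)|]; lra.
    by rewrite -[1 < t](ltr_pM2l e0); lra.
  by apply: eq_integral => t _; rewrite normrN gtr0_norm// mulNr addrC.
have -> : (\int[mu]_(x in `]1%R, e^-1%R[) (J r (1 - e * x)%R * e%:E) =
    \int[mu]_(a in `]e, 1%R[) (J r (1 - e / a)%R * e%:E * (a ^- 2)%:E))%E.
  rewrite integral_invr_on//; last 3 first.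
  - by move=> x /=; rewrite !in_itv/= andbT => /andP[+ _]; exact: lt_trans.
  - have := mJ r => mJr; mfun.
  - by move=> x; apply: mule_ge0 => //; rewrite lee_fin ltW.
  congr (integral _ _ _); apply/seteqP; split => a /=; rewrite !in_itv/= !andbT.
    by move=> [a0]; rewrite invf_gt1// ltf_pV2// => /andP[-> ->].
  move=> /andP[ea a1]; have a0 := lt_trans e0 ea.
  by split => //; rewrite invf_gt1// ltf_pV2// ea a1.
rewrite [RHS]integral_mkcond.
have mS := measurable_boundary_region e.
have mB : measurable_fun setT ((fun u => (boundary_integrand e u)%:E) \_ (boundary_region e)).
  apply: (measurable_restrictT _ _).1 => //; apply: measurable_funTS.
  by apply/measurable_EFinP; exact: measurable_boundary_integrand.
have B0 u : (0 <= ((fun u => (boundary_integrand e u)%:E) \_ (boundary_region e)) u)%E.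
  by apply: erestrict_ge0 => {}u _; rewrite lee_fin boundary_integrand_ge0.
apply: (etrans _ (esym (integral_leb3 mB B0))).
rewrite -ge0_integralZl//; last 3 first.
- apply: measurable_funTS; have := mJ r => mJr; mfun.
- move=> a _; apply: mule_ge0; first by apply: mule_ge0 => //; rewrite lee_fin ltW.
  by rewrite lee_fin invr_ge0 sqr_ge0.
- by rewrite lee_fin pi_ge0.
rewrite [LHS]integral_mkcond; apply: eq_integral => a _.
rewrite patchE; case: ifPn => [/set_mem|aN]; last first.
  apply/esym/integral0_eq => s _; apply: integral0_eq => l _.
  rewrite patchE memNset// => -[/= h _ _].
  by move: aN; rewrite notin_setE/= in_itv/= h.
rewrite /= in_itv/= => /andP[ea a1].
have a0 := lt_trans e0 ea.
have an0 : a != 0 by rewrite gt_eqF.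
set c := e / a.
have c0 : 0 < c by rewrite divr_gt0.
have c1 : c < 1 by rewrite ltr_pdivrMr// mul1r.
have cn0 : c != 0 by rewrite gt_eqF.
have E (s l : R) : 0 < s -> s <= a -> 
    (boundary_integrand e ((a, s), l))%:E =
    ((2 * pi * (e * a ^- 2) * c * c)%:E * f3 ((1 - c, 1 - c * s), c * l)%R)%E.
  move=> s0 sa; rewrite /boundary_integrand /f3 /= -/c polar_scaled_sech2//; last 2 first.
  - by rewrite c0.
  - by rewrite (le_lt_trans (ler_wpM2l (ltW c0) sa))// /c divfK.
  rewrite -EFinM; congr EFin.
  rewrite [1 - (1 - c)](_ : _ = c); last by ring.
  rewrite [1 - (1 - c * s)](_ : _ = c * s); last by ring.
  have -> : 1 + (c * l) ^+ 2 = 1 + c ^+ 2 * l ^+ 2 by ring.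
  set h := H _; have -> : e = c * a by rewrite /c divfK.
  have kp : 1 + c ^+ 2 * l ^+ 2 != 0.
    by rewrite gt_eqF// ltr_pwDl// mulr_ge0 ?sqr_ge0.
  move: kp; set N := 1 + _ => kp.
  by field; rewrite cn0 an0 kp gt_eqF.
transitivity ((2 * pi * (e * a ^- 2) * c * c)%:E *
    \int[mu]_(s in `]0%R, a]) \int[mu]_(l in `]0%R, +oo[)
      f3 ((1 - c, 1 - c * s), c * l)%R)%E; last first.
  pose g (p : plane R) := f3 ((1 - c, 1 - c * p.1), c * p.2)%R.
  have mg : measurable_fun setT g by rewrite /g; mfun.
  have g0 p : (0 <= g p)%E by exact: f30.
  have k0 : (0 <= (2 * pi * (e * a ^- 2) * c * c)%:E)%E.
    rewrite lee_fin; do 2 (apply: mulr_ge0; last exact: ltW).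
    apply: mulr_ge0; first by apply: mulr_ge0 => //; exact: pi_ge0.
    by apply: mulr_ge0; [exact: ltW|rewrite invr_ge0 sqr_ge0].
  rewrite -ge0_integralZl//; last 2 first.
  - by apply: measurable_funTS; exact: (measurable_integral_leb mg g0 (measurable_itv _)).
  - by move=> s _; apply: integral_ge0 => l _; exact: f30.
  rewrite [LHS]integral_mkcond; apply: eq_integral => s _.
  rewrite patchE; case: ifPn => [/set_mem|sN]; last first.
    apply/esym/integral0_eq => l _.
    rewrite patchE memNset// => -[/= _ h _].
    by move: sN; rewrite notin_setE/= in_itv/= h.
  rewrite /= in_itv/= => /andP[s0 sa].
  have mgs : measurable_fun setT (fun l => g (s, l)) by mfun.
  rewrite -ge0_integralZl//; last exact: measurable_funTS.
  rewrite [LHS]integral_mkcond; apply: eq_integral => l _.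
  rewrite !patchE; case: ifPn => [/set_mem|lN]; last first.
    rewrite memNset// => -[/= _ _ h].
    by move: lN; rewrite notin_setE/= in_itv/= h.
  rewrite /= in_itv/= andbT => l0.
  rewrite mem_set//=; last by rewrite /boundary_region/= ea a1 s0 sa l0.
  by rewrite E.
have K2E s : K2 (1 - c, 1 - c * s) =
    (c%:E * \int[mu]_(l in `]0%R, +oo[) f3 ((1 - c, 1 - c * s), c * l)%R)%E.
  have mfs : measurable_fun setT (fun k => f3 ((1 - c, 1 - c * s), k)) by mfun.
  apply: (etrans (@affine_cov _ c 0 `]0, +oo[ _ cn0 (measurable_itv _) mfs (fun k => f30 _))).
  rewrite (_ : [set _ | _] = `]0, +oo[%classic); last first.
    by apply/seteqP; split => x /=; rewrite !in_itv/= !andbT addr0 pmulr_rgt0.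
  rewrite -ge0_integralZl//; last 2 first.
  - by apply: measurable_funTS; mfun.
  - by rewrite lee_fin ltW.
  by apply: eq_integral => l _; rewrite addr0 gtr0_norm// muleC.
have JE : J r (1 - c) = ((2 * c * c)%:E * \int[mu]_(s in `]0%R, a])
    \int[mu]_(l in `]0%R, +oo[) f3 ((1 - c, 1 - c * s), c * l)%R)%E.
  pose g (p : plane R) := f3 ((1 - c, 1 - c * p.1), c * p.2)%R.
  have mg : measurable_fun setT g by rewrite /g; mfun.
  have g0 p : (0 <= g p)%E by exact: f30.
  rewrite /J -[2 * c * c]mulrA EFinM -muleA; congr (_ * _)%E.
  have ca : c * a = e by rewrite /c divfK.
  have nc0 : - c != 0 by rewrite oppr_eq0.
  have mK : measurable_fun setT (fun t => K2 (1 - c, t)) by mfun.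
  apply: (etrans (@affine_cov _ (- c) 1 `[r, 1[ _ nc0 (measurable_itv _) mK (fun t => K20 _))).
  rewrite (_ : [set x : R | `[r, 1[%classic (- c * x + 1)] = `]0, a]%classic); last first.
    apply/seteqP; split => t /=; rewrite !in_itv/= /r -[t <= a](ler_pM2l c0) ca.
      by move=> /andP[? ?]; apply/andP; split; [rewrite -(pmulr_rgt0 _ c0)|]; lra.
    by rewrite -[0 < t](pmulr_rgt0 _ c0); lra.
  rewrite -ge0_integralZl//; last 3 first.
  - by apply: measurable_funTS; exact: (measurable_integral_leb mg g0 (measurable_itv _)).
  - by move=> s _; apply: integral_ge0 => l _; exact: f30.
  - by rewrite lee_fin mulr_ge0 ?ltW.
  apply: eq_integral => s _.
  by rewrite mulNr [- (c * s) + 1]addrC K2E normrN gtr0_norm// muleC muleA -EFinM.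
rewrite JE -/c -!muleA; set I := (\int[mu]_(s in _) _)%E.
rewrite muleCA (muleC I) !muleA -!EFinM; congr (_%:E * _)%E.
ring.
Qed.

End boundary_integral.

Section power_integral.
Context (R : realType).
Local Notation mu := (@lebesgue_measure R).

(** The substitution [y = x^(a+1)] in the integral of 1 covers negative exponents as well, where the
    integrand is unbounded at 0. *)
Lemma integral_powR (a : R) : -1 < a ->
  (\int[mu]_(x in `]0%R, 1%R[) (x `^ a)%:E = ((a + 1)^-1)%:E)%E.
Proof.
move=> a1.
have b0 : 0 < a + 1 by lra.
have pow1 b : (1 : R) `^ b = 1 by rewrite powR1.
have bn0 : a + 1 != 0 by rewrite gt_eqF.
have dP (x : R) : `]0, 1[%classic x ->
    is_derive x 1 (fun x : R => x `^ (a + 1)) ((a + 1) * x `^ a).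
  rewrite /= in_itv/= => /andP[x0 x1].
  have h := is_derive1_powR (a + 1) x0.
  by rewrite addrK in h.
have cP (b x : R) : 0 < x -> {for x, continuous (fun x : R => x `^ b)}.
  move=> x0; apply: differentiable_continuous; apply/derivable1_diffP.
  by have [] := is_derive1_powR b x0.
have m1 : measurable_fun setT (fun _ : R => 1%E : \bar R) by exact: measurable_cst.
have E := @increasing_cov R `]0, 1[ `]0, 1[ (fun x => x `^ (a + 1))
  (fun x => (a + 1) * x `^ a) (CovDomain01 R) _ _ dP _ (fun=> 1%E) _ _ m1 (fun=> lee01).
have {}E : (\int[mu]_(y in `]0%R, 1%R[) cst 1%E y =
    \int[mu]_(x in `]0%R, 1%R[) (1 * ((a + 1) * x `^ a)%:E))%E.
  apply: E.
  - move=> x /=; rewrite !in_itv/= => /andP[x0 x1].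
    rewrite powR_gt0//= -[ltRHS](pow1 (a + 1)).
    by rewrite gt0_ltr_powR// nnegrE ltW.
  - move=> y /=; rewrite !in_itv/= => /andP[y0 y1].
    exists (y `^ (a + 1)^-1); last by rewrite -powRrM mulVf// powRr1// ltW.
    rewrite /= in_itv/= powR_gt0//= -[ltRHS](pow1 (a + 1)^-1).
    by rewrite gt0_ltr_powR ?invr_gt0// nnegrE ltW.
  - move=> x /=; rewrite in_itv/= => /andP[x0 _].
    by apply: cvgM; [exact: cvg_cst|exact: cP].
  - move=> x y /=; rewrite !in_itv/= => /andP[x0 _] /andP[y0 _] xy.
    by rewrite gt0_ltr_powR// nnegrE ltW.
  - by move=> x _; rewrite mulr_ge0 ?powR_ge0// ltW.
move: E; rewrite integral_cst//= lebesgue_measure_itv/= lte01 sube0 mule1.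
under eq_integral do rewrite mul1e EFinM.
rewrite ge0_integralZl//; last 3 first.
- apply: measurable_funTS; apply/measurable_EFinP; exact: measurable_powR.
- by move=> x _; rewrite lee_fin powR_ge0.
- by rewrite lee_fin ltW.
move=> /(congr1 (mule ((a + 1)^-1)%:E)).
by rewrite mule1 muleA -EFinM mulVf// mul1e => <-.
Qed.

End power_integral.

(** * Dominated convergence for the rescaled boundary integral *)

Section boundary_limit.
Context (R : realType).
Local Notation mu := (@lebesgue_measure R).
Local Notation mR := (measurableTypeR R).

(** In the denominator [1 + s - c s >= 1] and [1 <= 1 + p <= 2], so the first square is at least
    [1/4] and the second term at least [l^2]. The factor [1 + c^2 l^2] is kept in the bound because
    the integrand divides by it. *)
Lemma scaled_sech2_bounds (c s l : R) : 0 <= c <= 1 -> 0 < s <= 1 ->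
  0 < scaled_sech2 c s l <= 4 * s * ((1 + c ^+ 2 * l ^+ 2) / (1 + l ^+ 2)).
Proof.
move=> /andP[c0 c1] /andP[s0 s1]; rewrite /scaled_sech2/=.
set a := Num.sqrt (1 - c); set b := Num.sqrt (1 - c * s).
have a01 : 0 <= a <= 1.
  by rewrite sqrtr_ge0/= -[leRHS]sqrtr1 ler_sqrt//; lra.
have b01 : 0 <= b <= 1.
  rewrite sqrtr_ge0/= -[leRHS]sqrtr1 ler_sqrt//.
  by have := mulr_ge0 c0 (ltW s0); lra.
have [p0 p1] : 0 <= a * b /\ a * b <= 1.
  by move: a01 b01 => /andP[? ?] /andP[? ?]; rewrite mulr_ge0// mulr_ile1.
set p := a * b in p0 p1 *.
set q := (1 + s - c * s) / (1 + p).
have q2 : 2^-1 <= q.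
  rewrite /q ler_pdivlMr; last by lra.
  have : 0 <= s * (1 - c) by apply: mulr_ge0; [exact: ltW|rewrite subr_ge0].
  lra.
have k0 : 0 < 1 + c ^+ 2 * l ^+ 2 by rewrite ltr_pwDl// mulr_ge0 ?sqr_ge0.
have l0 : 0 < 1 + l ^+ 2 by rewrite ltr_pwDl// sqr_ge0.
have d : (1 + l ^+ 2) / 4 <= q ^+ 2 + l ^+ 2 * (1 + p) ^+ 2.
  have h1 : 2^-1 ^+ 2 <= q ^+ 2 by rewrite ler_pXn2r// nnegrE; lra.
  have h2 : 1 <= (1 + p) ^+ 2 by rewrite expr_ge1//; lra.
  have := sqr_ge0 l; have := ler_wpM2l (sqr_ge0 l) h2; nra.
have d0 : 0 < q ^+ 2 + l ^+ 2 * (1 + p) ^+ 2.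
  by apply: lt_le_trans d; rewrite divr_gt0.
apply/andP; split; first by rewrite divr_gt0// mulr_gt0.
rewrite ler_pdivrMr//; move: d; set N := _ + _ * (1 + p) ^+ 2 => d.
set K := 1 + _ in k0 *; set L := 1 + _ in l0 d *.
have -> : s * K = 4 * s * (K / L) * (L / 4) by field; rewrite gt_eqF.
apply: ler_wpM2l => //; apply: mulr_ge0; first by apply: mulr_ge0 => //; exact: ltW.
by rewrite divr_ge0// ltW.
Qed.

Lemma scaled_sech2_cvg (c : R^nat) (s l : R) : 0 < s -> c @ \oo --> 0 ->
  scaled_sech2 (c n) s l @[n --> \oo] --> scaled_sech2 0 s l.
Proof.
move=> s0 c0; rewrite /scaled_sech2/=.
have cX (f : R^nat) (a : R) : f @ \oo --> a -> f n ^+ 2 @[n --> \oo] --> a ^+ 2.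
  by move=> fa; exact: cvgM.
have cs : c n * s @[n --> \oo] --> 0 * s by apply: cvgM => //; exact: cvg_cst.
have csqrt (f : R^nat) (a : R) : f @ \oo --> a -> Num.sqrt (f n) @[n --> \oo] --> Num.sqrt a.
  by move=> fa; apply: cvg_comp fa _; exact: sqrt_continuous.
have cp : Num.sqrt (1 - c n) * Num.sqrt (1 - c n * s) @[n --> \oo] -->
    Num.sqrt (1 - 0) * Num.sqrt (1 - 0 * s).
  by apply: cvgM; apply: csqrt; apply: cvgB => //; exact: cvg_cst.
set p0 := Num.sqrt (1 - 0) * _ in cp *.
have p00 : 0 <= p0 by rewrite mulr_ge0// sqrtr_ge0.
have cp1 : 1 + Num.sqrt (1 - c n) * Num.sqrt (1 - c n * s) @[n --> \oo] --> 1 + p0.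
  by apply: cvgD => //; exact: cvg_cst.
apply: cvgM.
  apply: cvgM; first exact: cvg_cst.
  apply: cvgD; first exact: cvg_cst.
  by apply: cvgM; [exact: cX|exact: cvg_cst].
apply: cvgV.
  rewrite mul0r subr0 gt_eqF//; apply: ltr_pwDl; last by apply: mulr_ge0; exact: sqr_ge0.
  by rewrite exprn_gt0// divr_gt0//; lra.
apply: cvgD.
  apply: cX; apply: cvgM.
    by apply: cvgB => //; exact: cvg_cst.
  by apply: cvgV => //; rewrite gt_eqF//; lra.
by apply: cvgM; [exact: cvg_cst|exact: cX].
Qed.

Variables (H : R -> R) (gam M : R).
Hypotheses (mH : measurable_fun setT H) (H0 : forall v, 0 <= H v).
Hypotheses (gam1 : 1 < gam) (M0 : 0 <= M).
Hypothesis HM : forall v, 0 < v <= 4 -> H v <= M * v `^ gam.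
Hypothesis cH : forall v, 0 < v -> {for v, continuous H}.

(* e * boundary_integrand e, except at e = 0 where boundary_integrand divides by
   0; there it is the limit. *)
Definition scaled_integrand (e : R) (u : plane R * mR) : R :=
  2 * pi * (u.1.2 ^- 2 * (H (scaled_sech2 (e / u.1.1) u.1.2 u.2)
    / (1 + (e / u.1.1) ^+ 2 * u.2 ^+ 2))).

Lemma scaled_integrandE (e : R) u : e != 0 ->
  scaled_integrand e u = e * boundary_integrand H e u.
Proof.
by move=> e0; rewrite /scaled_integrand /boundary_integrand mulrA; congr (_ * _); field.
Qed.

Let mF e : measurable_fun setT (fun u => (scaled_integrand e u)%:E).
Proof. by rewrite /scaled_integrand /scaled_sech2/=; mfun. Qed.

Let F0 e u : (0 <= (scaled_integrand e u)%:E)%E.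
Proof.
rewrite lee_fin; apply: mulr_ge0.
  by apply: mulr_ge0 => //; exact: pi_ge0.
apply: mulr_ge0; first by rewrite invr_ge0 sqr_ge0.
apply: divr_ge0 => //; apply: addr_ge0 => //.
by apply: mulr_ge0; exact: sqr_ge0.
Qed.

Let box : set (plane R * mR) := [set u | [/\ 0 < u.1.1 < 1, 0 < u.1.2 < 1 & 0 < u.2]].

Let mbox : measurable box.
Proof.
rewrite (_ : box =
   ([set u | `]0, 1[%classic u.1.1] `&` [set u | `]0, 1[%classic u.1.2])
   `&` [set u | `]0, +oo[%classic u.2]).
  have mpre (f : plane R * mR -> R) (A : set R) : measurable_fun setT f -> measurable A ->
      measurable [set u | A (f u)].
    by move=> mf mA; rewrite -[X in measurable X]setTI; exact: mf.
  by apply: measurableI; [apply: measurableI|]; apply: mpre => //; mfun.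
apply/seteqP; split => u /=; rewrite !in_itv/= !andbT.
  by move=> [? ? ?].
by move=> [[? ?] ?].
Qed.

(** The factor [4^gam] comes from the bound [4 s] on [scaled_sech2]. *)
Let C := 2 * pi * (M * 4 `^ gam).

Let C0 : 0 <= C.
Proof. by rewrite !mulr_ge0 ?pi_ge0 ?powR_ge0. Qed.

Let dom (u : plane R * mR) : \bar R :=
  (C * (u.1.2 `^ (gam - 2) * (1 + u.2 ^+ 2)^-1))%:E.

Let mdom : measurable_fun setT dom.
Proof.
rewrite /dom; mfun; apply: (measurableT_comp (measurable_powR _)); mfun.
Qed.

Let dom0 u : (0 <= dom u)%E.
Proof.
rewrite lee_fin; apply: mulr_ge0 => //; apply: mulr_ge0; first exact: powR_ge0.
by rewrite invr_ge0 addr_ge0// sqr_ge0.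
Qed.

(** The integral factors: length 1 in [a], a power of exponent [gam - 2 > -1] in [s], and [pi/2] in
    [l]. *)
Let integrable_dom : (leb2 \x mu)%E.-integrable setT (dom \_ box).
Proof.
have mD : measurable_fun setT (dom \_ box).
  by apply: (measurable_restrictT _ _).1 => //; exact: measurable_funTS.
have D0 u : (0 <= (dom \_ box) u)%E by apply: erestrict_ge0.
apply/integrableP; split => //.
under eq_integral do rewrite gee0_abs//.
rewrite (integral_leb3 mD D0).
have atanE : (\int[mu]_(k in `]0%R, +oo[) ((1 + k ^+ 2)^-1)%:E = (pi / 2)%:E)%E.
  rewrite integral_itv_obnd_cbnd; last by apply: measurable_funTS; mfun.
  exact: integral0y_oneDsqr.
have -> : (\int[mu]_x \int[mu]_y \int[mu]_z (dom \_ box) ((x, y), z) =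
  \int[mu]_(x in `]0%R, 1%R[) cst (C * (pi / 2) * (gam - 2 + 1)^-1)%:E x)%E.
  rewrite [RHS]integral_mkcond; apply: eq_integral => x _.
  rewrite patchE; case: ifPn => [/set_mem xI|xN]; last first.
    apply: integral0_eq => s _; apply: integral0_eq => l _.
    rewrite patchE memNset// => -[/= h _ _].
    by move: xN; rewrite notin_setE/= in_itv/= h.
  rewrite [RHS]EFinM -integral_powR; last by move: gam1; lra.
  have mp : measurable_fun setT (fun x : R => (x `^ (gam - 2))%:E).
    apply/measurable_EFinP; exact: measurable_powR.
  rewrite -ge0_integralZl//; last 3 first.
  - exact: measurable_funTS.
  - by move=> y _; rewrite lee_fin powR_ge0.
  - by rewrite lee_fin mulr_ge0// divr_ge0// pi_ge0.
  rewrite [RHS]integral_mkcond; apply: eq_integral => y _.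
  rewrite patchE; case: ifPn => [/set_mem yI|yN]; last first.
    apply: integral0_eq => l _.
    rewrite patchE memNset// => -[/= _ h _].
    by move: yN; rewrite notin_setE/= in_itv/= h.
  transitivity ((C * y `^ (gam - 2))%:E * (pi / 2)%:E)%E; last first.
    by rewrite -!EFinM; congr EFin; ring.
  rewrite -atanE -ge0_integralZl//; last 3 first.
  - by apply: measurable_funTS; mfun.
  - by move=> l _; rewrite lee_fin invr_ge0 addr_ge0// sqr_ge0.
  - by rewrite lee_fin mulr_ge0// powR_ge0.
  rewrite [RHS]integral_mkcond; apply: eq_integral => l _.
  rewrite !patchE; case: ifPn => [/set_mem[_ _ /= l0]|lN].
    by rewrite mem_set/= ?in_itv/= ?l0// /dom -EFinM mulrA.
  rewrite memNset//= in_itv/= andbT => l0; move: lN; rewrite notin_setE; apply.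
  by split => //; move: xI yI; rewrite /= !in_itv.
by rewrite integral_cst//= lebesgue_measure_itv/= lte01 sube0 mule1 ltry.
Qed.

Let sub_box e : 0 <= e -> boundary_region e `<=` box.
Proof.
move=> e0 u [/= /andP[ea a1] /andP[s0 sa] l0]; split => //.
  by rewrite (le_lt_trans e0 ea).
by rewrite s0 (le_lt_trans sa a1).
Qed.

Let F_le_dom e u : 0 <= e -> boundary_region e u ->
  ((scaled_integrand e u)%:E <= dom u)%E.
Proof.
move=> e0 ru; have [/andP[a0 a1] /andP[s0 s1] l0] := sub_box e0 ru.
have [/andP[ea _] _ _] := ru.
rewrite lee_fin /scaled_integrand /C -[leRHS]mulrA.
set c := e / u.1.1; set s := u.1.2 in s0 s1 *; set l := u.2 in l0 *.
have c0 : 0 <= c by rewrite divr_ge0// ltW.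
have c1 : c <= 1 by rewrite ler_pdivrMr// mul1r ltW.
have [||v0 v4] := andP (@scaled_sech2_bounds c s l _ _); [by rewrite c0|by rewrite s0 ltW|].
set v := scaled_sech2 c s l in v0 v4 *.
set K := 1 + c ^+ 2 * l ^+ 2 in v4 *; set L := 1 + l ^+ 2 in v4 *.
have L0 : 0 < L by rewrite ltr_pwDl// sqr_ge0.
have K0 : 0 < K by rewrite ltr_pwDl// mulr_ge0 ?sqr_ge0.
have KL0 : 0 <= K / L by rewrite divr_ge0 ?ltW.
have KL : K / L <= 1.
  rewrite ler_pdivrMr// mul1r lerD2l ler_piMl ?sqr_ge0//.
  by rewrite exprn_ile1.
apply: ler_wpM2l; first by apply: mulr_ge0 => //; exact: pi_ge0.
have s20 : 0 <= s ^- 2 by rewrite invr_ge0 sqr_ge0.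
have v44 : v <= 4.
  apply: (le_trans v4); rewrite -[leRHS]mulr1; apply: ler_pM => //.
    by rewrite mulr_ge0// ltW.
  by rewrite ler_piMr// ltW.
(* Since [K/L <= 1 < gam], the power [(K/L)^gam] is at most [K/L]. The remaining [K] cancels the
   denominator of the integrand and leaves [1/L]. *)
have Hv : H v <= M * ((4 * s) `^ gam * (K / L)).
  apply: (le_trans (HM _)); first by rewrite v0.
  apply: ler_wpM2l => //.
  apply: (@le_trans _ _ ((4 * s * (K / L)) `^ gam)).
    have g0 : 0 <= gam by move: gam1; lra.
    apply: (ge0_ler_powR g0) => //; rewrite nnegrE; first exact: ltW.
    by rewrite mulr_ge0// mulr_ge0// ltW.
  have s40 : 0 <= 4 * s by rewrite mulr_ge0// ltW.
  rewrite powRM//; apply: ler_wpM2l; first exact: powR_ge0.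
  have [->|KLn0] := eqVneq (K / L) 0.
    by rewrite powR0//; move: gam1; apply: contraTN => /eqP ->; rewrite -leNgt ler01.
  have KLp : 0 < K / L by rewrite lt_neqAle eq_sym KLn0.
  by apply: ge1r_powR; [rewrite KLp|exact: ltW].
apply: (@le_trans _ _ (s ^- 2 * (M * ((4 * s) `^ gam * (K / L)) / K))).
  apply: ler_wpM2l => //; apply: ler_wpM2r => //; rewrite invr_ge0; exact: ltW.
rewrite le_eqVlt; apply/orP; left; apply/eqP.
rewrite powRM//; last exact: ltW.
have -> : s `^ (gam - 2) = s `^ gam * s ^- 2.
  by rewrite powRD ?(gt_eqF s0) ?implybT// powR_invn ?ltW.
have Kn0 : K != 0 by rewrite gt_eqF.
have Ln0 : L != 0 by rewrite gt_eqF.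
have sn0 : s != 0 by rewrite gt_eqF.
by field; rewrite Kn0 Ln0 sn0.
Qed.

Let Fr e := (fun u => (scaled_integrand e u)%:E) \_ (boundary_region e).

Let mFr e : measurable_fun setT (Fr e).
Proof.
apply: (measurable_restrictT _ _).1; first exact: measurable_boundary_region.
exact: measurable_funTS.
Qed.

Let Fr_le_dom e u : 0 <= e -> (`|Fr e u| <= (dom \_ box) u)%E.
Proof.
move=> e0; rewrite gee0_abs; last by apply: erestrict_ge0.
rewrite /Fr !patchE; case: ifPn => [/set_mem eu|_].
  by rewrite mem_set; [exact: F_le_dom|exact: sub_box eu].
by case: ifPn.
Qed.

Lemma scaled_integrand_lty :
  (\int[leb2 \x mu]_(u in boundary_region 0) (scaled_integrand 0 u)%:E < +oo)%E.
Proof.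
rewrite integral_mkcond -/(Fr 0).
have /integrableP[_] : (leb2 \x mu)%E.-integrable setT (Fr 0).
  apply: (le_integrable measurableT (mFr 0) _ integrable_dom) => u _.
  rewrite [leRHS]gee0_abs; last exact: erestrict_ge0.
  exact: Fr_le_dom.
apply: le_lt_trans; apply: ge0_le_integral => //.
- by move=> u _; apply: erestrict_ge0.
- by apply: measurableT_comp => //.
- by move=> u _; exact: lee_abs.
Qed.

(** The domain also varies with [e n], so dominated convergence is applied to the integrands cut off
    to their regions. A point of the limit region belongs to the region of [e n] as soon as
    [e n < a], and any other point belongs to none of them. *)
Lemma boundary_limit (e : R^nat) : (forall n, 0 < e n) -> e @ \oo --> 0 ->
  (\int[leb2 \x mu]_(u in boundary_region (e n)) (scaled_integrand (e n) u)%:E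
    @[n --> \oo] -->
  \int[leb2 \x mu]_(u in boundary_region 0%R) (scaled_integrand 0 u)%:E)%E.
Proof.
move=> e0 e_to0.
rewrite [X in _ --> X]integral_mkcond -/(Fr 0).
rewrite (_ : (fun n => _) = (fun n => \int[leb2 \x mu]_u Fr (e n) u)%E); last first.
  by apply/funext => n; rewrite integral_mkcond.
have [] // := @dominated_convergence _ _ _ (leb2 \x mu)%E setT measurableT
  (fun n => Fr (e n)) (Fr 0) (dom \_ box) (fun n => mFr (e n)) (mFr 0) _ integrable_dom _.
- apply: aeW => u _.
  have [u0|u0] := pselect (boundary_region 0 u); last first.
    rewrite (_ : (fun n => Fr (e n) u) = fun=> Fr 0 u); first exact: cvg_cst.
    apply/funext => n; rewrite /Fr !patchE !memNset//.
    move=> [/= /andP[h1 h2] h3 h4]; apply: u0; split => //.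
    by rewrite h2 (lt_trans (e0 n)).
  have [/= /andP[a0 a1] /andP[s0 sa] l0] := u0.
  rewrite {2}/Fr patchE mem_set//.
  have : (scaled_integrand (e n) u)%:E @[n --> \oo] --> (scaled_integrand 0 u)%:E.
    apply: cvg_EFin; first by near=> n.
    have ea : e n / u.1.1 @[n --> \oo] --> 0.
      by rewrite -(mul0r u.1.1^-1); apply: cvgM => //; exact: cvg_cst.
    rewrite /scaled_integrand (mul0r u.1.1^-1).
    apply: cvgM; first exact: cvg_cst.
    apply: cvgM; first exact: cvg_cst.
    apply: cvgM.
      apply: continuous_cvg; last exact: scaled_sech2_cvg.
      apply: cH; have := @scaled_sech2_bounds 0 u.1.2 u.2.
      by rewrite lexx ler01 s0 (le_trans sa (ltW a1)) => /(_ isT isT)/andP[].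
    apply: cvgV; first by rewrite expr0n/= mul0r addr0 oner_eq0.
    apply: cvgD; first exact: cvg_cst.
    by apply: cvgM; [exact: cvgM|exact: cvg_cst].
  apply: cvg_trans; apply: near_eq_cvg.
  have : \forall n \near \oo, e n < u.1.1.
    by apply: cvgr_lt e_to0 _ _ => //; rewrite a0.
  apply: filterS => n ena; rewrite /Fr patchE mem_set//.
  by split => //=; rewrite ?ena ?a1 ?s0 ?sa.
- by apply: aeW => u n _; apply: Fr_le_dom; exact: ltW.
Unshelve. all: by end_near. Qed.

End boundary_limit.

(** * Evaluation of the limit integral *)

Section limit_value.
Context (R : realType).
Local Notation mu := (@lebesgue_measure R).
Local Notation mR := (measurableTypeR R).
Variable H : R -> R.
Hypotheses (mH : measurable_fun setT H) (H0 : forall v, 0 <= H v).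

Lemma integral_atan (b : R) : 0 < b ->
  (\int[mu]_(k in `]0%R, b[) ((1 + k ^+ 2)^-1)%:E = (atan b)%:E)%E.
Proof.
move=> b0.
have k0 (k : R) : 0 <= (1 + k ^+ 2)^-1 by rewrite invr_ge0 addr_ge0// sqr_ge0.
have mk : measurable_fun setT (fun k : R => ((1 + k ^+ 2)^-1)%:E) by mfun.
have -> : (\int[mu]_(k in `]0%R, b[) ((1 + k ^+ 2)^-1)%:E =
    \int[mu]_(k in `[0%R, b]) ((1 + k ^+ 2)^-1)%:E)%E.
  by apply/esym/(@integral_itv_bndoo R 0 b _ true false); exact: measurable_funTS.
rewrite -(integral0_oneDsqr (ltW b0)) /Rintegral fineK// ge0_fin_numE; last first.
  by apply: integral_ge0 => k _; rewrite lee_fin.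
apply: (@le_lt_trans _ _ (\int[mu]_(k in `[0%R, +oo[) ((1 + k ^+ 2)^-1)%:E)%E).
  apply: ge0_subset_integral => //; first exact: measurable_funTS.
  by move=> k /=; rewrite !in_itv/= andbT => /andP[].
by rewrite [X in (X < _)%E](integral0y_oneDsqr R) ltry.
Qed.

Let T (t : R) : \bar R := (\int[mu]_(k in `]0%R, +oo[) (H (t / (1 + k ^+ 2)))%:E)%E.

Let mT : measurable_fun setT T.
Proof.
pose f (p : plane R) := (H (p.1 / (1 + p.2 ^+ 2)))%:E.
have mf : measurable_fun setT f by rewrite /f; mfun.
have f0 p : (0 <= f p)%E by rewrite lee_fin.
exact: (measurable_integral_leb mf f0 (measurable_itv _)).
Qed.

Let T0 t : (0 <= T t)%E.
Proof. by apply: integral_ge0 => k _; rewrite lee_fin. Qed.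

Lemma scaled_sech2_0 (s k : R) : 0 < s ->
  scaled_sech2 0 s ((1 + s) / 4 * k) = 4 * s / (1 + s) ^+ 2 / (1 + k ^+ 2).
Proof.
move=> s0; rewrite /scaled_sech2/= !mul0r !subr0 sqrtr1 mulr1 expr0n/= mul0r addr0 mulr1.
have s1 : 1 + s != 0 by rewrite gt_eqF// addr_gt0.
have k1 : 0 < 1 + k ^+ 2 by rewrite ltr_pwDl// sqr_ge0.
have -> : ((1 + s) / (1 + 1)) ^+ 2 + ((1 + s) / 4 * k) ^+ 2 * (1 + 1) ^+ 2 =
  (1 + s) ^+ 2 / 4 * (1 + k ^+ 2) by field.
set K := 1 + k ^+ 2 in k1 *.
by field; rewrite s1 gt_eqF.
Qed.

Let inner (s : R) : 0 < s ->
  (\int[mu]_(l in `]0%R, +oo[) (scaled_integrand H 0 ((0, s), l))%:E =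
   (2 * pi * s ^- 2 * ((1 + s) / 4))%:E * T (4 * s / (1 + s) ^+ 2))%E.
Proof.
move=> s0.
have c0 : 0 < (1 + s) / 4 by rewrite divr_gt0// addr_gt0.
have cn0 : (1 + s) / 4 != 0 by rewrite gt_eqF.
pose g (l : R) := (scaled_integrand H 0 ((0, s), l))%:E.
have mg : measurable_fun setT g by rewrite /g /scaled_integrand /scaled_sech2/=; mfun.
have g0 l : (0 <= g l)%E.
  rewrite lee_fin /scaled_integrand/=; apply: mulr_ge0.
    by apply: mulr_ge0 => //; exact: pi_ge0.
  by rewrite !mul0r expr0n/= mul0r addr0 divr1 mulr_ge0// invr_ge0 sqr_ge0.
apply: (etrans (@affine_cov _ ((1 + s) / 4) 0 `]0, +oo[ _ cn0 (measurable_itv _) mg g0)).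
rewrite (_ : [set x : R | `]0, +oo[%classic ((1 + s) / 4 * x + 0)] = `]0, +oo[%classic); last first.
  by apply/seteqP; split => x /=; rewrite !in_itv/= !andbT addr0 pmulr_rgt0.
rewrite /T -ge0_integralZl//; last 3 first.
- by apply: measurable_funTS; mfun.
- by move=> k _; rewrite lee_fin.
- rewrite lee_fin; apply: mulr_ge0; last exact: ltW.
  by apply: mulr_ge0; [apply: mulr_ge0 => //; exact: pi_ge0|rewrite invr_ge0 sqr_ge0].
apply: eq_integral => k _.
rewrite /g /scaled_integrand/= addr0 mul0r scaled_sech2_0// gtr0_norm// -!EFinM.
by rewrite expr0n/= mul0r addr0 divr1; congr EFin; ring.
Qed.

(* The substitutions are t = 4 s/(1 + s)^2, l = (1 + s) k/4 and t = v (1 + k^2). *)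
Lemma scaled_integrand0_value :
  (\int[leb2 \x mu]_(u in boundary_region 0) (scaled_integrand H 0 u)%:E =
   (2 * pi)%:E * \int[mu]_(v in `]0%R, 1%R[) (H v * v ^- 2 * atan (Num.sqrt (v^-1 - 1)))%:E)%E.
Proof.
rewrite integral_mkcond.
set F := (_ \_ _).
have mF : measurable_fun setT F.
  apply: (measurable_restrictT _ _).1; first exact: measurable_boundary_region.
  by apply: measurable_funTS; rewrite /scaled_integrand /scaled_sech2/=; mfun.
have F0 u : (0 <= F u)%E.
  apply: erestrict_ge0 => {}u _; rewrite lee_fin /scaled_integrand/=; apply: mulr_ge0.
    by apply: mulr_ge0 => //; exact: pi_ge0.
  by rewrite !mul0r expr0n/= mul0r addr0 divr1 mulr_ge0// invr_ge0 sqr_ge0.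
apply: (etrans (integral_leb3 mF F0)).
pose g (p : plane R) := (\int[mu]_z F (p, z))%E.
have mg : measurable_fun setT g by exact: (measurable_integral_snd mu measurableT mF F0).
have g0 p : (0 <= g p)%E by apply: integral_ge0.
apply: (etrans (tonelli_leb mg g0 measurableT measurableT)).
pose g1 (t : R) := ((2 * pi * t ^- 2)%:E * T t)%E.
have mg1 : measurable_fun setT g1.
  by have := mT => mT'; rewrite /g1; mfun.
have pi20 : 0 <= 2 * pi :> R by rewrite mulr_ge0// pi_ge0.
have g10 t : (0 <= g1 t)%E.
  by apply: mule_ge0 => //; rewrite lee_fin mulr_ge0// invr_ge0 sqr_ge0.
transitivity (\int[mu]_(t in `]0%R, 1%R[) g1 t)%E.
  apply: (etrans _ (esym (integral_koebe mg1 g10))).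
  rewrite [RHS]integral_mkcond; apply: eq_integral => s _.
  rewrite patchE; case: ifPn => [/set_mem|sN]; last first.
    apply: integral0_eq => a _; apply: integral0_eq => l _.
    rewrite /F patchE memNset// => -[/= /andP[a0 a1] /andP[s0 sa] _].
    by move: sN; rewrite notin_setE/= in_itv/= s0 (le_lt_trans sa a1).
  rewrite /= in_itv/= => /andP[s0 s1].
  (* At [e = 0] the integrand no longer involves [a]. Integrating over [a] gives [1 - s], exactly
     the factor missing from the Jacobian of [t = 4 s/(1 + s)^2]. *)
  transitivity (\int[mu]_(a in `[s, 1%R[) cst
      ((2 * pi * s ^- 2 * ((1 + s) / 4))%:E * T (4 * s / (1 + s) ^+ 2)) a)%E.
    rewrite [RHS]integral_mkcond; apply: eq_integral => a _.
    rewrite patchE; case: ifPn => [/set_mem|aN]; last first.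
      apply: integral0_eq => l _.
      rewrite /F patchE memNset// => -[/= /andP[a0 a1] /andP[_ sa] _].
      by move: aN; rewrite notin_setE/= in_itv/= sa a1.
    rewrite /= in_itv/= => /andP[sa a1].
    rewrite -inner// [RHS]integral_mkcond; apply: eq_integral => l _.
    rewrite /F !patchE.
    have -> : (((a, s), l) \in boundary_region 0) = (l \in `]0, +oo[%classic).
      apply/idP/idP => /set_mem h; apply/mem_set; move: h; rewrite /= ?in_itv/= ?andbT.
        by move=> [].
      by move=> l0; split => //=; rewrite ?s0 ?(lt_le_trans s0 sa).
    by case: ifPn => // _; rewrite /scaled_integrand/= !mul0r.
  rewrite integral_cst//= lebesgue_measure_itv/= lte_fin s1 -EFinD.
  rewrite /g1 muleAC -EFinM [RHS]muleAC -EFinM; congr (_%:E * _)%E.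
  have s10 : 1 + s != 0 by rewrite gt_eqF// addr_gt0.
  by field; rewrite s10 gt_eqF.
pose f1 (p : plane R) := (2 * pi * p.1 ^- 2 * H (p.1 / (1 + p.2 ^+ 2)))%:E.
have mf1 : measurable_fun setT f1 by rewrite /f1; mfun.
have f10 p : (0 <= f1 p)%E.
  by rewrite lee_fin mulr_ge0// mulr_ge0// invr_ge0 sqr_ge0.
transitivity (\int[mu]_(t in `]0%R, 1%R[) \int[mu]_(k in `]0%R, +oo[) f1 (t, k))%E.
  apply: eq_integral => t _; rewrite /g1 /T -ge0_integralZl//.
  - by apply: measurable_funTS; mfun.
  - by move=> k _; rewrite lee_fin.
  - by rewrite lee_fin mulr_ge0// invr_ge0 sqr_ge0.
apply: (etrans (tonelli_leb mf1 f10 (measurable_itv _) (measurable_itv _))).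
(* In terms of [(k, v)] the condition [t < 1] is [k < sqrt(1/v - 1)]. Integrating [1/(1 + k^2)] over
   these [k] produces the arctangent. *)
pose A : set (plane R) := [set p | 0 < p.2 < 1 /\ (1 + p.1 ^+ 2) * p.2 < 1].
have mA : measurable A.
  rewrite (_ : A = [set p | `]0, 1[%classic p.2] `&` [set p : plane R | `]-oo, 1[%classic ((1 + p.1 ^+ 2) * p.2)]); last first.
    by apply/seteqP; split => p /=; rewrite !in_itv/=.
  have mpre (f : plane R -> R) (B : set R) : measurable_fun setT f -> measurable B ->
      measurable [set u | B (f u)].
    by move=> mf mB; rewrite -[X in measurable X]setTI; exact: mf.
  by apply: measurableI; apply: mpre => //; mfun.
pose f2 (p : plane R) := (2 * pi * (H p.2 * p.2 ^- 2) * (1 + p.1 ^+ 2)^-1)%:E.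
have mf2 : measurable_fun setT f2 by rewrite /f2; mfun.
have k1 (k : R) : 0 < 1 + k ^+ 2 by rewrite ltr_pwDl// sqr_ge0.
have f20 p : (0 <= f2 p)%E.
  rewrite lee_fin; apply: mulr_ge0; last by rewrite invr_ge0 ltW.
  by apply: mulr_ge0 => //; apply: mulr_ge0 => //; rewrite invr_ge0 sqr_ge0.
pose h := f2 \_ A.
have mh : measurable_fun setT h.
  by apply: (measurable_restrictT _ mA).1; exact: measurable_funTS.
have h0 p : (0 <= h p)%E by apply: erestrict_ge0.
transitivity (\int[mu]_(k in `]0%R, +oo[) \int[mu]_v h (k, v))%E.
  apply: eq_integral => k _.
  have kn0 : 1 + k ^+ 2 != 0 by rewrite gt_eqF.
  have mfk : measurable_fun setT (fun t => f1 (t, k)) by mfun.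
  apply: (etrans (@affine_cov _ (1 + k ^+ 2) 0 `]0, 1[ _ kn0 (measurable_itv _) mfk (fun t => f10 _))).
  rewrite [LHS]integral_mkcond; apply: eq_integral => v _.
  rewrite /h !patchE.
  have -> : (v \in [set x : R | `]0, 1[%classic ((1 + k ^+ 2) * x + 0)]) = ((k, v) \in A).
    apply/idP/idP => /set_mem vv; apply/mem_set; move: vv; rewrite /= in_itv/= addr0.
      rewrite pmulr_rgt0// => /andP[v0 v1]; split => //; rewrite v0/=.
      by apply: le_lt_trans v1; rewrite ler_peMl ?lerDl ?sqr_ge0// ltW.
    by move=> [/andP[v0 _] ->]; rewrite mulr_gt0.
  case: ifPn => // /set_mem[/= /andP[v0 _] _].
  rewrite addr0 /f1 /f2/= gtr0_norm// -EFinM; congr EFin.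
  have -> : (1 + k ^+ 2) * v / (1 + k ^+ 2) = v by rewrite mulrAC mulfV// mul1r.
  by field; rewrite kn0 gt_eqF.
apply: (etrans (tonelli_leb mh h0 (measurable_itv _) measurableT)).
have mat : measurable_fun setT (fun v : R => (H v * v ^- 2 * atan (Num.sqrt (v^-1 - 1)))%:E).
  mfun; apply: (measurableT_comp (continuous_measurable_fun (@continuous_atan R))); mfun.
rewrite -ge0_integralZl//; last 2 first.
- exact: measurable_funTS.
- move=> v _; rewrite lee_fin; apply: mulr_ge0.
    by apply: mulr_ge0 => //; rewrite invr_ge0 sqr_ge0.
  by rewrite -atan0 le_atan// sqrtr_ge0.
rewrite [RHS]integral_mkcond; apply: eq_integral => v _.
rewrite patchE; case: ifPn => [/set_mem|vN]; last first.
  apply: integral0_eq => k _; rewrite /h patchE memNset// => -[/= vv _].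
  by move: vN; rewrite notin_setE/= in_itv/= vv.
rewrite /= in_itv/= => /andP[v0 v1].
have vv0 : 0 < v^-1 - 1 by rewrite subr_gt0 invf_gt1.
have b0 : 0 < Num.sqrt (v^-1 - 1) by rewrite sqrtr_gt0.
rewrite [(H v * v ^- 2 * _)%:E]EFinM -integral_atan// muleA -EFinM.
rewrite -ge0_integralZl//; last 3 first.
- by apply: measurable_funTS; mfun.
- by move=> k _; rewrite lee_fin invr_ge0 ltW.
- by rewrite lee_fin mulr_ge0// mulr_ge0// invr_ge0 sqr_ge0.
rewrite [LHS]integral_mkcond [RHS]integral_mkcond; apply: eq_integral => k _.
rewrite !patchE.
have kb : 0 < k -> ((k, v) \in A) = (k < Num.sqrt (v^-1 - 1)).
  move=> k0; have -> : k = Num.sqrt (k ^+ 2) by rewrite sqrtr_sqr gtr0_norm.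
  rewrite ltr_sqrt// sqrtr_sqr gtr0_norm// ltrBrDl -[_ < v^-1](ltr_pM2r v0) mulVf ?gt_eqF//.
  by apply/idP/idP => [/set_mem[]//|kv]; apply/mem_set; split => //=; rewrite v0.
have [k0|k0] := ltP 0 k; last first.
  by rewrite !memNset//= in_itv/= ?andbT ?ltNge k0.
rewrite mem_set/= ?in_itv/= ?k0// /h patchE kb//.
case: ifPn => kk; first by rewrite mem_set/= ?in_itv/= ?k0// -EFinM.
by rewrite memNset//= in_itv/= k0 (negbTE kk).
Qed.

End limit_value.

(** * The norm of the Jacobi polynomials P_m^(0,b) *)

Section falling_factorial.
Context (R : realFieldType).
Implicit Types (x y : R).

Definition falling x k : R := \prod_(i < k) (x - i%:R).

Lemma falling0 x : falling x 0 = 1. Proof. exact: big_ord0. Qed.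

Lemma fallingSr x k : falling x k.+1 = falling x k * (x - k%:R).
Proof. by rewrite /falling big_ord_recr. Qed.

Lemma fallingS x k : falling x k.+1 = x * falling (x - 1) k.
Proof.
rewrite /falling big_ord_recl/= subr0; congr (_ * _).
by apply: eq_bigr => i _; rewrite /bump/= add1n -natr1; ring.
Qed.

Lemma fallingD x p q : falling x (p + q) = falling x p * falling (x - p%:R) q.
Proof.
rewrite /falling big_split_ord/=; congr (_ * _).
by apply: eq_bigr => i _; rewrite natrD; ring.
Qed.

Lemma falling_nat n k : falling n%:R k = (n ^_ k)%:R.
Proof.
elim: k => [|k IH]; first by rewrite falling0 ffactn0.
rewrite fallingSr IH ffactnSr natrM.
have [kn|nk] := leqP k n; first by rewrite natrB.
by rewrite ffact_small// !mul0r.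
Qed.

Lemma fallingB x k : falling x k.+1 - falling (x - 1) k.+1 = k.+1%:R * falling (x - 1) k.
Proof. by rewrite fallingS fallingSr -natr1; ring. Qed.

Lemma falling_gt0 x k : (forall i, (i < k)%N -> i%:R < x) -> 0 < falling x k.
Proof. by move=> h; apply: prodr_gt0 => i _; rewrite subr_gt0 h. Qed.

(** Pascal's rule: an iterated difference of order [m + 1] is one of order [m] of the first
    difference. *)
Lemma alternating_sumS m (f : nat -> R) :
  \sum_(s < m.+2) (-1) ^+ s * 'C(m.+1, s)%:R * f s =
  \sum_(s < m.+1) (-1) ^+ s * 'C(m, s)%:R * (f s - f s.+1).
Proof.
transitivity (\sum_(s < m.+1) (-1) ^+ s * 'C(m, s)%:R * f s
   - \sum_(s < m.+1) (-1) ^+ s * 'C(m, s)%:R * f s.+1); last first.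
  by rewrite -sumrB; apply: eq_bigr => s _; ring.
rewrite big_ord_recl/= bin0.
under eq_bigr do rewrite /bump/= add1n binS natrD mulrDr mulrDl.
rewrite big_split/= addrA; congr (_ + _); last first.
  rewrite -sumrN; apply: eq_bigr => s _; rewrite exprS; ring.
rewrite [RHS]big_ord_recl/= bin0; congr (_ + _).
rewrite big_ord_recr/= bin_small// mulr0 mul0r addr0.
by apply: eq_bigr => s _; rewrite /bump/= add1n.
Qed.

(** Each difference lowers the degree of the falling factorial by one ([fallingB]), so [m]
    differences annihilate degree [k < m]. *)
Lemma alternating_falling m k y : (k < m)%N ->
  \sum_(s < m.+1) (-1) ^+ s * 'C(m, s)%:R * falling (y - s%:R) k = 0.
Proof.
elim: m k y => [//|m IH] [|k] y km.
  rewrite (@alternating_sumS m (fun s => falling (y - s%:R) 0)).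
  by rewrite big1// => s _; rewrite !falling0 subrr mulr0.
rewrite (@alternating_sumS m (fun s => falling (y - s%:R) k.+1)).
rewrite (eq_bigr (fun s : 'I_m.+1 => k.+1%:R *
    ((-1) ^+ s * 'C(m, s)%:R * falling (y - 1 - s%:R) k))); last first.
  move=> s _; rewrite -natr1 (_ : y - (s%:R + 1) = y - s%:R - 1); last by ring.
  rewrite fallingB (_ : y - s%:R - 1 = y - 1 - s%:R); last by ring.
  ring.
by rewrite -mulr_sumr IH// mulr0.
Qed.

(** This is the partial fraction expansion of [1/(x (x - 1) ... (x - m))], proved by induction
    through first differences. *)
Lemma alternating_inverse m x : (forall i, (i <= m)%N -> x != i%:R) ->
  \sum_(s < m.+1) (-1) ^+ s * 'C(m, s)%:R * (x - s%:R)^-1 =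
  (-1) ^+ m * m`!%:R / falling x m.+1.
Proof.
elim: m x => [|m IH] x xi.
  by rewrite big_ord1 bin0 /falling big_ord1 expr0 !mul1r.
rewrite (@alternating_sumS m (fun s => (x - s%:R)^-1)).
under eq_bigr do rewrite mulrBr.
rewrite sumrB IH; last by move=> i im; apply: xi; rewrite ltnW.
rewrite (eq_bigr (fun s : 'I_m.+1 => (-1) ^+ s * 'C(m, s)%:R * (x - 1 - s%:R)^-1)); last first.
  by move=> s _; congr (_ * _^-1); rewrite -natr1; ring.
rewrite IH; last first.
  by move=> i im; rewrite subr_eq natr1; apply: xi.
have f0 : falling x m.+2 != 0.
  apply/prodf_neq0 => i _; rewrite subr_eq0; apply: xi.
  by rewrite -ltnS.
have := f0; rewrite {1}fallingS mulf_eq0 negb_or => /andP[x0 f1].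
have := f0; rewrite fallingSr mulf_eq0 negb_or => /andP[f2 xm].
have E : falling x m.+1 * (x - m.+1%:R) = x * falling (x - 1) m.+1.
  by rewrite -fallingSr fallingS.
have -> : (falling (x - 1) m.+1)^-1 = x / (falling x m.+1 * (x - m.+1%:R)).
  by rewrite E; field; rewrite x0 f1.
rewrite exprS factS natrM -natr1 in xm *.
by field; rewrite f2 xm.
Qed.

End falling_factorial.

Section moment_functional.
Context (R : realFieldType).
Implicit Types (x : R) (p q : {poly R}).

(* The integral of v^(x-1) p(v) over [0, 1]. *)
Definition moment x p : R := \sum_(j < size p) p`_j / (x + j%:R).

Lemma moment_widen x p n : (size p <= n)%N -> moment x p = \sum_(j < n) p`_j / (x + j%:R).
Proof.
move=> pn; rewrite /moment.
rewrite -(big_mkord xpredT (fun j => p`_j / (x + j%:R))) -(big_mkord xpredT (fun j => p`_j / (x + j%:R))).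
rewrite [RHS](@big_cat_nat _ _ _ (size p))//=.
rewrite [X in _ + X]big_nat_cond [X in _ + X]big1 ?addr0// => j /andP[/andP[pj _] _].
by rewrite nth_default// mul0r.
Qed.

Lemma momentD x p q : moment x (p + q) = moment x p + moment x q.
Proof.
pose n := maxn (size p) (size q).
rewrite (@moment_widen x p n) ?leq_maxl// (@moment_widen x q n) ?leq_maxr//.
rewrite (@moment_widen x (p + q) n) ?size_polyD// -big_split/=.
by apply: eq_bigr => j _; rewrite coefD mulrDl.
Qed.

Lemma momentZ x c p : moment x (c *: p) = c * moment x p.
Proof.
rewrite (@moment_widen x (c *: p) (size p)) ?size_scale_leq// /moment mulr_sumr.
by apply: eq_bigr => j _; rewrite coefZ mulrA.
Qed.

Lemma moment0 x : moment x 0 = 0.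
Proof. by rewrite /moment size_poly0 big_ord0. Qed.

Lemma moment_sum x n (f : 'I_n -> {poly R}) :
  moment x (\sum_(i < n) f i) = \sum_(i < n) moment x (f i).
Proof. by apply: (big_morph (moment x) (momentD x)); exact: moment0. Qed.

Lemma momentXM x p : moment x ('X * p) = moment (x + 1) p.
Proof.
rewrite (@moment_widen x ('X * p) (size p).+1); last first.
  by have [->|p0] := eqVneq p 0; rewrite ?mulr0 ?size_poly0// mulrC size_mulX.
rewrite big_ord_recl coefXM eqxx mul0r add0r /moment.
by apply: eq_bigr => j _; rewrite coefXM/= /bump/= add1n -natr1 -!addrA [1 + _]addrC.
Qed.

Lemma momentXnM x n p : moment x ('X^n * p) = moment (x + n%:R) p.
Proof.
elim: n x => [|n IH] x; first by rewrite expr0 mul1r addr0.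
by rewrite exprS -mulrA momentXM IH -natr1 -addrA [1 + _]addrC.
Qed.

Lemma momentC x c : moment x c%:P = c / x.
Proof.
rewrite (@moment_widen x _ 1) ?size_polyC_leq1// big_ord1 coefC addr0//.
Qed.

(** A Beta integral: up to sign [B(x, s + 1) = s!/(x (x + 1) ... (x + s))]. The induction splits one
    factor [X - 1]. *)
Lemma moment_Xsub1 x s : 0 < x ->
  moment x (('X - 1) ^+ s) = (-1) ^+ s * s`!%:R / falling (x + s%:R) s.+1.
Proof.
elim: s x => [|s IH] x x0.
  by rewrite expr0 -[1]/(1%:P) momentC addr0 /falling big_ord1 subr0 expr0 !mul1r.
have -> : ('X - 1) ^+ s.+1 = 'X * ('X - 1) ^+ s + (-1) *: ('X - 1) ^+ s :> {poly R}.
  by rewrite exprS mulrBl mul1r scaleN1r.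
rewrite momentD momentZ momentXM !IH ?addr_gt0//.
rewrite (_ : x + 1 + s%:R = x + s.+1%:R); last by rewrite -natr1; ring.
have f0 : 0 < falling (x + s.+1%:R) s.+2.
  by apply: falling_gt0 => i si; rewrite ltr_pwDl// ler_nat -ltnS.
have := lt0r_neq0 f0; rewrite fallingS mulf_eq0 negb_or => /andP[x1 f1].
have := lt0r_neq0 f0; rewrite fallingSr mulf_eq0 negb_or => /andP[f2 x2].
have E : falling (x + s.+1%:R) s.+1 * (x + s.+1%:R - s.+1%:R) =
    (x + s.+1%:R) * falling (x + s.+1%:R - 1) s.+1 by rewrite -fallingSr fallingS.
have e1 : x + s.+1%:R - 1 = x + s%:R by rewrite -natr1; ring.
have e2 : x + s.+1%:R - s.+1%:R = x by rewrite addrK.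
rewrite e1 e2 in E f1 x2 *.
have -> : (s.+1)`!%:R = (x + s.+1%:R - x) * s`!%:R :> R by rewrite factS natrM; ring.
rewrite exprS; move: E x1 f1 f2 x2; set F1 := falling _ _; set F2 := falling _ _.
move: (x + s.+1%:R) F1 F2 => y F1 F2 E y0 f1 f2 x2.
rewrite -E; have -> : F2^-1 = y / (F1 * x) by rewrite E; field; rewrite y0 f1.
by field; rewrite f2 x2.
Qed.

End moment_functional.

Section jacobi_norm.
Context (R : realType).
Local Notation mu := (@lebesgue_measure R).

Lemma gbinomialE (a : R) k : gbinomial a k = falling a k / k`!%:R.
Proof. by []. Qed.

Lemma gbinomial_nat n k : gbinomial n%:R k = 'C(n, k)%:R :> R.
Proof.
by rewrite gbinomialE falling_nat -bin_ffact natrM mulfK.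
Qed.

Definition jacobi_poly m (b : R) : {poly R} :=
  \sum_(s < m.+1) ('C(m, s)%:R * gbinomial (m%:R + b) s)
    *: ('X^(m - s) * ('X - 1) ^+ s).

Lemma horner_jacobi_poly m (b v : R) :
  (jacobi_poly m b).[v] = jacobi m 0 b (2 * v - 1).
Proof.
rewrite /jacobi_poly /jacobi horner_sum; apply: eq_bigr => s _.
rewrite hornerZ hornerM !horner_exp hornerD hornerN hornerX hornerC.
rewrite addr0 gbinomial_nat bin_sub; last by rewrite -ltnS.
rewrite (_ : (2 * v - 1 - 1) / 2 = v - 1); last by field.
rewrite (_ : (2 * v - 1 + 1) / 2 = v); last by field.
ring.
Qed.

(** Every summand is a Beta integral. The powers of [X] and [X - 1] add up to [m], so all falling
    factorials start from the same number [m + b + i], and [s!] cancels. *)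
Lemma moment_jacobi_XnM m (b : R) i : 0 < b ->
  moment b ('X^i * jacobi_poly m b) =
  \sum_(s < m.+1) (-1) ^+ s * 'C(m, s)%:R
    * (falling (m%:R + b) s / falling (m%:R + b + i%:R) s.+1).
Proof.
move=> b0; rewrite momentXnM /jacobi_poly moment_sum; apply: eq_bigr => s _.
have sm : (s <= m)%N by rewrite -ltnS.
rewrite momentZ momentXnM moment_Xsub1; last first.
  by rewrite ltr_wpDr// ltr_wpDr.
rewrite gbinomialE natrB//.
rewrite (_ : b + i%:R + (m%:R - s%:R) + s%:R = m%:R + b + i%:R); last by ring.
have sn : s`!%:R != 0 :> R by rewrite pnatr_eq0 -lt0n fact_gt0.
have fn : falling (m%:R + b + i%:R) s.+1 != 0.
  apply: lt0r_neq0; apply: falling_gt0 => k ks.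
  rewrite ltr_wpDr// ltr_pwDr// ler_nat.
  by rewrite (leq_trans _ sm)// -ltnS.
by field; rewrite sn fn.
Qed.

(* Up to a constant the summands are values at s = 0, ..., m of a polynomial of
   degree i - 1 < m, whose m-th difference vanishes. *)
Lemma moment_jacobi_orthogonal m (b : R) i : 0 < b -> (0 < i <= m)%N ->
  moment b ('X^i * jacobi_poly m b) = 0.
Proof.
move=> b0; case: i => // i im; rewrite moment_jacobi_XnM//.
set x := m%:R + b.
have mx : m%:R < x by rewrite ltrDl.
rewrite (eq_bigr (fun s : 'I_m.+1 => (falling (x + i.+1%:R) i.+1)^-1 *
  ((-1) ^+ s * 'C(m, s)%:R * falling (x + i.+1%:R - 1 - s%:R) i))); last first.
  move=> s _.
  have sm : (s <= m)%N by rewrite -ltnS.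
  have f1 : falling (x + i.+1%:R) s.+1 != 0.
    apply: lt0r_neq0; apply: falling_gt0 => k ks.
    rewrite ltr_wpDr// (le_lt_trans _ mx)// ler_nat.
    by rewrite (leq_trans _ sm)// -ltnS.
  have f2 : falling (x + i.+1%:R) i.+1 != 0.
    apply: lt0r_neq0; apply: falling_gt0 => k ki.
    rewrite ltr_wpDl ?ltr_nat//.
    exact: le_trans (ltW mx).
  (* Both sides are the falling factorial of [x + i + 1] of length [s + i + 1], cut after [i + 1]
     factors and after [s + 1] factors. *)
  have E : falling x s * falling (x + i.+1%:R) i.+1 =
      falling (x + i.+1%:R) s.+1 * falling (x + i.+1%:R - 1 - s%:R) i.
    rewrite (_ : x + i.+1%:R - 1 - s%:R = x + i.+1%:R - s.+1%:R); last first.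
      by rewrite -(natr1 s); ring.
    rewrite -fallingD addSnnS addnC fallingD addrK mulrC//.
  have -> : falling x s / falling (x + i.+1%:R) s.+1 =
     falling (x + i.+1%:R - 1 - s%:R) i / falling (x + i.+1%:R) i.+1.
    by apply/eqP; rewrite eqr_div// E mulrC.
  by ring.
by rewrite -mulr_sumr alternating_falling// mulr0.
Qed.

(** The weight [v^(b-1)] is one power short of the orthogonality weight [v^b], so the constant 1 is
    not annihilated. For [i = 0] the quotient of falling factorials collapses to [1/(x - s)], and
    the sum is a partial fraction expansion. *)
Lemma moment_jacobi m (b : R) : 0 < b ->
  moment b (jacobi_poly m b) = (-1) ^+ m * m`!%:R / falling (m%:R + b) m.+1.
Proof.
move=> b0; have := @moment_jacobi_XnM m b 0 b0; rewrite expr0 mul1r addr0 => ->.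
set x := m%:R + b.
have mx : m%:R < x by rewrite ltrDl.
rewrite -alternating_inverse; last first.
  by move=> i im; rewrite gt_eqF// (le_lt_trans _ mx)// ler_nat.
apply: eq_bigr => s _; congr (_ * _).
have sm : (s <= m)%N by rewrite -ltnS.
have f1 : falling x s != 0.
  apply: lt0r_neq0; apply: falling_gt0 => k ks.
  by rewrite (le_lt_trans _ mx)// ler_nat (leq_trans _ sm)// ltnW.
have x1 : x - s%:R != 0.
  by rewrite subr_eq0 gt_eqF// (le_lt_trans _ mx)// ler_nat.
by rewrite fallingSr; field; rewrite f1 x1.
Qed.

Lemma coef0_jacobi_poly m (b : R) :
  (jacobi_poly m b)`_0 = (-1) ^+ m * falling (m%:R + b) m / m`!%:R.
Proof.
rewrite -horner_coef0 /jacobi_poly horner_sum (bigD1 ord_max)//= big1 ?addr0.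
  rewrite hornerZ subnn expr0 mul1r horner_exp hornerD hornerN hornerX hornerC.
  by rewrite binn mul1r gbinomialE sub0r; ring.
move=> s sm; rewrite hornerZ hornerM horner_exp hornerX expr0n.
have -> : (m - s == 0)%N = false.
  apply/negbTE; rewrite subn_eq0 -ltnNge ltn_neqAle -ltnS ltn_ord andbT.
  by apply: contra sm => /eqP h; apply/eqP/val_inj.
by rewrite mul0r mulr0.
Qed.

Lemma size_jacobi_poly m (b : R) : (size (jacobi_poly m b) <= m.+1)%N.
Proof.
apply: (leq_trans (size_sum _ _ _)); apply/bigmax_leqP => s _.
apply: (leq_trans (size_scale_leq _ _)).
apply: (leq_trans (size_polyMleq _ _)).
rewrite size_polyXn addSn/= -['X - 1]/('X - 1%:P) size_exp_XsubC addnS subnK//.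
by rewrite -ltnS.
Qed.

(* By orthogonality only the constant coefficient of one factor contributes. *)
Lemma moment_jacobi_sqr m (b : R) : 0 < b ->
  moment b (jacobi_poly m b ^+ 2) = b^-1.
Proof.
move=> b0; rewrite expr2; set P := jacobi_poly m b.
have PE : P = \sum_(i < m.+1) P`_i *: 'X^i.
  rewrite -poly_def; apply/polyP => i; rewrite coef_poly; case: ltnP => // mi.
  by rewrite nth_default// (leq_trans (size_jacobi_poly _ _)).
rewrite {1}PE mulr_suml moment_sum big_ord_recl big1 ?addr0; last first.
  move=> i _; rewrite -scalerAl momentZ moment_jacobi_orthogonal ?mulr0//.
  by exact: ltn_ord.
rewrite expr0 -scalerAl mul1r momentZ coef0_jacobi_poly moment_jacobi//.
have f1 : falling (m%:R + b) m != 0.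
  apply: lt0r_neq0; apply: falling_gt0 => k ks.
  by rewrite ltr_pwDr// ler_nat ltnW.
have sn : m`!%:R != 0 :> R by rewrite pnatr_eq0 -lt0n fact_gt0.
rewrite fallingSr (_ : m%:R + b - m%:R = b); last by ring.
transitivity (((-1) ^+ m) ^+ 2 * b^-1 : R); last by rewrite sqrr_sign mul1r.
by field; rewrite f1 sn gt_eqF.
Qed.

End jacobi_norm.

(** * The squared kernel as a function of the distance *)

Section profile.
Context (R : realType).
Local Notation mu := (@lebesgue_measure R).

Lemma integrable_powR (x : R) : 0 < x ->
  mu.-integrable `]0, 1[ (fun v => (v `^ (x - 1))%:E).
Proof.
move=> x0; apply/integrableP; split.
  by apply: measurable_funTS; apply/measurable_EFinP; exact: measurable_powR.
under eq_integral => v _ do rewrite gee0_abs ?lee_fin ?powR_ge0//.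
by rewrite integral_powR ?ltry//; lra.
Qed.

(** Induction on the polynomial with [x] general: multiplication by the variable shifts [x] by
    one. *)
Lemma integral_moment (p : {poly R}) (x : R) : 0 < x ->
  mu.-integrable `]0, 1[ (fun v => (v `^ (x - 1) * p.[v])%:E) /\
  (\int[mu]_(v in `]0%R, 1%R[) (v `^ (x - 1) * p.[v])%:E = (moment x p)%:E)%E.
Proof.
elim/poly_ind: p x => [|p c IH] x x0.
  rewrite moment0 (_ : (fun v => _) = cst 0%E); last first.
    by apply/funext => v; rewrite horner0 mulr0.
  by rewrite integral0; split => //; exact: integrable0.
have [i1 e1] := IH _ (addr_gt0 x0 ltr01).
have i2 : mu.-integrable `]0, 1[ (fun v => c%:E * (v `^ (x - 1))%:E)%E.
  by apply: integrableZl => //; exact: integrable_powR.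
have E v : 0 < v < 1 -> ((v `^ (x - 1) * (p * 'X + c%:P).[v])%:E =
    (v `^ (x + 1 - 1) * p.[v])%:E + c%:E * (v `^ (x - 1))%:E)%E.
  move=> /andP[v0 v1].
  rewrite !hornerE addrK -EFinM -EFinD -(@mulr_powRB1 _ v x)// ?ltW//.
  by congr EFin; ring.
have mI : measurable (`]0, 1[%classic : set (measurableTypeR R)) by exact: measurable_itv.
split.
  have := integrableD mI i1 i2.
  apply: eq_integrable => // v /set_mem/=; rewrite in_itv/= => v01.
  by rewrite E.
transitivity (\int[mu]_(v in `]0%R, 1%R[)
    ((v `^ (x + 1 - 1) * p.[v])%:E + c%:E * (v `^ (x - 1))%:E))%E.
  by apply: eq_integral => v /set_mem/=; rewrite in_itv/=; exact: E.
apply: (etrans (integralD mI i1 i2)).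
rewrite e1 (integralZl mI (integrable_powR x0)) integral_powR; last by lra.
rewrite subrK -EFinM -EFinD; congr EFin.
by rewrite momentD [p * 'X]mulrC momentXM momentC.
Qed.

Variables (e : R) (m : nat).
Hypothesis e12 : 1 / 2 < e.
Local Notation b := (2 * e - 1).

Let b0 : 0 < b. Proof. by move: e12; lra. Qed.

(* With e = nu - m, profile (1 / cosh^2 d) is f_ nu m d. *)
Definition profile (v : R) : R := (b / pi * v `^ e * jacobi m 0 b (2 * v - 1)) ^+ 2.

Lemma profile_ge0 v : 0 <= profile v. Proof. exact: sqr_ge0. Qed.

Lemma profileE v : profile v = (b / pi) ^+ 2 * (v `^ e) ^+ 2 * (jacobi_poly m b ^+ 2).[v].
Proof. by rewrite horner_exp horner_jacobi_poly -!exprMn. Qed.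

Lemma measurable_profile : measurable_fun setT profile.
Proof.
rewrite (_ : profile = fun v => (b / pi) ^+ 2 * (v `^ e) ^+ 2 * (jacobi_poly m b ^+ 2).[v]); last first.
  by apply/funext => v; rewrite profileE.
apply: measurable_funM; first apply: measurable_funM => //.
  by apply: measurable_funX; exact: measurable_powR.
by apply: continuous_measurable_fun => v; exact: continuous_horner.
Qed.

Lemma continuous_profile v : 0 < v -> {for v, continuous profile}.
Proof.
move=> v0; rewrite (_ : profile = fun v => (b / pi) ^+ 2 * (v `^ e) ^+ 2 * (jacobi_poly m b ^+ 2).[v]); last first.
  by apply/funext => w; rewrite profileE.
have cp : {for v, continuous (fun v : R => v `^ e)}.
  apply: differentiable_continuous; apply/derivable1_diffP.
  by have [] := is_derive1_powR e v0.
apply: cvgM; last exact: continuous_horner.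
by apply: cvgM; [exact: cvg_cst|exact: cvgM].
Qed.

(** The polynomial factor is bounded on the compact interval [[0, 4]], whose end point 4 is the
    upper bound available for [scaled_sech2]. *)
Lemma profile_bound : exists2 M, 0 <= M &
  forall v, 0 < v <= 4 -> profile v <= M * v `^ (2 * e).
Proof.
have cont : {within `[0, 4], continuous (horner (jacobi_poly m b ^+ 2))}.
  by apply: continuous_subspaceT => v; exact: continuous_horner.
have [c c4 cmax] := EVT_max (ler0n R 4) cont.
exists ((b / pi) ^+ 2 * (jacobi_poly m b ^+ 2).[c]).
  by rewrite mulr_ge0 ?sqr_ge0// horner_exp sqr_ge0.
move=> v /andP[v0 v4]; rewrite profileE mulrAC.
have -> : v `^ (2 * e) = (v `^ e) ^+ 2.
  by rewrite mulr_natl mulr2n powRD ?expr2// (gt_eqF v0) implybT.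
apply: ler_wpM2r; first exact: sqr_ge0.
apply: ler_wpM2l; first exact: sqr_ge0.
by apply: cmax; rewrite in_itv/= (ltW v0).
Qed.

(** Since [2 e - 2 = b - 1], the integrand is [(b/pi)^2] times the squared Jacobi polynomial with
    the weight of [moment b]. *)
Lemma integral_profile :
  (\int[mu]_(v in `]0%R, 1%R[) (profile v * v ^- 2)%:E = (b / pi ^+ 2)%:E)%E.
Proof.
have [i1 e1] := integral_moment (jacobi_poly m b ^+ 2) b0.
transitivity (\int[mu]_(v in `]0%R, 1%R[) (((b / pi) ^+ 2)%:E * (v `^ (b - 1) * (jacobi_poly m b ^+ 2).[v])%:E))%E.
  apply: eq_integral => v /set_mem/=; rewrite in_itv/= => /andP[v0 v1].
  rewrite profileE -EFinM; congr EFin.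
  have -> : v `^ (b - 1) = (v `^ e) ^+ 2 * v ^- 2.
    rewrite (_ : b - 1 = e + e - 2%:R); last by ring.
    rewrite powRB ?(gt_eqF v0) ?implybT// powRD ?(gt_eqF v0) ?implybT// powR_mulrn ?ltW//.
  ring.
rewrite integralZl// ?e1 ?moment_jacobi_sqr// -EFinM; congr EFin.
have pn0 : pi != 0 :> R by rewrite gt_eqF// pi_gt0.
have : b != 0 by rewrite gt_eqF.
by move: b => c cn0; move: (pi : R) pn0 => q qn0; field; rewrite ?qn0 ?cn0.
Qed.

End profile.

(** * The variance of a determinantal process *)

Section power_measure_integral.
Context d (T : measurableType d) (R : realType).
Variable mu : {sigma_finite_measure set T -> \bar R}.
Local Notation pt := ([tuple] : 0.-tuple T).
Local Notation cons0 := (cons_measure mu (\d_ pt)).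

Lemma measurable_thead n : measurable_fun setT (fun t : n.+1.-tuple T => thead t).
Proof. exact: measurable_tnth. Qed.

(** Tonelli's theorem on pairs needs sigma-finiteness, which the type of [power_measure] does not
    record. *)
Lemma cons_measure_sigma_finite : sigma_finite setT cons0.
Proof.
have /sigma_finiteP[F [TF ndF Foo]] := sigma_finiteT mu.
exists (fun n => [set t : 1.-tuple T | F n (thead t)]).
  by apply/esym; rewrite -subTset => t _; have : setT (thead t) by []; rewrite TF.
move=> n; have [mF Fn] := Foo n; split.
  by rewrite -[X in measurable X]setTI; exact: measurable_thead.
rewrite /= /cons_measure /pushforward.
rewrite (_ : _ @^-1` _ = setT `*` F n); last first.
  by apply/seteqP; split => -[t x] /=; rewrite theadE // => -[].
by rewrite product_measure1E//= diracT mul1e.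
Qed.

HB.instance Definition _ := @Measure_isSigmaFinite.Build _ _ _
  cons0 cons_measure_sigma_finite.

Lemma integral_power_measure1 (g : T -> \bar R) : measurable_fun setT g ->
  (forall x, 0 <= g x)%E ->
  (\int[power_measure mu 1]_t g (thead t) = \int[mu]_x g x)%E.
Proof.
move=> mg g0.
have mgt : measurable_fun setT (fun t : 1.-tuple T => g (thead t)).
  by apply: measurableT_comp => //; exact: measurable_thead.
have mcons := @measurable_tcons _ T 0.
apply: (etrans (ge0_integral_pushforward mcons (\d_ pt \x mu)%E measurableT mgt _)) => //.
rewrite preimage_setT.
have -> : (fun t : 1.-tuple T => g (thead t)) \o @tcons _ T 0 = (fun p => g p.2).
  by apply/funext => -[t x] /=; rewrite theadE.
have mg2 : measurable_fun setT (fun p : 0.-tuple T * T => g p.2).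
  by apply: measurableT_comp => //; exact: measurable_snd.
apply: (etrans (fubini_tonelli1 (fun p : 0.-tuple T * T => g p.2) mg2 _)) => //.
rewrite /fubini_F/= (@integral_dirac _ _ _ _ _ measurableT (fun _ => (\int[mu]_x g x)%E))//.
by rewrite diracT mul1e.
Qed.

(** The last factor of the product becomes the head of the tuple and is integrated innermost, whence
    the order of the arguments of [g]. *)
Lemma integral_power_measure2 (g : T * T -> \bar R) : measurable_fun setT g ->
  (forall p, 0 <= g p)%E ->
  (\int[power_measure mu 2]_t g (tnth t ord0, tnth t ord_max) =
   \int[mu]_x \int[mu]_y g (y, x))%E.
Proof.
move=> mg g0.
have mgt : measurable_fun setT (fun t : 2.-tuple T => g (tnth t ord0, tnth t ord_max)).
  by apply: measurableT_comp => //; apply: measurable_fun_pair; exact: measurable_tnth.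
have mcons := @measurable_tcons _ T 1.
apply: (etrans (ge0_integral_pushforward mcons (cons0 \x mu)%E measurableT mgt _)) => //.
rewrite preimage_setT.
pose h (p : 1.-tuple T * T) := g (p.2, thead p.1).
have -> : (fun t : 2.-tuple T => g (tnth t ord0, tnth t ord_max)) \o @tcons _ T 1 = h.
  by apply/funext => -[t x] /=; rewrite /h /thead !(tnth_nth x)/=.
have mh : measurable_fun setT h.
  apply: measurableT_comp => //; apply: measurable_fun_pair.
    exact: measurable_snd.
  by apply: measurableT_comp; [exact: measurable_thead|exact: measurable_fst].
have h0 p : (0 <= h p)%E by exact: g0.
apply: (etrans (@fubini_tonelli1 _ _ _ _ _ cons0 mu h mh h0)).
have mG : measurable_fun setT (fun x => \int[mu]_y g (y, x))%E.
  exact: measurable_fun_fubini_tonelli_G.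
have G0 x : (0 <= \int[mu]_y g (y, x))%E by exact: integral_ge0.
exact (integral_power_measure1 mG G0).
Qed.

End power_measure_integral.

Section counting.
Context (R : realType) (E B C : set (plane R)).
Hypotheses (cC : compact C) (BC : B `<=` C) (CE : C `<=` E).
Local Notation Rc := (real_complex R).

Lemma finite_points (X : configuration E) : finite_set (points X `&` B).
Proof.
have [_ /(_ _ cC CE) fin] := pointsP X.
by apply: sub_finite_set fin => x [Xx /BC].
Qed.

Lemma fsbig_indic n (s : seq (n.-tuple (plane R))) (D : set (n.-tuple (plane R)))
    (f : n.-tuple (plane R) -> R[i]) : uniq s -> [set` s] `<=` D ->
  (forall t, t \in s -> f t = 1) -> (forall t, D t -> t \notin s -> f t = 0) ->
  \sum_(t \in D) f t = (size s)%:R.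
Proof.
move=> us sD f1 f0; rewrite -(@fsbig_widen _ _ _ _ [set` s])//; last first.
  by move=> t [Dt /negP st]; exact: f0.
rewrite -fsbig_seq// big_seq_cond (eq_bigr (fun=> 1)); last first.
  by move=> t; rewrite andbT => /f1.
by rewrite -big_seq_cond big_const_seq iter_addr_0 count_predT.
Qed.

Lemma sum_indic1 (X : configuration E) :
  \sum_(t \in @distinct_tuples R 1 (points X)) (\1_B (thead t) : R)%:C%C
  = (count_points B X)%:R.
Proof.
have fin := finite_points X.
rewrite /count_points; set F := fset_set _.
have FE x : (x \in F) = (x \in points X `&` B) by rewrite in_fset_set.
rewrite (@fsbig_indic _ [seq [tuple x] | x <- F]) ?size_map//.
- by rewrite map_inj_uniq// => x y [].
- move=> t /= /mapP[x]; rewrite FE => /set_mem[Xx Bx] ->; split => // y /=.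
  by rewrite inE => /eqP ->.
- move=> t /mapP[x]; rewrite FE => /set_mem[Xx Bx] ->.
  by rewrite theadE indicE mem_set.
- move=> t [_ tX] tF; rewrite indicE; case: (boolP (_ \in B)) => // /set_mem Bt.
  case/negP: tF; apply/mapP; exists (thead t).
    by rewrite FE; apply/mem_set; split => //; apply: tX; rewrite /= mem_tnth.
  apply/eq_from_tnth => i; rewrite [RHS](tnth_nth (0, 0)).
  by case: i => -[|//] /= p; congr tnth; exact/val_inj.
Qed.

(** The ordered pairs are listed by choosing [x] among the points in [B] and [y] among the remaining
    ones. This gives the second factorial moment of the count. *)
Lemma sum_indic2 (X : configuration E) :
  \sum_(t \in @distinct_tuples R 2 (points X))
     (\1_B (tnth t ord0) * \1_B (tnth t ord_max) : R)%:C%C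
  = (count_points B X * (count_points B X).-1)%:R.
Proof.
have fin := finite_points X.
rewrite /count_points; set F := fset_set _.
have FE x : (x \in F) = (x \in points X `&` B) by rewrite in_fset_set.
have uF := fset_uniq F.
pose s := [seq [tuple x; y] | x <- F, y <- rem x F].
have sP t : reflect (exists x y, [/\ x \in F, y \in F, x != y & t = [tuple x; y]]) (t \in s).
  apply: (iffP allpairsPdep) => -[x [y]].
    by rewrite mem_rem_uniq// !inE => -[xF /andP[yx yF] ->]; exists x, y; rewrite eq_sym.
  move=> [xF yF xy ->]; exists x, y; split=> //.
  by rewrite mem_rem_uniq// !inE eq_sym xy.
rewrite (@fsbig_indic _ s).
- rewrite size_allpairs_dep (_ : [seq _ | x <- F] = nseq (size F) (size F).-1).
    by rewrite sumn_nseq mulnC.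
  apply: (@eq_from_nth _ 0%N); rewrite ?size_map ?size_nseq// => i iF.
  by rewrite (nth_map (0, 0))// nth_nseq iF size_rem// mem_nth.
- apply: allpairs_uniq_dep => // [x _|]; first exact: rem_uniq.
  by move=> [x y] [x' y'] _ _ /= [-> ->].
- move=> t /= /sP[x [y [xF yF xy ->]]]; split; first by rewrite /= inE andbT.
  move=> z /=; rewrite !inE => /orP[] /eqP ->.
    by move: xF; rewrite FE => /set_mem[].
  by move: yF; rewrite FE => /set_mem[].
- move=> t /sP[x [y [xF yF _ ->]]]; rewrite !(tnth_nth (0,0))/= !indicE.
  move: xF yF; rewrite !FE => /set_mem[_ Bx] /set_mem[_ By].
  by rewrite !mem_set// mulr1.
- move=> t [ut tX] tF; rewrite !indicE.
  case: (boolP (_ \in B)) => [/set_mem B0|_]; last by rewrite mul0r.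
  case: (boolP (_ \in B)) => [/set_mem B1|_]; last by rewrite mulr0.
  case/negP: tF; apply/sP.
  exists (tnth t ord0), (tnth t ord_max); split.
  + by rewrite FE; apply/mem_set; split => //; apply: tX; rewrite /= mem_tnth.
  + by rewrite FE; apply/mem_set; split => //; apply: tX; rewrite /= mem_tnth.
  + by have /tuple_uniqP inj := ut; apply/eqP => /inj.
  + apply/eq_from_tnth => i; rewrite [RHS](tnth_nth (0, 0)).
    by case: i => -[|[|//]] /= p; congr tnth; exact/val_inj.
Qed.

End counting.

Lemma Lfun2_sqr_integrable d (T : measurableType d) (R : realType)
    (m : {measure set T -> \bar R}) (f : T -> R) : measurable_fun setT f ->
  m.-integrable setT (fun x => (f x ^+ 2)%:E) -> f \in Lfun m 2%:E.
Proof.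
move=> mf /integrableP[_ fi]; rewrite inE; apply/andP; split; rewrite inE//=.
rewrite /finite_norm unlock /= poweR_lty//; apply: le_lt_trans fi.
rewrite le_eqVlt; apply/orP; left; apply/eqP; apply: eq_integral => x _.
by rewrite /= normrX powR_mulrn.
Qed.

Lemma det_mx2 (K : comNzRingType) (A : 'M[K]_2) :
  \det A = A ord0 ord0 * A ord_max ord_max - A ord0 ord_max * A ord_max ord0.
Proof.
rewrite (expand_det_row _ ord0) !big_ord_recl big_ord0 /cofactor !det_mx11 !mxE/=.
rewrite expr0 mul1r addr0 /= expr1 mulN1r mulrN.
by congr (A _ _ * A _ _ - A _ _ * A _ _); exact/val_inj.
Qed.

Section determinantal_variance.
Context (R : realType) (E : set (plane R)).
Context (mu : {sigma_finite_measure set (plane R) -> \bar R}).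
Context (K : plane R -> plane R -> R[i]).
Context (P : probability (configuration_space E) R).
Hypothesis hP : determinantal mu K P.
Context (B C : set (plane R)).
Hypotheses (mB : measurable B) (cC : compact C) (BC : B `<=` C) (CE : C `<=` E).
Context (a : plane R -> R) (q : plane R * plane R -> R).
Hypotheses (ma : measurable_fun setT a) (a0 : forall z, 0 <= a z).
Hypotheses (mq : measurable_fun setT q) (q0 : forall p, 0 <= q p).
Hypothesis Ka : forall z, B z -> K z z = (a z)%:C%C.
Hypothesis Kq : forall z w, B z -> B w -> complex.Re (K z w * K w z) = q (z, w).

Local Notation N := (fun X : configuration_space E => (count_points B X)%:R : R).
Local Notation f1 := (fun t : 1.-tuple (plane R) => (\1_B (thead t) : R)%:C%C).
Local Notation f2 := (fun t : 2.-tuple (plane R) =>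
  (\1_B (tnth t ord0) * \1_B (tnth t ord_max) : R)%:C%C).

Let m1B : measurable_fun setT (\1_B : plane R -> R).
Proof. exact: measurable_indic. Qed.

Let normcR (x : R) : 0 <= x -> normc x%:C%C = x.
Proof. by move=> x0; rewrite /normc/= expr0n addr0 sqrtr_sqr ger0_norm. Qed.

Let ReM (x : R) (w : R[i]) : complex.Re (x%:C%C * w) = x * complex.Re w.
Proof. by case: w => u v /=; rewrite mul0r subr0. Qed.

Let indic01 z : 0 <= (\1_B z : R) <= 1.
Proof. by rewrite indicE; case: (_ \in _); rewrite ?lexx ler01. Qed.

Let test1 : test_function E f1.
Proof.
split.
- split => /=; last exact: measurable_cst.
  by apply: measurableT_comp => //; exact: measurable_thead.
- by exists 1 => t; have /andP[? ?] := indic01 (thead t); rewrite normcR.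
- exists C; split => // t; rewrite indicE; case: (boolP (_ \in B)).
    by move=> /set_mem/BC Ct _ z /= /tnthP[i ->]; rewrite ord1.
  by rewrite eqxx.
Qed.

Let test2 : test_function E f2.
Proof.
split.
- split => /=; last exact: measurable_cst.
  by apply: measurable_funM; apply: measurableT_comp => //; exact: measurable_tnth.
- exists 1 => t; have /andP[? ?] := indic01 (tnth t ord0).
  have /andP[? ?] := indic01 (tnth t ord_max).
  by rewrite normcR ?mulr_ge0// mulr_ile1.
- exists C; split => // t; rewrite !indicE.
  case: (boolP (_ \in B)) => [/set_mem/BC C0|_]; last by rewrite mul0r eqxx.
  case: (boolP (_ \in B)) => [/set_mem/BC C1 _|_]; last by rewrite mulr0 eqxx.
  move=> z /= /tnthP[i ->].
  have [->|] := eqVneq i ord0; first exact: C0.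
  case: i => -[|[|//]] p; first by rewrite -val_eqE.
  by move=> _; rewrite (_ : Ordinal p = ord_max)//; exact/val_inj.
Qed.

Let g z := ((\1_B z * a z)%:E : \bar R).

Let mg : measurable_fun setT g.
Proof. by apply/measurable_EFinP; exact: measurable_funM. Qed.

Let g0 z : (0 <= g z)%E.
Proof. by rewrite lee_fin; apply: mulr_ge0 => //; have /andP[] := indic01 z. Qed.

Let integral_g : (\int[mu]_z g z = \int[mu]_(z in B) (a z)%:E)%E.
Proof.
rewrite [RHS]integral_mkcond; apply: eq_integral => z _.
by rewrite patchE /g indicE; case: ifPn => _; rewrite ?mul1r ?mul0r.
Qed.

Lemma expected_count :
  P.-integrable setT (fun X => (N X)%:E) /\
  (\int[P]_X (N X)%:E = \int[mu]_(z in B) (a z)%:E)%E.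
Proof.
have [[iS _] [iF _] eqSF] := hP (ltn0Sn 0) test1.
have SE X : complex.Re (\sum_(t \in @distinct_tuples R 1 (points X)) f1 t) = N X.
  by rewrite (sum_indic1 cC BC CE) -(rmorph_nat (real_complex R)).
have FE (t : 1.-tuple (plane R)) :
    complex.Re (f1 t * \det (\matrix_(i, j) K (tnth t i) (tnth t j)))
    = \1_B (thead t) * a (thead t).
  rewrite ReM det_mx11 mxE /thead indicE; case: (boolP (_ \in B)) => [/set_mem Bt|_].
    by rewrite Ka.
  by rewrite !mul0r.
have iN : P.-integrable setT (fun X => (N X)%:E).
  by apply: eq_integrable iS => // X _; rewrite SE.
have iA : (power_measure mu 1).-integrable setT
    (fun t => (\1_B (thead t) * a (thead t))%:E).
  by apply: eq_integrable iF => // t _; rewrite FE.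
split=> //; case: eqSF => e1 _; move: (congr1 EFin e1); rewrite /Rintegral.
under eq_integral do rewrite SE.
under [in RHS]eq_integral do rewrite FE.
rewrite !fineK ?integrable_fin_num// => ->.
apply: (etrans (integral_power_measure1 mu mg g0)); exact: integral_g.
Qed.

Lemma expected_pairs :
  [/\ P.-integrable setT (fun X => (N X * (N X - 1))%:E),
    (\int[mu]_(z in B) \int[mu]_(w in B) (q (w, z))%:E \is a fin_num)%E &
    (\int[P]_X (N X * (N X - 1))%:E =
     (\int[mu]_(z in B) (a z)%:E) ^+ 2
     - \int[mu]_(z in B) \int[mu]_(w in B) (q (w, z))%:E)%E].
Proof.
have [[iS _] [iF _] eqSF] := hP (ltn0Sn 1) test2.
have SE X : complex.Re (\sum_(t \in @distinct_tuples R 2 (points X)) f2 t)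
    = N X * (N X - 1).
  rewrite (sum_indic2 cC BC CE) -(rmorph_nat (real_complex R)) /=.
  case: (count_points B X) => [|n]; first by rewrite mul0n mul0r.
  by rewrite natrM /= -natr1 addrK.
pose A p : R := \1_B p.1 * \1_B p.2 * (a p.1 * a p.2).
pose Q p : R := \1_B p.1 * \1_B p.2 * q p.
have FE (t : 2.-tuple (plane R)) :
    complex.Re (f2 t * \det (\matrix_(i, j) K (tnth t i) (tnth t j)))
    = A (tnth t ord0, tnth t ord_max) - Q (tnth t ord0, tnth t ord_max).
  rewrite ReM det_mx2 !mxE /A /Q -mulrBr /= !indicE.
  case: (boolP (_ \in B)) => [/set_mem B0|_]; last by rewrite !mul0r.
  case: (boolP (_ \in B)) => [/set_mem B1|_]; last by rewrite mulr0 !mul0r.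
  by rewrite !mul1r raddfB/= Kq// !Ka//= mul0r subr0.
have iN : P.-integrable setT (fun X => (N X * (N X - 1))%:E).
  by apply: eq_integrable iS => // X _; rewrite SE.
have mfst := @measurable_fst _ _ (plane R) (plane R).
have msnd := @measurable_snd _ _ (plane R) (plane R).
have mI : measurable_fun setT (fun p : plane R * plane R => \1_B p.1 * \1_B p.2 : R).
  by apply: measurable_funM; exact: measurableT_comp.
have mA : measurable_fun setT (EFin \o A).
  apply/measurable_EFinP; apply: measurable_funM => //.
  by apply: measurable_funM; exact: measurableT_comp.
have mQ : measurable_fun setT (EFin \o Q).
  by apply/measurable_EFinP; exact: measurable_funM.
have I0 p : 0 <= \1_B p.1 * \1_B p.2 :> R.
  by apply: mulr_ge0; [have /andP[] := indic01 p.1|have /andP[] := indic01 p.2].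
have A0 p : (0 <= (EFin \o A) p)%E by rewrite lee_fin !mulr_ge0.
have Q0 p : (0 <= (EFin \o Q) p)%E by rewrite lee_fin mulr_ge0.
have IAfin : (\int[mu]_(z in B) (a z)%:E \is a fin_num)%E.
  by have [i1 <-] := expected_count; exact: integrable_fin_num.
have AE : (\int[power_measure mu 2]_t (EFin \o A) (tnth t ord0, tnth t ord_max)
    = (\int[mu]_(z in B) (a z)%:E) ^+ 2)%E.
  apply: (etrans (integral_power_measure2 mu mA A0)).
  rewrite -integral_g -(fineK (_ : \int[mu]_z g z \is a fin_num)%E) ?integral_g//.
  set I := fine _; have IE : (\int[mu]_z g z = I%:E)%E by rewrite fineK // integral_g.
  transitivity (\int[mu]_x (I%:E * g x))%E.
    apply: eq_integral => x _; rewrite -IE muleC -ge0_integralZl//.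
    apply: eq_integral => y _; rewrite /A /g/= -EFinM; congr EFin; ring.
  have I_0 : (0 <= I%:E)%E by rewrite -IE; exact: integral_ge0.
  by rewrite ge0_integralZl// IE expe2.
have mt : measurable_fun setT (fun t : 2.-tuple (plane R) => (tnth t ord0, tnth t ord_max)).
  by apply: measurable_fun_pair; exact: measurable_tnth.
have iA : (power_measure mu 2).-integrable setT
    (fun t => (A (tnth t ord0, tnth t ord_max))%:E).
  apply/integrableP; split; first exact: (measurableT_comp mA mt).
  under eq_integral do rewrite (gee0_abs (A0 _)).
  rewrite [ltLHS]AE expe2 -(fineK IAfin) -EFinM; exact: ltry.
have iF' : (power_measure mu 2).-integrable setT (fun t =>
    (A (tnth t ord0, tnth t ord_max))%:E - (Q (tnth t ord0, tnth t ord_max))%:E)%E.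
  by apply: eq_integrable iF => // t _; rewrite FE.
(* The determinantal identity gives integrability of [A - Q] only. As [A] is integrable by the first
   moment, so is [Q]. *)
have iQ : (power_measure mu 2).-integrable setT
    (fun t => (Q (tnth t ord0, tnth t ord_max))%:E).
  have := integrableB measurableT iA iF'; apply: eq_integrable => // t _ /=.
  by rewrite -!EFinB subKr.
have QE : (\int[power_measure mu 2]_t (EFin \o Q) (tnth t ord0, tnth t ord_max)
    = \int[mu]_(z in B) \int[mu]_(w in B) (q (w, z))%:E)%E.
  apply: (etrans (integral_power_measure2 mu mQ Q0)).
  rewrite [RHS]integral_mkcond; apply: eq_integral => z _.
  rewrite patchE /Q/= indicE; case: ifPn => _; last first.
    by under eq_integral do rewrite mulr0 mul0r; rewrite integral0.
  rewrite [RHS]integral_mkcond; apply: eq_integral => w _.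
  by rewrite patchE indicE; case: ifPn => _; rewrite ?mul1r ?mul0r.
split=> //; first by rewrite -QE; exact: integrable_fin_num.
case: eqSF => e1 _; move: (congr1 EFin e1); rewrite /Rintegral.
under eq_integral do rewrite SE.
under [in RHS]eq_integral do rewrite FE.
rewrite !fineK ?integrable_fin_num// => ->.
by rewrite -AE -QE; exact: (integralB measurableT iA iQ).
Qed.

(** The variance is [E[N(N-1)] + E[N] - E[N]^2], in which the squares of the first moment cancel.
    Finiteness is part of the conclusion because the integral of [q] is cancelled later. *)
Lemma determinantal_variance :
  (\int[mu]_(z in B) (a z)%:E \is a fin_num)%E /\
  (\int[mu]_(z in B) \int[mu]_(w in B) (q (w, z))%:E \is a fin_num)%E /\
  ('V_P[N] = \int[mu]_(z in B) (a z)%:E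
     - \int[mu]_(z in B) \int[mu]_(w in B) (q (w, z))%:E)%E.
Proof.
have [iN eN] := expected_count; have [iNN fQ eNN] := expected_pairs.
have fA : (\int[mu]_(z in B) (a z)%:E \is a fin_num)%E.
  by rewrite -eN; exact: integrable_fin_num.
split=> //; split=> //.
have iN2 : P.-integrable setT (fun X => (N X ^+ 2)%:E).
  have := integrableD measurableT iNN iN; apply: eq_integrable => // X _ /=.
  by rewrite -EFinD; congr EFin; ring.
have mN : measurable_fun setT N by apply/measurable_EFinP; exact: measurable_int iN.
rewrite varianceE; last exact: Lfun2_sqr_integrable.
rewrite unlock eN (_ : \int[P]_X _ = \int[P]_X ((N X * (N X - 1))%:E + (N X)%:E))%E; last first.
  apply: eq_integral => X _; rewrite -EFinD; congr EFin; rewrite [LHS](_ : _ = N X ^+ 2)//; ring.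
rewrite integralD// eN eNN -(fineK fA) -(fineK fQ).
by rewrite !expe2 -!EFinM -!EFinD; congr EFin; ring.
Qed.

End determinantal_variance.

(** * The hyperbolic kernel *)

Section complex_power.
Context (R : realType).
Implicit Types (w : R[i]) (a : R).

Lemma carg_pos w : 0 < complex.Re w -> complex.Im w = 0 -> carg w = 0.
Proof.
case: w => x y /= x0 ->; rewrite /carg /= lexx /normc expr0n addr0 sqrtr_sqr.
by rewrite gtr0_norm// divff ?gt_eqF// acos1.
Qed.

(** A positive real part excludes the negative real axis, where the principal argument is not
    odd. *)
Lemma carg_conj w : 0 < complex.Re w -> carg (w^*)%C = - carg w.
Proof.
have [I0|I0] := eqVneq (complex.Im w) 0.
  by case: w I0 => x y /= -> x0; rewrite !carg_pos ?oppr0.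
case: w I0 => x y /= y0 _; rewrite /carg /normc /= sqrrN oppr_ge0.
by case: ltrgt0P y0 => // _ _; rewrite opprK.
Qed.

Lemma cpow_mul_conj w a : 0 < complex.Re w ->
  cpow w a * cpow (w^*)%C a = ((normc w ^+ 2) `^ a)%:C%C.
Proof.
move=> w0; have n0 : 0 <= normc w by case: w {w0} => x y; exact: sqrtr_ge0.
rewrite /cpow carg_conj// mulrN cosN sinN.
have -> : normc (w^*)%C = normc w by case: w {w0 n0} => x y; rewrite /normc/= sqrrN.
rewrite mulrACA -rmorphM/=; set t := a * _.
have -> : (cos t +i* sin t * (cos t +i* - sin t))%C = 1.
  apply/eqP; rewrite eq_complex/=; apply/andP; split; apply/eqP.
    by rewrite -[RHS](cos2Dsin2 t); ring.
  by ring.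
by rewrite mulr1 -powRM ?expr2.
Qed.

Lemma cpow_real (x a : R) : 0 < x -> cpow (x%:C)%C a = (x `^ a)%:C%C.
Proof.
move=> x0; rewrite /cpow carg_pos//= mulr0 cos0 sin0.
rewrite /normc/= expr0n addr0 sqrtr_sqr gtr0_norm//.
by apply/eqP; rewrite eq_complex/=; rewrite !mulr0 mulr1 !mul0r subr0 addr0 !eqxx.
Qed.
End complex_power.

Section kernel.
Context (R : realType).
Implicit Types (z w : plane R) (nu : R).

Lemma normc_toC z : normc (toC z) ^+ 2 = sqnorm z.
Proof. by rewrite /normc/= sqr_sqrtr// addr_ge0// sqr_ge0. Qed.

Lemma cdiskE (r : R) : 0 < r -> cdisk r = [set z | sqnorm z < r ^+ 2].
Proof.
move=> r0; apply/seteqP; split => z /=; rewrite -normc_toC.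
  by move=> zr; rewrite ltr_pXn2r// ?nnegrE ?sqrtr_ge0// ltW.
by rewrite ltr_pXn2r// ?nnegrE ?sqrtr_ge0// ltW.
Qed.

Lemma kernel_factor_conj z w :
  1 - toC w * ((toC z)^*)%C = ((1 - toC z * ((toC w)^*)%C)^*)%C.
Proof. by apply/eqP; rewrite eq_complex/=; apply/andP; split; apply/eqP; ring. Qed.

Lemma normc_kernel_factor z w : normc (1 - toC z * ((toC w)^*)%C) ^+ 2
  = 1 - 2 * (z.1 * w.1 + z.2 * w.2) + sqnorm z * sqnorm w.
Proof.
rewrite /normc/= sqr_sqrtr; last by rewrite addr_ge0// sqr_ge0.
by rewrite /sqnorm; ring.
Qed.

Lemma Re_kernel_factor z w : sqnorm z < 1 -> sqnorm w < 1 ->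
  0 < complex.Re (1 - toC z * ((toC w)^*)%C).
Proof.
rewrite /sqnorm /= => z1 w1.
have := sqr_ge0 (z.1 - w.1); have := sqr_ge0 (z.2 - w.2).
rewrite !sqrrB; lra.
Qed.

Lemma cosh2_distE z w : cosh2_dist z w = (sech2_dist z w)^-1.
Proof.
by rewrite /cosh2_dist !normc_toC normc_kernel_factor /sech2_dist invf_div.
Qed.

Lemma sech2_distC z w : sech2_dist z w = sech2_dist w z.
Proof.
by rewrite /sech2_dist; congr (_ / _); rewrite ?[_ * sqnorm z]mulrC; ring.
Qed.

Lemma kernel_factor_gt0 z w : sqnorm z < 1 -> sqnorm w < 1 ->
  0 < 1 - 2 * (z.1 * w.1 + z.2 * w.2) + sqnorm z * sqnorm w.
Proof.
move=> z1 w1; rewrite -normc_kernel_factor exprn_gt0//.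
have := Re_kernel_factor z1 w1; case: (1 - _) => x y /= x0.
by rewrite sqrtr_gt0 ltr_pwDl ?sqr_ge0// exprn_gt0.
Qed.

Lemma jacobi1 m (b : R) : jacobi m 0 b 1 = 1.
Proof.
rewrite /jacobi big_ord_recl /= big1 => [|i _]; last first.
  by rewrite subrr mul0r expr0n/= mulr0 mul0r.
rewrite addr0 subn0 addr0 gbinomial_nat binn expr0 mulr1.
rewrite (_ : (1 + 1) / 2 = 1 :> R); last by lra.
by rewrite expr1n mulr1 mul1r /gbinomial big_ord0 fact0 divr1.
Qed.

Lemma hyp_kernel_diag nu m z : sqnorm z < 1 ->
  hyp_kernel nu m z z =
  ((2 * (nu - m%:R) - 1) / pi * (1 - sqnorm z) `^ (- (2 * nu)))%:C%C.
Proof.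
move=> z1; have x0 : 0 < 1 - sqnorm z by rewrite subr_gt0.
rewrite /hyp_kernel.
have -> : 1 - toC z * ((toC z)^*)%C = (1 - sqnorm z)%:C%C.
  by apply/eqP; rewrite eq_complex/=; apply/andP; split; apply/eqP; rewrite /sqnorm; ring.
rewrite cpow_real// /cosh2_dist.
have -> : 1 - toC z * ((toC z)^*)%C = (1 - sqnorm z)%:C%C.
  by apply/eqP; rewrite eq_complex/=; apply/andP; split; apply/eqP; rewrite /sqnorm; ring.
rewrite !normc_toC /normc/= expr0n addr0 sqrtr_sqr gtr0_norm//.
rewrite -expr2 divff ?expf_neq0 ?gt_eqF// expr1n mul1r mulr1.
rewrite (_ : 2 - 1 = 1 :> R) ?jacobi1; last by lra.
by rewrite -!rmorphM/= mulr1.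
Qed.

(** The two complex powers have conjugate bases, so their phases cancel. The modulus [|1 - z w^*|^2]
    is then replaced by [(1 - |z|^2)(1 - |w|^2)/V]. *)
Lemma hyp_kernel_mul nu m z w : sqnorm z < 1 -> sqnorm w < 1 ->
  hyp_kernel nu m z w * hyp_kernel nu m w z =
  (profile (nu - m%:R) m (sech2_dist z w)
   * (1 - sqnorm z) `^ (- (2 * nu)) * (1 - sqnorm w) `^ (- (2 * nu)))%:C%C.
Proof.
move=> z1 w1; rewrite /hyp_kernel !cosh2_distE (sech2_distC w z).
rewrite !normc_kernel_factor !normc_toC (kernel_factor_conj z w).
set V := sech2_dist z w.
have x0 : 0 < 1 - sqnorm z by rewrite subr_gt0.
have y0 : 0 < 1 - sqnorm w by rewrite subr_gt0.
have Q0 := kernel_factor_gt0 z1 w1.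
have V0 : 0 < V by apply: divr_gt0 => //; exact: mulr_gt0.
have -> : (1 - sqnorm w) * (1 - sqnorm z)
  / (1 - 2 * (w.1 * z.1 + w.2 * z.2) + sqnorm w * sqnorm z) = V.
  by rewrite /V sech2_distC.
rewrite -/(sech2_dist z w) -/V.
rewrite mulrACA [X in X * _]mulrACA cpow_mul_conj ?Re_kernel_factor//.
rewrite normc_kernel_factor -!rmorphM /profile; congr (_%:C)%C.
have -> : (1 - 2 * (z.1 * w.1 + z.2 * w.2) + sqnorm z * sqnorm w)
    = (1 - sqnorm z) * (1 - sqnorm w) / V.
  by rewrite /V /sech2_dist invf_div mulrCA divff ?mulr1// mulf_neq0 ?gt_eqF.
rewrite powRM ?mulr_ge0 ?invr_ge0 ?ltW// powRM ?ltW//.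
(* From [2 nu = 2 (nu - m) + 2 m]. The two powers [V^m] cancel the factors [cosh^(2m) d] of the two
   kernels. *)
have -> : V^-1 `^ (- (2 * nu)) = (V `^ (nu - m%:R)) ^+ 2 * V ^+ m * V ^+ m.
  rewrite -powR_inv1 ?ltW// -powRrM -powR_mulrn ?powR_ge0// -powRrM.
  rewrite -!mulrA -powR_mulrn ?ltW// -!powRD ?(gt_eqF V0) ?implybT//.
  by congr powR; ring.
set J := jacobi _ _ _ _; rewrite exprVn.
move: (V ^+ m) (expf_neq0 m (lt0r_neq0 V0)) => Vm Vm0.
have : pi != 0 :> R by rewrite gt_eqF// pi_gt0.
move: (pi : R) => p p0.
set A := _ `^ (- _); set A' := _ `^ (- _); set B := V `^ _.
by field; rewrite ?p0 ?Vm0.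
Qed.

End kernel.

Section hyperbolic_integration.
Context (R : realType).
Implicit Types (z w : plane R) (nu r : R).

Lemma sqnorm_ge0 z : 0 <= sqnorm z.
Proof. by rewrite addr_ge0// sqr_ge0. Qed.

Lemma cdisk1E : @cdisk R 1 = [set z | sqnorm z < 1].
Proof. by rewrite cdiskE// expr1n. Qed.

Lemma compact_closed_disk r : compact [set z : plane R | sqnorm z <= r ^+ 2].
Proof.
apply: (@subclosed_compact _ _ (`[- `|r|, `|r|] `*` `[- `|r|, `|r|])).
- apply: (@closed_comp _ _ (@sqnorm R) [set x | x <= r ^+ 2]); last exact: closed_le.
  move=> z _; apply: cvgD.
    by apply: (cvg_comp fst (fun x : R => x ^+ 2)); [exact: cvg_fst|exact: exprn_continuous].
  by apply: (cvg_comp snd (fun x : R => x ^+ 2)); [exact: cvg_snd|exact: exprn_continuous].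
- by apply: compact_setX; exact: segment_compact.
- move=> z /= zr; split; rewrite /= in_itv/= -ler_norml -ler_sqr ?nnegrE//.
    rewrite !real_normK ?num_real//; apply: le_trans zr.
    by rewrite lerDl sqr_ge0.
  rewrite !real_normK ?num_real//; apply: le_trans zr.
  by rewrite lerDr sqr_ge0.
Qed.

Lemma hyp_densityE nu z : hyp_density nu z = (1 - sqnorm z) `^ (2 * nu - 2).
Proof. by rewrite /hyp_density normc_toC. Qed.

(** The power of [1 - |z|^2] carried by the kernel and the density of [lambda_nu] combine to the
    density of [lambda_0]. *)
Lemma hyp_density_area nu z : sqnorm z < 1 ->
  (1 - sqnorm z) `^ (- (2 * nu)) * hyp_density nu z = hyp_area z.
Proof.
move=> z1; have x0 : 0 < 1 - sqnorm z by rewrite subr_gt0.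
rewrite hyp_densityE -powRD ?(gt_eqF x0) ?implybT// addrA addNr add0r.
by rewrite powRN powR_mulrn// ltW.
Qed.

Lemma integral_hyp_measure nu (B : set (plane R)) (f : plane R -> \bar R) :
  measurable B -> B `<=` cdisk 1 -> measurable_fun setT f -> (forall z, 0 <= f z)%E ->
  (\int[hyp_measure nu]_(z in B) f z = \int[leb2]_(z in B) (f z * (hyp_density nu z)%:E))%E.
Proof.
move=> mB B1 mf f0.
have mD := @measurable_cdisk R 1.
(* [hyp_measure] is a measure on the whole plane, so its density must contain the indicator of the
   disk. *)
pose w z := (hyp_density nu z * \1_(cdisk 1) z)%:E : \bar R.
have mw : measurable_fun setT w.
  by apply/measurable_EFinP; apply: measurable_funM; [exact: measurable_hyp_density|exact: measurable_indic].
have w0 z : (0 <= w z)%E.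
  by rewrite lee_fin mulr_ge0 ?powR_ge0// indicE; case: (_ \in _).
have nuE A : measurable A -> hyp_measure nu A = (\int[leb2]_(z in A) w z)%E.
  move=> mA; rewrite /hyp_measure integral_mkcondr; apply: eq_integral => z _.
  by rewrite patchE /w indicE; case: ifPn => _; rewrite ?mulr1 ?mulr0.
have mfB : measurable_fun setT (f \_ B).
  by apply: (measurable_restrictT _ mB).1; exact: measurable_funTS.
have fB0 z : (0 <= (f \_ B) z)%E by rewrite erestrict_ge0.
rewrite [LHS]integral_mkcond.
apply: (etrans (ge0_integral_density mw w0 (fun z => erefl) nuE mfB fB0)).
rewrite [RHS]integral_mkcond; apply: eq_integral => z _.
rewrite !patchE; case: ifPn => [/set_mem/B1 z1|_]; last by rewrite mul0e.
by rewrite /w indicE mem_set// mulr1.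
Qed.

End hyperbolic_integration.

Section hyperbolic_variance.
Context (R : realType) (nu : R) (m : nat).
Hypothesis e12 : 1 / 2 < nu - m%:R.
Context (P : probability (configuration_space (@cdisk R 1)) R).
Hypothesis hP : hyperbolic_type_process nu m P.
Local Notation b := (2 * (nu - m%:R) - 1).
Local Notation H := (profile (nu - m%:R) m).
Local Notation D := [set w : plane R | sqnorm w < 1].

Let mH : measurable_fun setT H := measurable_profile _ m.
Let H0 v : 0 <= H v := profile_ge0 (nu - m%:R) m v.

Let b0 : 0 < b. Proof. by move: e12; lra. Qed.

Let mpow (a : R) : measurable_fun setT (fun z : plane R => (1 - sqnorm z) `^ a).
Proof.
by apply: (measurableT_comp (measurable_powR a)); rewrite /sqnorm; mfun.
Qed.

(* |G(z,w)|^2 lambda_nu(dz) lambda_nu(dw) in terms of Lebesgue measure. *)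
Definition pair_energy (p : plane R * plane R) : \bar R :=
  (H (sech2_dist p.1 p.2) * hyp_area p.1 * hyp_area p.2)%:E.

Let marea : measurable_fun setT (@hyp_area R).
Proof. by rewrite /hyp_area /sqnorm; mfun. Qed.

Let msech : measurable_fun setT (fun p : plane R * plane R => sech2_dist p.1 p.2).
Proof. by rewrite /sech2_dist /sqnorm; mfun. Qed.

Let area_ge0 (z : plane R) : 0 <= hyp_area z.
Proof. by rewrite invr_ge0 sqr_ge0. Qed.

Lemma measurable_pair_energy : measurable_fun setT pair_energy.
Proof.
apply/measurable_EFinP; apply: measurable_funM; first apply: measurable_funM.
- exact: (measurableT_comp mH msech).
- exact: (measurableT_comp marea measurable_fst).
- exact: (measurableT_comp marea measurable_snd).
Qed.

Lemma pair_energy_ge0 p : (0 <= pair_energy p)%E.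
Proof. by rewrite lee_fin; apply: mulr_ge0 => //; exact: mulr_ge0. Qed.

Lemma measurable_annulus (I : interval R) :
  measurable [set z : plane R | [set` I] (sqnorm z)].
Proof.
have mI : measurable ([set` I] : set (measurableTypeR R)) by exact: measurable_itv.
exact: (measurable_sqnorm_lt mI).
Qed.

(** The reproducing property: the right side is [G(z,z)] times the density of [lambda_nu] at [z].
    The constant is [pi] times the value [b/pi^2] of [integral_profile]. *)
Lemma pair_energy_total (z : plane R) : sqnorm z < 1 ->
  (\int[leb2]_(w in D) pair_energy (z, w) =
   (b / pi * hyp_area z)%:E)%E.
Proof.
move=> z1; have H' := integral_sech2_dist mH H0 z1.
rewrite integral_profile// -EFinM in H'.
transitivity (\int[leb2]_(w in D)
    ((hyp_area z)%:E * (H (sech2_dist z w) * hyp_area w)%:E))%E.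
  by apply: eq_integral => w _; rewrite -EFinM /pair_energy/=; congr EFin; ring.
rewrite ge0_integralZl//.
- rewrite H' -EFinM; congr EFin; have : pi != 0 :> R by rewrite gt_eqF// pi_gt0.
  by move: (pi : R) => p p0; field; rewrite ?p0.
- by have := @measurable_cdisk R 1; rewrite cdisk1E.
- apply: measurable_funTS; apply/measurable_EFinP; apply: measurable_funM => //.
  apply: (measurableT_comp mH).
  by rewrite /sech2_dist /sqnorm; mfun.
- by move=> w _; rewrite lee_fin; exact: mulr_ge0.
- by rewrite lee_fin.
Qed.

Lemma hyperbolic_variance r : 0 < r < 1 ->
  ('V_P[number_in_disk r] =
   \int[leb2]_(z in [set z | `]-oo, (r ^+ 2)%R[%classic (sqnorm z)])
     \int[leb2]_(w in [set w | `[(r ^+ 2)%R, 1%R[%classic (sqnorm w)])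
       pair_energy (z, w))%E.
Proof.
move=> /andP[r0 r1]; have r21 : r ^+ 2 < 1 by rewrite expr_lt1// ltW.
set B := [set z : plane R | `]-oo, r ^+ 2[%classic (sqnorm z)].
have BE : cdisk r = B.
  by rewrite cdiskE//; apply/seteqP; split => z; rewrite /B/= in_itv.
set A := [set w : plane R | `[r ^+ 2, 1[%classic (sqnorm w)].
have mA : measurable A := measurable_annulus _.
have mB : measurable B := measurable_annulus _.
have Blt1 z : B z -> sqnorm z < 1.
  by rewrite /B/= in_itv/= => /lt_trans; exact.
have B1 : B `<=` cdisk 1 by rewrite cdisk1E => z /Blt1.
pose a (z : plane R) := b / pi * (1 - sqnorm z) `^ (- (2 * nu)).
pose q (p : plane R * plane R) := H (sech2_dist p.1 p.2)
  * (1 - sqnorm p.1) `^ (- (2 * nu)) * (1 - sqnorm p.2) `^ (- (2 * nu)).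
have ma : measurable_fun setT a by apply: measurable_funM.
have a0 z : 0 <= a z.
  by apply: mulr_ge0; [rewrite divr_ge0 ?pi_ge0// ltW|exact: powR_ge0].
have mq : measurable_fun setT q.
  apply: measurable_funM; first apply: measurable_funM.
  - exact: (measurableT_comp mH msech).
  - exact: (measurableT_comp (mpow _) measurable_fst).
  - exact: (measurableT_comp (mpow _) measurable_snd).
have q0 p : 0 <= q p.
  by apply: mulr_ge0; [apply: mulr_ge0 => //; exact: powR_ge0|exact: powR_ge0].
have BC : B `<=` [set z | sqnorm z <= r ^+ 2].
  by move=> z; rewrite /B/= in_itv/= => /ltW.
have CE : [set z : plane R | sqnorm z <= r ^+ 2] `<=` cdisk 1.
  by rewrite cdisk1E => z /= /le_lt_trans; exact.
have Ka z : B z -> hyp_kernel nu m z z = (a z)%:C%C.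
  by move=> Bz; exact/hyp_kernel_diag/Blt1.
have Kq z w : B z -> B w ->
    complex.Re (hyp_kernel nu m z w * hyp_kernel nu m w z) = q (z, w).
  by move=> /Blt1 z1 /Blt1 w1; rewrite hyp_kernel_mul.
have [_ [fQ]] := determinantal_variance hP mB (@compact_closed_disk R r) BC CE
  ma a0 mq q0 Ka Kq.
rewrite /number_in_disk BE => ->.
have mE := measurable_pair_energy; have E0 := pair_energy_ge0.
have QE : (\int[hyp_measure nu]_(z in B) \int[hyp_measure nu]_(w in B) (q (w, z))%:E
    = \int[leb2]_(z in B) \int[leb2]_(w in B) pair_energy (z, w))%E.
  pose F z := (\int[hyp_measure nu]_(w in B) (q (w, z))%:E)%E.
  have mF : measurable_fun setT F.
    apply: (@measurable_integral_snd _ _ _ _ _ (hyp_measure nu) B (fun p => (q (p.2, p.1))%:E)) => //.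
      apply/measurable_EFinP; apply: (measurableT_comp mq).
      by apply: measurable_fun_pair; [exact: measurable_snd|exact: measurable_fst].
    by move=> p; rewrite lee_fin.
  have F0 z : (0 <= F z)%E by apply: integral_ge0 => w _; rewrite lee_fin.
  apply: (etrans (integral_hyp_measure nu mB B1 mF F0)).
  apply: eq_integral => z /set_mem /Blt1 z1.
  have mqz : measurable_fun setT (fun w => (q (w, z))%:E).
    apply/measurable_EFinP; apply: (measurableT_comp mq).
    by apply: measurable_fun_pair.
  have qz0 w : (0 <= (q (w, z))%:E)%E by rewrite lee_fin.
  rewrite /F (integral_hyp_measure nu mB B1 mqz qz0) -ge0_integralZr//.
  - apply: eq_integral => w /set_mem /Blt1 w1.
    rewrite -!EFinM /pair_energy/= -(hyp_density_area nu z1) -(hyp_density_area nu w1).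
    by rewrite /q/= sech2_distC; congr EFin; ring.
  - apply: measurable_funTS; apply: emeasurable_funM => //.
    by apply/measurable_EFinP; exact: measurable_hyp_density.
  - by move=> w _; rewrite mule_ge0// lee_fin powR_ge0.
  - by rewrite lee_fin powR_ge0.
rewrite QE in fQ *.
have mEa : measurable_fun setT (EFin \o a) by exact/measurable_EFinP.
have a0' z : (0 <= (a z)%:E)%E by rewrite lee_fin.
rewrite (integral_hyp_measure nu mB B1 mEa a0').
pose S C z := (\int[leb2]_(w in C) pair_energy (z, w))%E.
have mS C : measurable C -> measurable_fun B (S C).
  move=> mC; apply: measurable_funTS.
  exact: (@measurable_integral_snd _ _ _ _ _ leb2 C pair_energy).
have S0 C z : B z -> (0 <= S C z)%E by move=> _; exact: integral_ge0.
(* Here [x] will be the double integral over [B x B]. Its finiteness [fQ] makes the cancellation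
   valid in the extended reals. *)
have addKK (x y : \bar R) : x \is a fin_num -> (x + y - x = y)%E.
  by move=> fx; rewrite addeAC subee// add0e.
have SD := ge0_integralD leb2 mB (S0 B) (mS B mB) (S0 A) (mS A mA).
rewrite -/(S B) in fQ *; rewrite -/(S A).
transitivity (\int[leb2]_(z in B) (S B z + S A z) - \int[leb2]_(z in B) S B z)%E; last first.
  apply: (etrans (congr1 (fun x => x - _)%E SD)).
  exact: (addKK _ _ fQ).
congr (_ - _)%E.
apply: eq_integral => z /set_mem /Blt1 z1.
rewrite /S -ge0_integral_setU//.
- rewrite /a -EFinM -(mulrA (b / pi)) hyp_density_area// -pair_energy_total//.
  congr (integral _ _ _); apply/seteqP; split => w; rewrite /A /B /setU/= !in_itv/=.
    by move=> w1; case: ltP => wr; [left|right].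
  by move=> [/lt_trans->//|/andP[]].
- apply: measurable_funTS; apply: (measurableT_comp mE).
  by apply: measurable_fun_pair.
- rewrite disj_set2E; apply/eqP/seteqP; split => // w; rewrite /B /A/= !in_itv/=.
  by move=> [wr /andP[]]; rewrite leNgt wr.
Qed.

End hyperbolic_variance.

(** * The constant and the limit *)

Section hyperbolic_functions.
Context (R : realType).
Implicit Types (x v : R).

Lemma cosh2Bsinh2 x : cosh x ^+ 2 - sinh x ^+ 2 = 1.
Proof.
rewrite -[RHS](expRxMexpNx_1 x) /cosh /sinh.
by move: (expR x) (expR (- x)) => p q; field.
Qed.

Lemma cosh2_surjective (y : R) : 1 <= y -> exists d, 0 <= d /\ cosh d ^+ 2 = y.
Proof.
move=> y1; pose c := Num.sqrt y; pose s := Num.sqrt (y - 1).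
have c2 : c ^+ 2 = y by rewrite sqr_sqrtr// (le_trans ler01).
have s2 : s ^+ 2 = y - 1 by rewrite sqr_sqrtr// subr_ge0.
have c1 : 1 <= c by rewrite -sqrtr1 ler_wsqrtr.
have s0 : 0 <= s := sqrtr_ge0 _.
have cs0 : 0 < c + s by rewrite ltr_pwDl// (lt_le_trans ltr01).
(* This is the inverse hyperbolic cosine of [sqrt y]; note that [(c + s)(c - s) = 1]. *)
exists (ln (c + s)); split; first by rewrite ln_ge0// (le_trans c1)// lerDl.
rewrite -c2 /cosh expRN lnK ?posrE//.
have -> : (c + s)^-1 = c - s.
  apply: (mulfI (lt0r_neq0 cs0)); rewrite divff ?gt_eqF// mulrC -subr_sqr c2 s2; ring.
by congr (_ ^+ 2); field.
Qed.

Lemma acos_atan v : 0 < v <= 1 -> acos (2 * v - 1) = 2 * atan (Num.sqrt (v^-1 - 1)).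
Proof.
move=> /andP[v0 v1]; set y := Num.sqrt _.
have y2 : y ^+ 2 = v^-1 - 1 by rewrite sqr_sqrtr// subr_ge0 invf_ge1.
have -> : 2 * v - 1 = cos (atan y *+ 2).
  rewrite cos_mulr2n cos_atan exprVn sqr_sqrtr; last by rewrite addr_ge0// sqr_ge0.
  by rewrite y2 [1 + _]addrC subrK invrK mulr_natl.
have a0 : 0 <= atan y by rewrite -(atan0 R); apply: le_atan; exact: sqrtr_ge0.
have a1 := atan_ltpi2 y.
have -> : atan y *+ 2 = 2 * atan y by rewrite mulr_natl.
apply: cosK; rewrite in_itv/=; apply/andP; split; first by rewrite mulr_ge0.
lra.
Qed.

End hyperbolic_functions.

Section variance_constant.
Context (R : realType) (nu : R) (m : nat).
Hypothesis e12 : 1 / 2 < nu - m%:R.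
Local Notation mu := (@lebesgue_measure R).
Local Notation b := (2 * (nu - m%:R) - 1).
Local Notation H := (profile (nu - m%:R) m).
Local Notation angle v := (atan (Num.sqrt (v^-1 - 1))).

Lemma sech2_dist0 (z : plane R) : sech2_dist (0, 0) z = 1 - sqnorm z.
Proof.
have s0 : sqnorm ((0, 0) : plane R) = 0 by rewrite /sqnorm/= expr0n/= addr0.
by rewrite /sech2_dist s0 /= !mul0r !addr0 mulr0 !subr0 divr1 mul1r.
Qed.

(** The chosen distance enters only through [cosh^2 d], because [tanh^2 d = 1 - cosh^-2 d]. *)
Lemma tanh_hyp_dist (z : plane R) : sqnorm z < 1 ->
  tanh (hyp_dist z (0, 0)) ^+ 2 = sqnorm z.
Proof.
move=> z1; have v0 : 0 < 1 - sqnorm z by rewrite subr_gt0.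
have z0 := sqnorm_ge0 z.
have : cosh (hyp_dist z (0, 0)) ^+ 2 = cosh2_dist z (0, 0).
  have [|_ ->//] := @getPex _ [set d : R | 0 <= d /\ cosh d ^+ 2 = cosh2_dist z (0, 0)].
  apply: cosh2_surjective; rewrite cosh2_distE sech2_distC sech2_dist0.
  by rewrite invf_ge1// gerBl.
move: (hyp_dist z (0, 0)) => d; rewrite cosh2_distE sech2_distC sech2_dist0 => dE.
have := cosh2Bsinh2 d; rewrite /tanh dE => h; rewrite expr_div_n dE invrK.
have -> : sinh d ^+ 2 = (1 - sqnorm z)^-1 - 1.
  by move: h; move: (sinh d ^+ 2) (_^-1) => x y h; lra.
by rewrite mulrBl mulVf ?gt_eqF// mul1r subKr.
Qed.

Lemma f_hyp_dist (z : plane R) : sqnorm z < 1 ->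
  f_ nu m (hyp_dist z (0, 0)) = H (1 - sqnorm z).
Proof.
move=> z1; rewrite /f_ tanh_hyp_dist// /profile; congr ((_ * jacobi _ _ _ _) ^+ 2); ring.
Qed.

Let mangle : measurable_fun setT (fun v : R => angle v).
Proof. by apply: (measurableT_comp (continuous_measurable_fun (@continuous_atan R))); mfun. Qed.

Let angle_ge0 v : 0 <= angle v :> R.
Proof. by rewrite -(atan0 R); apply: le_atan; exact: sqrtr_ge0. Qed.

(** With [v = 1 - |z|^2] the arccosine is [arccos(2 v - 1)], twice the angle. The integral is then
    radial, the case of centre 0 in [integral_sech2_dist]. *)
Lemma integral_variance_constant :
  (\int[hyp_measure 0]_(z in @cdisk R 1) (f_ nu m (hyp_dist z (0%R, 0%R))
     * acos (1 - 2 * normc (toC z) ^+ 2))%:E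
  = (2 * pi)%:E * \int[mu]_(v in `]0%R, 1%R[) (H v * v ^- 2 * angle v)%:E)%E.
Proof.
pose G v : R := H v * (2 * angle v).
have mG : measurable_fun setT G.
  by apply: measurable_funM; [exact: measurable_profile|exact: measurable_funM].
have G0 v : 0 <= G v by rewrite mulr_ge0 ?profile_ge0// mulr_ge0.
transitivity (\int[hyp_measure 0]_(z in @cdisk R 1) (G (1 - sqnorm z))%:E)%E.
  apply: eq_integral => z /set_mem; rewrite cdisk1E/= => z1.
  rewrite f_hyp_dist// /G normc_toC; congr (_ * _)%:E.
  rewrite -acos_atan; last by rewrite subr_gt0 z1 gerBl sqnorm_ge0.
  by congr acos; ring.
have mGs : measurable_fun setT (fun z : plane R => (G (1 - sqnorm z))%:E).
  apply/measurable_EFinP; apply: (measurableT_comp mG).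
  by rewrite /sqnorm; mfun.
apply: (etrans (integral_hyp_measure 0 (@measurable_cdisk R 1) (@subset_refl _ _) mGs _)).
  by move=> z; rewrite lee_fin.
transitivity (\int[leb2]_(z in [set z : plane R | (sqnorm z < 1)%R])
    (G (sech2_dist (0%R, 0%R) z) * hyp_area z)%:E)%E.
  rewrite cdisk1E; apply: eq_integral => z /set_mem/= z1.
  rewrite -EFinM sech2_dist0; congr (_ * _)%:E.
  by rewrite -(hyp_density_area 0)// mulr0 oppr0 powRr0 mul1r.
have z01 : sqnorm ((0, 0) : plane R) < 1 by rewrite /sqnorm/= expr0n/= addr0.
apply: (etrans (integral_sech2_dist mG G0 z01)).
transitivity (pi%:E * \int[mu]_(v in `]0%R, 1%R[) (2%:E * (H v * v ^- 2 * angle v)%:E))%E.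
  congr (_ * _)%E; apply: eq_integral => v _; rewrite -EFinM /G; congr EFin; ring.
rewrite ge0_integralZl//.
- by rewrite muleA -EFinM [pi * 2]mulrC.
- by apply: measurable_funTS; apply/measurable_EFinP; apply: measurable_funM => //;
    apply: measurable_funM; [exact: measurable_profile|mfun].
- move=> v _; rewrite lee_fin; apply: mulr_ge0 => //.
  by apply: mulr_ge0; [exact: profile_ge0|rewrite invr_ge0 sqr_ge0].
Qed.

(** The angle is positive on []0, 1[]. If the integral vanished, [H(v) v^-2] would be 0 almost
    everywhere, contradicting its integral [b/pi^2 > 0]. *)
Lemma variance_integral_gt0 :
  (0 < \int[mu]_(v in `]0%R, 1%R[) (H v * v ^- 2 * angle v)%:E)%E.
Proof.
have mI : measurable (`]0, 1[%classic : set (measurableTypeR R)) by exact: measurable_itv.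
have mh : measurable_fun (`]0, 1[%classic : set (measurableTypeR R))
    (fun v : R => (H v * v ^- 2 * angle v)%:E).
  by apply: measurable_funTS; apply/measurable_EFinP; apply: measurable_funM => //;
    apply: measurable_funM; [exact: measurable_profile|mfun].
have mk : measurable_fun (`]0, 1[%classic : set (measurableTypeR R))
    (fun v : R => (H v * v ^- 2)%:E).
  by apply: measurable_funTS; apply/measurable_EFinP;
    apply: measurable_funM; [exact: measurable_profile|mfun].
have Hv0 v : 0 <= H v * v ^- 2.
  by apply: mulr_ge0; [exact: profile_ge0|rewrite invr_ge0 sqr_ge0].
rewrite lt0e integral_ge0 ?andbT => [|v _]; last by rewrite lee_fin mulr_ge0.
apply/eqP => h0.
have := integral_profile m e12.
suff -> : (\int[mu]_(v in `]0%R, 1%R[) (H v * v ^- 2)%:E = 0)%E.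
  move=> /eqP; rewrite eqe eq_sym mulf_eq0 invr_eq0 expf_eq0/=.
  by rewrite (gt_eqF (pi_gt0 R)) orbF gt_eqF//; move: e12; lra.
have /(ae_eq_integral_abs mu mI mh) h1 :
    (\int[mu]_(v in `]0%R, 1%R[) `|(H v * v ^- 2 * angle v)%:E| = 0)%E.
  by rewrite -[RHS]h0; apply: eq_integral => v _; rewrite gee0_abs// lee_fin mulr_ge0.
have : (\int[mu]_(v in `]0%R, 1%R[) `|(H v * v ^- 2)%:E| = 0)%E.
  apply/(ae_eq_integral_abs mu mI mk).
  apply: filterS h1 => v + /[dup] v01 => /[apply] /= [[]] /eqP.
  rewrite mulf_eq0 => /orP[/eqP -> //|]; rewrite gt_eqF//.
  move: v01; rewrite /= in_itv/= => /andP[v0 v1].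
  rewrite -(atan0 R); apply: lt_atan.
  by rewrite sqrtr_gt0 subr_gt0 invf_gt1.
by move=> <-; apply: eq_integral => v _; rewrite gee0_abs// lee_fin.
Qed.

End variance_constant.

Section asymptotics.
Context (R : realType) (nu : R) (m : nat).
Hypothesis e12 : 1 / 2 < nu - m%:R.
Context (P : probability (configuration_space (@cdisk R 1)) R).
Hypothesis hP : hyperbolic_type_process nu m P.
Local Notation mu := (@lebesgue_measure R).
Local Notation H := (profile (nu - m%:R) m).

Let limit_value := (\int[leb2 \x mu]_(u in boundary_region 0) (scaled_integrand H 0 u)%:E)%E.

Let mH : measurable_fun setT H := measurable_profile (nu - m%:R) m.
Let H0 v : 0 <= H v := profile_ge0 (nu - m%:R) m v.

Let gam1 : 1 < 2 * (nu - m%:R).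
Proof. by move: e12; lra. Qed.

Let limit_fin : limit_value \is a fin_num.
Proof.
have [M M0 HM] := profile_bound (nu - m%:R) m.
rewrite ge0_fin_numE.
  exact: (scaled_integrand_lty mH H0 gam1 M0 HM).
rewrite /limit_value scaled_integrand0_value//.
by apply: mule_ge0; [rewrite lee_fin mulr_ge0// pi_ge0|exact/ltW/variance_integral_gt0].
Qed.

(** [variance_constant] is a real-valued integral, which is 0 by default when the extended one is
    infinite. The finiteness [limit_fin] excludes that case. *)
Lemma variance_constantE : (variance_constant nu m)%:E = limit_value.
Proof.
rewrite /variance_constant /Rintegral integral_variance_constant//.
by rewrite -scaled_integrand0_value// fineK.
Qed.

Lemma variance_constant_gt0 : 0 < variance_constant nu m.
Proof.
rewrite -lte_fin variance_constantE /limit_value scaled_integrand0_value//.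
apply: mule_gt0; last exact: variance_integral_gt0.
by rewrite lte_fin mulr_gt0// pi_gt0.
Qed.

Lemma scaled_variance r : 0 < r < 1 ->
  ((1 - r ^+ 2)%:E * 'V_P[number_in_disk r] =
   \int[leb2 \x mu]_(u in boundary_region (1 - r ^+ 2)%R)
     (scaled_integrand H (1 - r ^+ 2) u)%:E)%E.
Proof.
move=> r01; have /andP[r0 r1] := r01.
have r2 : 0 < 1 - r ^+ 2 < 1.
  by rewrite subr_gt0 expr_lt1 ?(ltW r0)//= r1/= gtrBl exprn_gt0.
rewrite (hyperbolic_variance e12 hP r01).
have := boundary_integral mH H0 r2; rewrite subKr => ->.
have /andP[e0 _] := r2.
have mb := @measurable_boundary_region R (1 - r ^+ 2).
rewrite -ge0_integralZl//.
- by apply: eq_integral => u _; rewrite -EFinM scaled_integrandE// gt_eqF.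
- apply: measurable_funTS; apply/measurable_EFinP.
  exact: (measurable_boundary_integrand mH).
- by move=> u _; rewrite lee_fin; exact: boundary_integrand_ge0.
- by rewrite lee_fin ltW.
Qed.

Lemma variance_asymptotics :
  ('V_P[number_in_disk r] / (variance_constant nu m / (1 - r ^+ 2))%:E)%E
    @[r --> 1^'-] --> 1%:E.
Proof.
have [M M0 HM] := profile_bound (nu - m%:R) m.
set C := variance_constant nu m.
have C0 : 0 < C := variance_constant_gt0.
apply/cvge_at_leftP => u [u1 ucvg].
have [N _ uN] : \forall n \near \oo, 0 < u n.
  exact: (cvgr_gt 1 ucvg 0 ltr01).
pose v n := u (n + N)%N.
have v01 n : 0 < v n < 1 by rewrite /v u1 uN//= leq_addl.
have e0 n : 0 < 1 - v n ^+ 2.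
  by have /andP[v0 v1] := v01 n; rewrite subr_gt0 expr_lt1 ?(ltW v0).
have vcvg : v @ \oo --> (1 : R) by rewrite /v cvg_shiftn.
have ecvg : (fun n => 1 - v n ^+ 2) @ \oo --> (0 : R).
  rewrite -(subrr 1) -[X in _ --> _ - X](expr1n _ 2).
  by apply: cvgB; [exact: cvg_cst|apply: (cvg_comp v (fun x : R => x ^+ 2) vcvg); exact: exprn_continuous].
have lim := boundary_limit mH H0 gam1 M0 HM (@continuous_profile _ _ _) e0 ecvg.
rewrite -(cvg_shiftn N).
suff : ('V_P[number_in_disk (v n)] / (C / (1 - v n ^+ 2))%:E)%E @[n --> \oo]
    --> (C%:E * (C^-1)%:E)%E by rewrite -EFinM divff ?gt_eqF.
have -> : (fun n => 'V_P[number_in_disk (v n)] / (C / (1 - v n ^+ 2))%:E)%E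
    = (fun n => (1 - v n ^+ 2)%:E * 'V_P[number_in_disk (v n)] * (C^-1)%:E)%E.
  apply/funext => n; rewrite inver mulf_eq0 invr_eq0 !gt_eqF//=.
  by rewrite invf_div EFinM muleA [X in (X * _)%E]muleC.
apply: cvgeZr => //.
rewrite variance_constantE.
by under eq_fun => n do rewrite scaled_variance//.
Qed.

End asymptotics.

Theorem theorem1 (R : realType) (nu : R) (m : nat)
    (hnu : 1 / 2 < nu)
    (hm : m%:Z <= Num.floor (nu - 1 / 2))
    (hnum : 2 * (nu - m%:R) - 1 != 0)
    (P : probability (configuration_space (@cdisk R 1)) R)
    (hP : hyperbolic_type_process nu m P) :
  ('V_P[number_in_disk r] / (variance_constant nu m / (1 - r ^+ 2))%:E)%E
    @[r --> 1^'-] --> 1%:E.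
Proof.
apply: variance_asymptotics => //.
(* The floor condition gives [nu - m >= 1/2], and [hnum] rules out equality. *)
have fl : m%:R <= nu - 1 / 2.
  apply: le_trans (floor_le (nu - 1 / 2)).
  by rewrite -[m%:R]/((m%:Z)%:~R) ler_int.
rewrite lt_neqAle; apply/andP; split; last by lra.
by apply: contra hnum => /eqP h; apply/eqP; lra.
Qed.
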